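(* Let $N\ge1$ and $T>0$. Assume that: (a) $u_0\in BUC(\mathbb{R}^N)$ (bounded and uniformly continuous); (b) $c_0\in C([0,T];L^1(\mathbb{R}^N))$, $D_xc_0\in L^\infty([0,T];L^1(\mathbb{R}^N))$, and $c_0\ge0$ on $\mathbb{R}^N\times[0,T]$; (c) $c_1\in C(\mathbb{R}^N\times[0,T])$ and there exist constants $M_1,L_1$ such that $|c_1(x,t)|\le M_1$ and $|c_1(x,t)-c_1(y,t)|\le L_1|x-y|$ for all $x,y\in\mathbb{R}^N$, $t\in[0,T]$. Then there exists a unique viscosity solution $u$ of $$\frac{\partial u}{\partial t}=\bigl(c_0(\cdot,t)\star\mathbf 1_{\{u(\cdot,t)\ge u(x,t)\}}(x)+c_1(x,t)\bigr)|Du|\ \text{ in }\mathbb{R}^N\times(0,T),\qquad u(\cdot,0)=u_0\ \text{ in }\mathbb{R}^N. \tag{S}$$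
   Context: Notation: $c_0,c_1$ are real-valued; $\mathbf 1_A$ is the indicator function of $A$; $\star$ is convolution in space only: $(c_0(\cdot,t)\star f)(x)=\int_{\mathbb{R}^N}c_0(x-z,t)f(z)\,dz$. For a function $u$ set $$c^+[u](x,t)=c_1(x,t)+\int_{\mathbb{R}^N}c_0(x-z,t)\mathbf 1_{\{u(\cdot,t)\ge u(x,t)\}}(z)\,dz,$$ $$c^-[u](x,t)=c_1(x,t)+\int_{\mathbb{R}^N}c_0(x-z,t)\mathbf 1_{\{u(\cdot,t)>u(x,t)\}}(z)\,dz.$$ **Viscosity solutions of (S) (Slepčev).** An upper-semicontinuous function $u:\mathbb{R}^N\times[0,T]\to\mathbb{R}$ is a viscosity subsolution of (S) if, for any $\varphi\in C^1(\mathbb{R}^N\times[0,T])$ and any maximum point $(\bar x,\bar t)$ of $u-\varphi$: if $\bar t>0$ then $\frac{\partial\varphi}{\partial t}(\bar x,\bar t)\le c^+[u](\bar x,\bar t)|D\varphi(\bar x,\bar t)|$, and if $\bar t=0$ then $u(\bar x,0)\le u_0(\bar x)$. A lower-semicontinuous function $u:\mathbb{R}^N\times[0,T]\to\mathbb{R}$ is a viscosity supersolution of (S) if, for any $\varphi\in C^1(\mathbb{R}^N\times[0,T])$ and any minimum point $(\bar x,\bar t)$ of $u-\varphi$: if $\bar t>0$ then $\frac{\partial\varphi}{\partial t}(\bar x,\bar t)\ge c^-[u](\bar x,\bar t)|D\varphi(\bar x,\bar t)|$, and if $\bar t=0$ then $u(\bar x,0)\ge u_0(\bar x)$. A locally bounded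 function is a viscosity solution of (S) if its upper-semicontinuous envelope is a subsolution and its lower-semicontinuous envelope is a supersolution of (S). *)

(* Defs.v *)
From HB Require Import structures.
From mathcomp Require Import all_boot all_order all_algebra.
From mathcomp Require Import all_classical all_reals all_analysis.

Set Implicit Arguments.
Unset Strict Implicit.
Unset Printing Implicit Defensive.

Import Order.TTheory GRing.Theory Num.Theory.
Import numFieldNormedType.Exports.

Local Open Scope classical_set_scope.
Local Open Scope ring_scope.

Definition measure_rV_display : measure_display.
Proof. exact: default_measure_display. Qed.

(* As for [n.-tuple T] in the library, R^n carries the sigma-algebra generated
   by the coordinates, i.e. its Borel sigma-algebra. *)
Section measurable_rV.
Context {R : realType} (n : nat).

Let coors : 'I_n -> 'rV[R]_n -> R := fun i x => x ord0 i.

Let rV_set0 : g_sigma_preimage coors set0.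
Proof. exact: sigma_algebra0. Qed.

Let rV_setC A : g_sigma_preimage coors A -> g_sigma_preimage coors (~` A).
Proof. exact: sigma_algebraC. Qed.

Let rV_bigcup (F : _^nat) : (forall i, g_sigma_preimage coors (F i)) ->
  g_sigma_preimage coors (\bigcup_i (F i)).
Proof. exact: sigma_algebra_bigcup. Qed.

HB.instance Definition _ := @isMeasurable.Build measure_rV_display
  'rV[R]_n (g_sigma_preimage coors) rV_set0 rV_setC rV_bigcup.

End measurable_rV.

Section lebesgue_measure_rV.
Context {R : realType}.

Lemma measurable_rV_coord n (i : 'I_n) :
  measurable_fun [set: 'rV[R]_n] (fun x => x ord0 i).
Proof.
move=> _ Y mY; rewrite setTI; apply: sub_sigma_algebra => /=.
rewrite -bigcup_seq/=; exists i => /=; first by rewrite mem_index_enum.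
by exists Y => //; rewrite setTI.
Qed.

Lemma measurable_fun_rV d (T : measurableType d) n (f : T -> 'rV[R]_n) :
  (forall i, measurable_fun [set: T] (fun x => f x ord0 i)) ->
  measurable_fun [set: T] f.
Proof.
move=> mf _ A mA; rewrite setTI.
suff : @measurable _ 'rV[R]_n `<=` [set B | measurable (f @^-1` B)] by exact.
apply: smallest_sub => [|B].
  split=> [|B /= mB|F /= mF].
  - by rewrite /= preimage_set0.
  - by rewrite setTD preimage_setC; exact: measurableC.
  - by rewrite preimage_bigcup; exact: bigcupT_measurable.
rewrite -bigcup_seq/= => -[i _ [Y mY <-]].
by rewrite setTI; have := mf i measurableT _ mY; rewrite setTI.
Qed.

Definition cons_rV n (p : R * 'rV[R]_n) : 'rV[R]_n.+1 :=
  row_mx (p.1)%:M p.2.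

Definition uncons_rV n (x : 'rV[R]_n.+1) : R * 'rV[R]_n :=
  (x ord0 ord0, \row_i x ord0 (lift ord0 i)).

Lemma cons_rV0 n (p : R * 'rV[R]_n) : cons_rV p ord0 ord0 = p.1.
Proof.
have -> : @ord0 n = lshift n (@ord0 0) by exact: val_inj.
by rewrite [LHS]row_mxEl mxE eqxx.
Qed.

Lemma cons_rVS n (p : R * 'rV[R]_n) i :
  cons_rV p ord0 (lift ord0 i) = p.2 ord0 i.
Proof.
have -> : lift (@ord0 n) i = rshift 1 i by exact: val_inj.
by rewrite [LHS]row_mxEr.
Qed.

Lemma cons_rVK n : cancel (@cons_rV n) (@uncons_rV n).
Proof.
move=> [a x]; rewrite /uncons_rV cons_rV0; congr pair.
by apply/rowP => i; rewrite mxE cons_rVS.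
Qed.

Lemma measurable_cons_rV n : measurable_fun setT (@cons_rV n).
Proof.
apply: measurable_fun_rV => i; case: (unliftP ord0 i) => [j|] ->.
  under eq_fun do rewrite cons_rVS.
  apply: (measurableT_comp (measurable_rV_coord j)).
  exact: measurable_snd.
under eq_fun do rewrite cons_rV0.
exact: measurable_fst.
Qed.

Lemma measurable_uncons_rV n : measurable_fun setT (@uncons_rV n).
Proof.
apply/measurable_fun_pairP; split; first exact: measurable_rV_coord.
apply: measurable_fun_rV => i /=.
under eq_fun do rewrite mxE.
exact: measurable_rV_coord.
Qed.

Section cons.
Variables (n : nat) (mu : {sigma_finite_measure set 'rV[R]_n -> \bar R}).

Definition cons_measure : set 'rV[R]_n.+1 -> \bar R :=
  pushforward (@lebesgue_measure R \x mu)%E (@cons_rV n).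

Let cons_measure0 : cons_measure set0 = 0%E.
Proof. by rewrite /cons_measure /pushforward preimage_set0 measure0. Qed.

Let cons_measure_ge0 A : (0 <= cons_measure A)%E.
Proof. by rewrite /cons_measure /pushforward measure_ge0. Qed.

Let cons_measure_sigma_additive : semi_sigma_additive cons_measure.
Proof.
move=> F mF tF mUF; have mc := @measurable_cons_rV n.
rewrite /cons_measure /pushforward preimage_bigcup.
apply: measure_semi_sigma_additive.
- by move=> k; rewrite -[X in measurable X]setTI; exact: mc.
- apply/trivIsetP => /= i j _ _ ij; rewrite -preimage_setI.
  by move/trivIsetP : tF => /(_ _ _ _ _ ij) ->//; rewrite preimage_set0.
- by rewrite -preimage_bigcup -[X in measurable X]setTI; exact: mc.
Qed.

HB.instance Definition _ := isMeasure.Build _ _ _ cons_measure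
  cons_measure0 cons_measure_ge0 cons_measure_sigma_additive.

Let cons_measure_sigma_finite : sigma_finite setT cons_measure.
Proof.
have /sigma_finiteP[F [TF ndF Foo]] := sigma_finiteT (@lebesgue_measure R).
have /sigma_finiteP[G [TG ndG Goo]] := sigma_finiteT mu.
exists (fun k => @uncons_rV n @^-1` (F k `*` G k)) => [|k].
  rewrite -preimage_bigcup; apply/esym; rewrite -(preimage_setT (@uncons_rV n)).
  congr (_ @^-1` _); rewrite -setXTT TF TG predeqE => -[x y]; split.
    by move=> [k _ []/= ? ?]; split; exists k.
  move=> [/= [k _ Fkx] [l _ Gly]]; exists (maxn k l) => //; split.
  - by move: x Fkx; exact/subsetPset/ndF/leq_maxl.
  - by move: y Gly; exact/subsetPset/ndG/leq_maxr.
have [[mF Fk] [mG Gk]] := (Foo k, Goo k); split.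
  rewrite -[X in measurable X]setTI; apply: measurable_uncons_rV => //.
  exact: measurableX.
rewrite /cons_measure /pushforward -comp_preimage.
rewrite (_ : @uncons_rV n \o @cons_rV n = id) ?preimage_id.
  by rewrite product_measure1E// lte_mul_pinfty// ge0_fin_numE.
by apply/funext => p /=; rewrite cons_rVK.
Qed.

HB.instance Definition _ := Measure_isSigmaFinite.Build _ _ _ cons_measure
  cons_measure_sigma_finite.

End cons.

Fixpoint lebesgue_rV n : {sigma_finite_measure set 'rV[R]_n -> \bar R} :=
  if n is m.+1 then cons_measure (lebesgue_rV m) else \d_(0 : 'rV[R]_0).

Lemma lebesgue_rV_box n (A : 'I_n -> set R) :
  (forall i, measurable (A i)) ->
  lebesgue_rV n [set x | forall i, A i (x ord0 i)] =
  (\prod_(i < n) lebesgue_measure (A i))%E.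
Proof.
elim: n A => [|n IH] A mA.
  rewrite big_ord0 /= diracE mem_set//=.
  by case.
rewrite big_ord_recl /=.
rewrite -(IH (fun i => A (lift ord0 i)))//.
rewrite -product_measure1E; [|exact: mA|]; last first.
  rewrite [X in measurable X](_ : _ = \bigcap_(i in [set: 'I_n])
      ((fun x : 'rV[R]_n => x ord0 i) @^-1` A (lift ord0 i))).
    apply: fin_bigcap_measurable => // i _.
    by rewrite -[X in measurable X]setTI; exact: measurable_rV_coord.
  by apply/seteqP; split => x /= h i; [move=> _|]; apply: h.
rewrite /cons_measure /pushforward; congr (product_measure1 _ _ _).
apply/seteqP; split => p /=.
  move=> h; split; first by have := h ord0; rewrite cons_rV0.
  by move=> i; have := h (lift ord0 i); rewrite cons_rVS.
move=> [h0 h] i; case: (unliftP ord0 i) => [j|] ->.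
  by rewrite cons_rVS.
by rewrite cons_rV0.
Qed.

End lebesgue_measure_rV.

Section slepcev.
Context {R : realType} {N : nat}.

Local Notation X := 'rV[R]_N.
Local Notation leb := (@lebesgue_rV R N).

(* [`|x|] on row vectors is the sup norm. *)
Definition enorm (x : X) : R := Num.sqrt (\sum_(i < N) x ord0 i ^+ 2).

Definition unit_vec (i : 'I_N) : X := delta_mx ord0 i.

Definition iter_partial (s : seq 'I_N) (f : X -> R) : X -> R :=
  foldr (fun i g => fun x => 'D_(unit_vec i) g x) f s.

Definition test_function (f : X -> R) :=
  (forall s, continuous (iter_partial s f) /\
     forall i x, derivable (iter_partial s f) x (unit_vec i)) /\
  exists2 K, compact K & forall x, ~ K x -> f x = 0.

Definition weak_gradient (f : X -> R) (G : X -> X) :=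
  forall phi, test_function phi -> forall i,
    \int[leb]_x (f x * 'D_(unit_vec i) phi x) =
    - \int[leb]_x (G x ord0 i * phi x).

Section strip.
Variable T : R.

(* Functions on R^N x [0,T] are represented by functions on R^N x R of which
   only the values on [strip] matter. *)
Definition strip : set (X * R) := [set p | 0 <= p.2 <= T].

Definition continuous_L1 (c : X * R -> R) :=
  (forall t, 0 <= t <= T -> (fun x => c (x, t)) \in Lfun leb 1%E) /\
  (forall t, 0 <= t <= T ->
     'N[leb]_1[(fun x => (c (x, s) - c (x, t))%:E)]%E
       @[s --> within `[0, T] (nbhs t)] --> 0%E).

(* D_x c belongs to L^oo([0,T]; L^1(R^N)); elements of this space are taken to
   be given by jointly measurable functions. *)
Definition gradient_Linfty_L1 (c : X * R -> R) :=
  exists G : X * R -> X,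
    measurable_fun strip G /\
    exists K : R, {ae (@lebesgue_measure R), forall t, 0 <= t <= T ->
      weak_gradient (fun x => c (x, t)) (fun x => G (x, t)) /\
      ('N[leb]_1[(fun x => (enorm (G (x, t)))%:E)] <= K%:E)%E}.

(* phi is C^1 on R^N x [0,T] (with one-sided time derivatives at 0 and T),
   dt and Dx being its time derivative and its space gradient. *)
Definition C1_with (phi dt : X * R -> R) (Dx : X * R -> X) :=
  [/\ forall x t, 0 <= t <= T ->
        (phi (x, s) - phi (x, t)) / (s - t)
          @[s --> within `[0, T] t^'] --> dt (x, t),
      forall x t, 0 <= t <= T -> forall i,
        is_derive x (unit_vec i) (fun y => phi (y, t)) (Dx (x, t) ord0 i),
      {within strip, continuous phi},
      {within strip, continuous dt} &
      {within strip, continuous Dx}].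

Definition locally_bounded (u : X * R -> R) :=
  forall p, strip p -> bounded_near u (within strip (nbhs p)).

(* The limits run over the points of the strip, the centre included; they are
   finite when u is locally bounded. *)
Definition usc_envelope (u : X * R -> R) (p : X * R) : R :=
  fine (limf_esup (EFin \o u) (within strip (nbhs p))).

Definition lsc_envelope (u : X * R -> R) (p : X * R) : R :=
  fine (limf_einf (EFin \o u) (within strip (nbhs p))).

Definition lsc_on_strip (u : X * R -> R) :=
  lower_semicontinuous (fun p : subspace strip => (u p)%:E).

Definition usc_on_strip (u : X * R -> R) := lsc_on_strip (\- u).

Definition max_point (f : X * R -> R) (p : X * R) :=
  strip p /\ forall q, strip q -> f q <= f p.

Definition min_point (f : X * R -> R) (p : X * R) :=
  strip p /\ forall q, strip q -> f p <= f q.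

Section equation.
Variables (c0 c1 : X * R -> R) (u0 : X -> R).

Definition c_plus (u : X * R -> R) (p : X * R) : R :=
  c1 p + \int[leb]_z (c0 (p.1 - z, p.2) * \1_[set y | u p <= u (y, p.2)] z).

Definition c_minus (u : X * R -> R) (p : X * R) : R :=
  c1 p + \int[leb]_z (c0 (p.1 - z, p.2) * \1_[set y | u p < u (y, p.2)] z).

Definition subsolution (u : X * R -> R) :=
  usc_on_strip u /\
  forall phi dt Dx, C1_with phi dt Dx -> forall p, max_point (u \- phi) p ->
    (0 < p.2 -> dt p <= c_plus u p * enorm (Dx p)) /\
    (p.2 = 0 -> u p <= u0 p.1).

Definition supersolution (u : X * R -> R) :=
  lsc_on_strip u /\
  forall phi dt Dx, C1_with phi dt Dx -> forall p, min_point (u \- phi) p ->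
    (0 < p.2 -> dt p >= c_minus u p * enorm (Dx p)) /\
    (p.2 = 0 -> u p >= u0 p.1).

Definition viscosity_solution (u : X * R -> R) :=
  [/\ locally_bounded u, subsolution (usc_envelope u)
    & supersolution (lsc_envelope u)].

End equation.
End strip.
End slepcev.

(* Main.v *)
Require Import Defs.
From mathcomp Require Import all_boot all_order all_algebra.
From mathcomp Require Import all_classical all_reals all_analysis.
From mathcomp Require Import measurable_realfun.
From mathcomp Require Import ring lra.
Set Implicit Arguments.
Unset Strict Implicit.
Unset Printing Implicit Defensive.
Import Order.TTheory GRing.Theory Num.Theory.
Import numFieldNormedType.Exports.
Local Open Scope classical_set_scope.
Local Open Scope ring_scope.

(** The equation moves the level sets of [u] with the normal velocity
    [c1 + c0 * 1_{u >= u(x)}], which is nonlocal but nondecreasing in the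
    superlevel sets of [u].  This monotonicity is what makes comparison and
    Perron's method work.  All arguments on viscosity solutions are carried out
    for an abstract set function [J x t Z], monotone in the open or closed set
    [Z], which stands for [(c0(.,t) * 1_Z)(x)]; the record [nonlocal_data] lists
    the properties of it that matter: boundedness, Lipschitz continuity in [x]
    and continuity in [t], uniformly in [Z], small influence of far away
    points, and continuity along sequences of sets.

    Growth.  Since the speed is bounded by a constant [C], a subsolution also
    satisfies [u_t <= C |Du|].  Information then travels at speed at most [C],
    and [speed_subsolution_bounded] shows that an upper bound of the initial
    datum bounds the subsolution, however fast it might grow at infinity, by
    means of a barrier [Phi (ln (1 + |x - x0|^2) + C t)] in which [Phi] is
    chosen, after [u], to grow faster than [u].  A barrier with a linear [Phi]
    gives a modulus of continuity at time [0] ([speed_subsolution_initial]).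

    Comparison ([comparison]).  Double the variables with the penalty
    [al e^{la t} |x - y|^2 + be (t - s)^2 + de ln (1 + |x - x0|^2) + et t], and
    let [(x, t), (y, s)] be a maximum point.  Testing maximality against
    [(z, t), (z, s)], with the same [z] on both sides, removes the quadratic
    term: so [u(z, t) >= u(x, t)] forces [v(z, s) > v(y, s)], unless the
    quadratic term is negligible or [z] is far away ([superlevel_inclusion]).
    Hence the two nonlocal speeds are ordered up to a small tail and a Lipschitz
    error [(L + L1) |x - y|], which the derivative of [e^{la t}] absorbs.
    If the quadratic term is negligible, so is the gradient of the test
    function, and bounded speeds suffice to conclude.

    Existence.  The supremum [u] of all subsolutions is locally bounded, by the
    growth estimates.  Its upper envelope is a subsolution
    ([usc_envelope_perron_sub]), by the stability of the nonlocal term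
    ([J_superlevel_usc]); and if its lower envelope were not a supersolution
    then a subsolution could be pushed above [u] near some point
    ([perron_bump]).  Comparison of the two envelopes gives uniqueness.

    The convolution.  It remains to see that [c0(.,t) * 1_Z] is Lipschitz in
    the space variable, uniformly in [Z].  For [Z] open, [1_Z] is the pointwise
    limit of smooth bumps ([open_bump_approximable]); moving a bump in a
    coordinate direction changes its integral against [c0(.,t)] at the rate
    given by the weak gradient, thus at most by its [L^1] norm ([indic_shift]).
    This is available for almost every time, and extends to all times because
    [c0] is continuous in time with values in [L^1] ([mass_shift_time]). *)

(** * The Euclidean norm of row vectors *)

Section enorm_theory.
Context {R : realType} {N : nat}.
Local Notation X := 'rV[R]_N.
Implicit Types x y : X.

Lemma enorm_ge0 x : 0 <= enorm x.
Proof. exact: sqrtr_ge0. Qed.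

Lemma sum_sqr_ge0 x : 0 <= \sum_(i < N) x ord0 i ^+ 2.
Proof. by apply: sumr_ge0 => i _; exact: sqr_ge0. Qed.

Lemma sqr_enorm x : enorm x ^+ 2 = \sum_(i < N) x ord0 i ^+ 2.
Proof. by rewrite sqr_sqrtr// sum_sqr_ge0. Qed.

Lemma enormN x : enorm (- x) = enorm x.
Proof. by congr Num.sqrt; apply: eq_bigr => i _; rewrite mxE sqrrN. Qed.

Lemma enormZ a x : enorm (a *: x) = `|a| * enorm x.
Proof.
rewrite /enorm -sqrtr_sqr -sqrtrM ?sqr_ge0// mulr_sumr.
by congr Num.sqrt; apply: eq_bigr => i _; rewrite mxE exprMn.
Qed.

Lemma coord_le_enorm x i : `|x ord0 i| <= enorm x.
Proof.
rewrite -sqrtr_sqr ler_wsqrtr// (bigD1 i)//= lerDl.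
by apply: sumr_ge0 => j _; exact: sqr_ge0.
Qed.

Lemma norm_le_enorm x : `|x| <= enorm x.
Proof.
rewrite (_ : `|x| = mx_norm x)// mx_normrE; apply/bigmax_leP; split.
  exact: enorm_ge0.
by move=> [i j] _ /=; rewrite ord1; exact: coord_le_enorm.
Qed.

Lemma coord_le_norm x i : `|x ord0 i| <= `|x|.
Proof.
rewrite (_ : `|x| = mx_norm x)// mx_normrE; apply/bigmax_geP; right.
by exists (ord0, i).
Qed.

Lemma enorm_le_norm x : enorm x <= N%:R * `|x|.
Proof.
rewrite -[leRHS]ger0_norm ?mulr_ge0// -sqrtr_sqr ler_wsqrtr//.
apply: (@le_trans _ _ (\sum_(i < N) `|x| ^+ 2)).
  apply: ler_sum => i _; rewrite -real_normK ?num_real//.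
  by rewrite lerXn2r ?nnegrE ?coord_le_norm.
rewrite sumr_const card_ord exprMn -[leLHS]mulr_natl ler_wpM2r ?sqr_ge0//.
by rewrite -natrX ler_nat; case: (N) => // n; rewrite expnS leq_pmulr.
Qed.

(** Cauchy-Schwarz: expand the square of the difference of the two vectors
    scaled to equal length. *)
Lemma dot_le_enorm x y :
  \sum_(i < N) x ord0 i * y ord0 i <= enorm x * enorm y.
Proof.
have zero (a b : X) : enorm a = 0 -> \sum_(i < N) a ord0 i * b ord0 i = 0.
  move=> a0; rewrite big1// => i _; apply/eqP; rewrite mulf_eq0 -normr_le0.
  by rewrite -a0 coord_le_enorm.
have [x0|xn0] := eqVneq (enorm x) 0; first by rewrite zero// x0 mul0r.
have [y0|yn0] := eqVneq (enorm y) 0.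
  by under eq_bigr do rewrite mulrC; rewrite zero// y0 mulr0.
have hx : 0 < enorm x by rewrite lt_neqAle eq_sym xn0 enorm_ge0.
have hy : 0 < enorm y by rewrite lt_neqAle eq_sym yn0 enorm_ge0.
have : \sum_(i < N) 2 * (x ord0 i * y ord0 i) <=
  \sum_(i < N) (enorm y / enorm x * x ord0 i ^+ 2 +
                enorm x / enorm y * y ord0 i ^+ 2).
  apply: ler_sum => i _; set p := enorm x; set q := enorm y.
  set a := x ord0 i; set b := y ord0 i.
  rewrite -subr_ge0 (_ : _ - _ = (q * a - p * b) ^+ 2 / (p * q)); last first.
    by field; rewrite xn0 yn0.
  by rewrite divr_ge0 ?sqr_ge0// mulr_ge0 ?enorm_ge0.
rewrite -mulr_sumr big_split /= -!mulr_sumr -!sqr_enorm => h.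
rewrite -(ler_pM2l (ltr0n R 2)) (le_trans h)// le_eqVlt; apply/orP; left.
by apply/eqP; field; rewrite xn0 yn0.
Qed.

Lemma enormD x y : enorm (x + y) <= enorm x + enorm y.
Proof.
rewrite -[leRHS]ger0_norm ?addr_ge0 ?enorm_ge0// -sqrtr_sqr ler_wsqrtr//.
rewrite (_ : \sum_(i < N) _ = enorm x ^+ 2 +
    (\sum_(i < N) x ord0 i * y ord0 i) *+ 2 + enorm y ^+ 2); last first.
  rewrite !sqr_enorm -sumrMnl -!big_split /=; apply: eq_bigr => i _.
  by rewrite mxE sqrrD.
by rewrite sqrrD lerD2r lerD2l lerMn2r dot_le_enorm orbT.
Qed.

Lemma enormDl_ge x y : enorm x - enorm y <= enorm (x + y).
Proof.
by rewrite lerBlDr -{1}(addrK y x) (le_trans (enormD _ _))// enormN.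
Qed.

Lemma enorm_distC x y : enorm (x - y) = enorm (y - x).
Proof. by rewrite -enormN opprB. Qed.

Lemma cvg_coord (I : Type) (F : set_system I) {FF : Filter F} (f : I -> X)
    (x : X) i : f @ F --> x -> f j ord0 i @[j --> F] --> x ord0 i.
Proof.
move=> fx.
exact: (@continuous_cvg _ _ _ F FF f (fun v : X => v ord0 i) x
  (@coord_continuous _ _ _ _ _ _) fx).
Qed.

Lemma cvg_enorm (I : Type) (F : set_system I) {FF : Filter F} (f : I -> X)
    (x : X) : f @ F --> x -> enorm (f j) @[j --> F] --> enorm x.
Proof.
move=> fx.
apply: (@continuous_cvg _ _ _ F FF (fun j => \sum_(i < N) f j ord0 i ^+ 2)
  (@Num.sqrt R) _ (@sqrt_continuous R _)).
apply: cvg_big => [|i _]; first by apply: add_continuous.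
have h : f j ord0 i @[j --> F] --> x ord0 i by exact: cvg_coord.
rewrite expr2; under eq_fun do rewrite expr2.
exact: cvgM.
Qed.

Lemma compact_enorm_ball (a : X) r : compact [set x : X | enorm (x - a) <= r].
Proof.
apply: bounded_closed_compact.
  exists (r + `|a|); split=> [|M rM x /= xa]; first exact: num_real.
  rewrite (le_trans _ (ltW rM))// -lerBlDr (le_trans _ xa)//.
  by rewrite (le_trans _ (norm_le_enorm _))// lerB_dist.
apply: (@preimage_closed _ _ (fun x : X => enorm (x - a)) [set y | y <= r]).
  move=> x _; apply: (@cvg_enorm _ (nbhs x) _ (fun x => x - a)).
  by apply: cvgB; [exact: cvg_id|exact: cvg_cst].
exact: closed_le.
Qed.

End enorm_theory.

(** * Directional derivatives and test functions *)

Section line.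
Context {R : realType} {V : normedModType R}.

(** A directional derivative is a derivative along a line, so that the calculus
    of one real variable applies to it. *)
Lemma is_derive_line (f : V -> R) (x v : V) (s df : R) :
  is_derive (x + s *: v) v f df <->
  is_derive s (1 : R) (fun r => f (x + r *: v)) df.
Proof.
have E : (fun h => h^-1 *: (f (h *: v + (x + s *: v)) - f (x + s *: v))) =
  (fun h : R => h^-1 *: (f (x + (h *: 1 + s) *: v) - f (x + s *: v))).
  by apply/funext => h; rewrite addrCA -scalerDl [h *: 1]mulr1.
split=> -[h1 h2]; split.
- by move: h1; rewrite /derivable E.
- by move: h2; rewrite /derive E.
- by move: h1; rewrite /derivable E.
- by move: h2; rewrite /derive E.
Qed.

Lemma is_derive_line0 (f : V -> R) (x v : V) (df : R) :
  is_derive x v f df <-> is_derive (0 : R) (1 : R) (fun r => f (x + r *: v)) df.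
Proof. by rewrite -is_derive_line scale0r addr0. Qed.

Lemma is_derive_compR (F : R -> R) (f : V -> R) (x v : V) (a b : R) :
  is_derive (f x) 1 F a -> is_derive x v f b ->
  is_derive x v (fun y => F (f y)) (a * b).
Proof.
move=> hF /is_derive_line0 hf; apply/is_derive_line0.
apply: (@is_derive1_comp R F (fun r => f (x + r *: v))) => //.
by rewrite scale0r addr0.
Qed.

End line.

Section C1_algebra.
Context {R : realType} {N : nat}.
Local Notation X := 'rV[R]_N.
Implicit Types phi dt : X * R -> R.

(** C^1 on the whole of R^N x R.  The derivatives being two-sided, the usual
    calculus rules hold as they stand; restricting to the strip gives test
    functions by [C1_with_global]. *)
Definition C1_global phi dt (Dx : X * R -> X) :=
  [/\ forall x (t : R), is_derive t (1 : R) (fun s => phi (x, s)) (dt (x, t)),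
      forall x t i, is_derive x (unit_vec i) (fun y => phi (y, t))
                      (Dx (x, t) ord0 i),
      continuous phi, continuous dt & continuous Dx].

Lemma C1_global_cst (a : R) : C1_global (fun=> a) (fun=> 0) (fun=> 0).
Proof.
split; [by move=> x t; exact: is_derive_cst | |by move=> p; exact: cvg_cst..].
by move=> x t i; rewrite mxE; exact: is_derive_cst.
Qed.

Lemma C1_global_time :
  C1_global (fun p : X * R => p.2) (fun=> 1) (fun=> 0).
Proof.
split; [by move=> x t; exact: is_derive_id | | |by move=> p; exact: cvg_cst..].
  by move=> x t i; rewrite mxE; exact: is_derive_cst.
by move=> p; exact: cvg_snd.
Qed.

Lemma C1_global_coord (i : 'I_N) :
  C1_global (fun p : X * R => p.1 ord0 i) (fun=> 0) (fun=> unit_vec i).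
Proof.
split; [by move=> x t; exact: is_derive_cst | | |by move=> p; exact: cvg_cst..].
  move=> x t j; apply/is_derive_line0 => /=.
  have -> : (fun r : R => (x + r *: unit_vec j : X) ord0 i) =
     (fun=> x ord0 i) + (unit_vec i ord0 j) \*: (@id R).
    apply/funext => r; rewrite !mxE eqxx (eq_sym j).
    by rewrite [RHS]/(_ + _) /= [_ *: r]mulrC.
  apply: is_derive_eq.
  by rewrite add0r [_ *: 1]mulr1.
move=> p; apply: (@cvg_coord _ _ _ _ _ (fun p => p.1)); exact: cvg_fst.
Qed.

Lemma C1_globalD f df Df g dg Dg :
  C1_global f df Df -> C1_global g dg Dg ->
  C1_global (fun p => f p + g p) (fun p => df p + dg p) (fun p => Df p + Dg p).
Proof.
move=> [f1 f2 f3 f4 f5] [g1 g2 g3 g4 g5]; split.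
- by move=> x t; exact: (is_deriveD (f1 x t) (g1 x t)).
- by move=> x t i; rewrite mxE; exact: (is_deriveD (f2 x t i) (g2 x t i)).
- by move=> p; exact: cvgD (f3 p) (g3 p).
- by move=> p; exact: cvgD (f4 p) (g4 p).
- by move=> p; exact: cvgD (f5 p) (g5 p).
Qed.

Lemma C1_globalM f df Df g dg Dg :
  C1_global f df Df -> C1_global g dg Dg ->
  C1_global (fun p => f p * g p) (fun p => f p * dg p + g p * df p)
    (fun p => f p *: Dg p + g p *: Df p).
Proof.
move=> [f1 f2 f3 f4 f5] [g1 g2 g3 g4 g5]; split.
- by move=> x t; exact: (is_deriveM (f1 x t) (g1 x t)).
- move=> x t i; rewrite !mxE.
  exact: (is_deriveM (f2 x t i) (g2 x t i)).
- by move=> p; exact: cvgM (f3 p) (g3 p).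
- by move=> p; apply: cvgD; [exact: cvgM (f3 p) (g4 p)|exact: cvgM (g3 p) (f4 p)].
- by move=> p; apply: cvgD; [exact: cvgZ (f3 p) (g5 p)|exact: cvgZ (g3 p) (f5 p)].
Qed.

Lemma C1_global_comp (F dF : R -> R) (f df : X * R -> R) (Df : X * R -> X) :
  (forall p, is_derive (f p) (1 : R) F (dF (f p))) ->
  (forall p, {for f p, continuous dF}) ->
  C1_global f df Df ->
  C1_global (fun p => F (f p)) (fun p => dF (f p) * df p)
    (fun p => dF (f p) *: Df p).
Proof.
move=> h1 h2 [f1 f2 f3 f4 f5]; split.
- by move=> x t; exact: (is_derive_compR (h1 _) (f1 x t)).
- by move=> x t i; rewrite mxE; exact: (is_derive_compR (h1 (x, t)) (f2 x t i)).
- move=> p; apply: (@continuous_cvg _ _ _ _ _ f F) (f3 p).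
  by have [/derivable1_diffP/differentiable_continuous] := h1 p.
- by move=> p; apply: cvgM (f4 p); apply: (@continuous_cvg _ _ _ _ _ f dF) (f3 p).
- by move=> p; apply: cvgZ (f5 p); apply: (@continuous_cvg _ _ _ _ _ f dF) (f3 p).
Qed.

Lemma eq_C1_global f g df dg Df Dg : C1_global f df Df ->
  f =1 g -> df =1 dg -> Df =1 Dg -> C1_global g dg Dg.
Proof. by move=> h /funext <- /funext <- /funext <-. Qed.

Lemma C1_global_sum n (f df : 'I_n -> X * R -> R) (Df : 'I_n -> X * R -> X) :
  (forall i, C1_global (f i) (df i) (Df i)) ->
  C1_global (fun p => \sum_(i < n) f i p) (fun p => \sum_(i < n) df i p)
    (fun p => \sum_(i < n) Df i p).
Proof.
elim: n f df Df => [|n IH] f df Df h.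
  by apply: eq_C1_global (C1_global_cst 0) _ _ _ => p; rewrite big_ord0.
apply: eq_C1_global (C1_globalD (h ord0) (IH _ _ _ (fun i => h (lift ord0 i)))) _ _ _;
  by move=> p; rewrite big_ord_recl.
Qed.

Lemma C1_global_sqdist (a : X) :
  C1_global (fun p : X * R => enorm (p.1 - a) ^+ 2) (fun=> 0)
    (fun p => 2 *: (p.1 - a)).
Proof.
have h i : C1_global (fun p : X * R => p.1 ord0 i - a ord0 i)
     (fun=> 0) (fun=> unit_vec i).
  apply: eq_C1_global (C1_globalD (C1_global_coord i)
    (C1_global_cst (- a ord0 i))) _ _ _ => p //; by rewrite addr0.
apply: eq_C1_global (C1_global_sum (fun i => C1_globalM (h i) (h i))) _ _ _ => p.
- by rewrite sqr_enorm; apply: eq_bigr => i _; rewrite !mxE expr2.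
- by rewrite big1// => i _; rewrite !mulr0 addr0.
- apply/rowP => j; rewrite summxE (bigD1 j)//= big1 ?addr0.
    rewrite !mxE !eqxx/=; ring.
  by move=> i ij; rewrite !mxE eqxx/= eq_sym (negbTE ij) !mulr0 addr0.
Qed.

Variable T : R.

(** The one-sided difference quotients at the ends of [0,T] converge because the
    two-sided ones do. *)
Lemma C1_with_global phi dt Dx : C1_global phi dt Dx -> C1_with T phi dt Dx.
Proof.
move=> [h1 h2 h3 h4 h5]; split.
- move=> x t tT; have /is_derive1_caratheodory[g [g1 g2 g3]] := h1 x t.
  have : g s @[s --> within `[0, T] t^'] --> dt (x, t).
    rewrite -g3; apply: cvg_trans g2; apply: cvg_app.
    apply: cvg_trans; last exact: (@nbhs_dnbhs _ t).
    exact: cvg_within.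
  apply: cvg_trans; apply: near_eq_cvg.
  rewrite near_withinE; near=> s => _; rewrite g1 mulfK// subr_eq0; near: s.
  exact: nbhs_dnbhs_neq.
- by move=> x t _ i; exact: h2.
- by apply: continuous_subspaceT.
- by apply: continuous_subspaceT.
- by apply: continuous_subspaceT.
Unshelve. all: by end_near. Qed.

Lemma C1_withD (f df : X * R -> R) (Df : X * R -> X)
    (g dg : X * R -> R) (Dg : X * R -> X) :
  C1_with T f df Df -> C1_with T g dg Dg ->
  C1_with T (fun p => f p + g p) (fun p => df p + dg p) (fun p => Df p + Dg p).
Proof.
move=> [f1 f2 f3 f4 f5] [g1 g2 g3 g4 g5]; split.
- move=> x t tT.
  rewrite [X in X @ _ --> _](_ : _ = (fun s => (f (x, s) - f (x, t)) / (s - t) +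
      (g (x, s) - g (x, t)) / (s - t))).
    by apply: cvgD; [exact: f1|exact: g1].
  by apply/funext => s; rewrite -mulrDl addrACA -opprD.
- by move=> x t tT i; rewrite mxE; exact: (is_deriveD (f2 x t tT i) (g2 x t tT i)).
- by move=> p; exact: cvgD (f3 p) (g3 p).
- by move=> p; exact: cvgD (f4 p) (g4 p).
- by move=> p; exact: cvgD (f5 p) (g5 p).
Qed.

Lemma C1_withN (f df : X * R -> R) (Df : X * R -> X) :
  C1_with T f df Df ->
  C1_with T (fun p => - f p) (fun p => - df p) (fun p => - Df p).
Proof.
move=> [f1 f2 f3 f4 f5]; split.
- move=> x t tT.
  rewrite [X in X @ _ --> _](_ : _ = (fun s => - ((f (x, s) - f (x, t)) / (s - t)))).
    by apply: cvgN; exact: f1.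
  by apply/funext => s; rewrite -mulNr opprB opprK addrC.
- by move=> x t tT i; rewrite mxE; exact: (is_deriveN (f2 x t tT i)).
- by move=> p; exact: cvgN (f3 p).
- by move=> p; exact: cvgN (f4 p).
- by move=> p; exact: cvgN (f5 p).
Qed.

(** First order conditions at a maximum.  When [p.2 = T] only times [s <= T] can be
    compared, whence an inequality for the time derivative. *)
Lemma C1_with_max (f df : X * R -> R) (Df : X * R -> X) p :
  C1_with T f df Df -> strip T p -> 0 < p.2 ->
  (forall q, strip T q -> f q <= f p) -> 0 <= df p /\ Df p = 0.
Proof.
case: p => x t [f1 f2 _ _ _] /= tT t0 fmax; split.
  rewrite leNgt; apply/negP => d0.
  have : \forall s \near t, s != t -> s \in `[0, T] ->
      (f (x, s) - f (x, t)) / (s - t) < 0.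
    have := f1 x t tT; move/cvgr_lt => /(_ _ d0).
    by rewrite near_withinE /dnbhs near_withinE.
  move=> /nbhs_ballP[e /= e0 he].
  pose s := Num.max (t - e / 2) 0.
  have st : s < t by rewrite gt_max t0 andbT; lra.
  have s0 : 0 <= s by rewrite le_max lexx orbT.
  have tT' : t <= T by move: tT => /andP[].
  have sT : s \in `[0, T] by rewrite in_itv/= s0 (le_trans (ltW st)).
  have : ball t e s.
    rewrite /ball/= gtr0_norm ?subr_gt0//.
    have : t - e / 2 <= s by rewrite le_max lexx.
    lra.
  move=> /he/(_ (negbT (lt_eqF st)))/(_ sT).
  rewrite ltNge => /negP; apply.
  rewrite -mulrNN -invrN !opprB; apply: divr_ge0; last by rewrite subr_ge0 ltW.
  rewrite subr_ge0; apply: fmax; rewrite /strip/= s0 /=.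
  exact: le_trans (ltW st) tT'.
apply/rowP => i; rewrite [RHS]mxE.
pose F (r : R) := f (x + r *: unit_vec i, t).
have hF : is_derive (0 : R) (1 : R) F (Df (x, t) ord0 i).
  exact/(is_derive_line0 (fun y => f (y, t)))/f2.
have h0 : is_derive (0 : R) (1 : R) F 0.
  apply: (@derive1_at_max R F (-1) 1); rewrite ?in_itv/=; [lra| |lra|].
    move=> s _; apply: ex_derive.
    exact/(is_derive_line (fun y => f (y, t)))/f2.
  by move=> s _; rewrite /F scale0r addr0; exact: fmax.
by case: hF => _ <-; case: h0 => _ ->.
Qed.

End C1_algebra.

(** * Upper semicontinuous functions *)

Section upper_semicontinuity.
Context {R : realType}.

(** Semicontinuity relative to a set, for real-valued functions and with real
    levels; [usc_on_stripP] relates it to the extended-real notion on the subspace. *)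
Definition usc_in (V : topologicalType) (S : set V) (f : V -> R) :=
  forall p, S p -> forall a, f p < a -> \forall q \near p, S q -> f q < a.

Lemma usc_inS (V : topologicalType) (S S' : set V) (f : V -> R) :
  S' `<=` S -> usc_in S f -> usc_in S' f.
Proof.
move=> SS uf p S'p a pa; have := uf p (SS _ S'p) a pa.
by apply: filterS => q h /SS.
Qed.

Lemma usc_in_continuous (V : topologicalType) (S : set V) (f : V -> R) :
  {within S, continuous f} -> usc_in S f.
Proof.
move=> /subspace_continuousP cf p Sp a pa.
by have := cf p Sp; move/cvgr_lt => /(_ _ pa); rewrite near_withinE.
Qed.

Lemma usc_inD (V : topologicalType) (S : set V) (f g : V -> R) :
  usc_in S f -> usc_in S g -> usc_in S (fun p => f p + g p).
Proof.
move=> uf ug p Sp a pa; pose e := (a - (f p + g p)) / 2.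
have e0 : 0 < e by rewrite /e; lra.
have h1 : \forall q \near p, S q -> f q < f p + e by apply: uf => //; lra.
have h2 : \forall q \near p, S q -> g q < g p + e by apply: ug => //; lra.
near=> q => Sq.
have : f q < f p + e by move: Sq; near: q.
have : g q < g p + e by move: Sq; near: q.
rewrite /e; lra.
Unshelve. all: by end_near. Qed.

Lemma usc_inB_continuous (V : topologicalType) (S : set V) (f g : V -> R) :
  usc_in S f -> {within S, continuous g} -> usc_in S (f \- g).
Proof.
move=> uf cg; apply: usc_inD => //; apply: usc_in_continuous => p.
exact: cvgN (cg p).
Qed.

Lemma usc_in_max (V : topologicalType) (S : set V) (f g : V -> R) :
  usc_in S f -> usc_in S g -> usc_in S (fun p => Num.max (f p) (g p)).
Proof.
move=> uf ug p Sp a; rewrite gt_max => /andP[fa ga].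
have := ug p Sp a ga; have := uf p Sp a fa.
by apply: filterS2 => q h1 h2 Sq; rewrite gt_max h1// h2.
Qed.

Lemma usc_in_comp (V W : topologicalType) (S : set V) (S' : set W)
    (g : W -> V) (f : V -> R) :
  continuous g -> (forall q, S' q -> S (g q)) -> usc_in S f ->
  usc_in S' (f \o g).
Proof.
move=> cg SS uf q S'q a qa; have := uf _ (SS _ S'q) a qa.
move=> /(cg q); rewrite /nbhs/=; apply: filterS => r h /SS; exact: h.
Qed.

(** Both boundedness and attainment of the supremum follow by covering [K] with the
    open sets on which [f] lies below a level: the level tends to infinity for
    the first, and increases to the supremum for the second. *)
Lemma usc_in_compact_max (V : topologicalType) (K : set V) (f : V -> R) :
  compact K -> K !=set0 -> usc_in K f ->
  exists2 p, K p & forall q, K q -> f q <= f p.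
Proof.
move=> /compact_near_coveringP/near_covering_withinP cK [p0 Kp0] uf.
have : \forall r \near +oo, K `<=` (fun q => f q < r).
  apply: (cK R (nbhs +oo) (fun r q => f q < r)) => p Kp.
  have h : \forall q \near p, K q -> f q < f p + 1 by apply: uf => //; lra.
  have h2 : \forall r \near +oo, f p + 1 <= r.
    by apply: nbhs_pinfty_ge; exact: num_real.
  near=> q r => /= Kq.
  apply: (@lt_le_trans _ _ (f p + 1)); first by move: Kq; near: q.
  by near: r.
move=> [r0 [_ hr0]].
have ub : has_ubound (f @` K).
  exists (r0 + 1) => _ [q Kq <-]; apply/ltW/(hr0 (r0 + 1)) => //; lra.
have ne : f @` K !=set0 by exists (f p0); exists p0.
pose M := sup (f @` K).
have fM q : K q -> f q <= M by move=> Kq; apply: ub_le_sup => //; exists q.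
have [[p [Kp pM]]|no] := pselect (exists p, K p /\ f p = M).
  by exists p => // q Kq; rewrite pM; exact: fM.
exfalso.
have fltM q : K q -> f q < M.
  move=> Kq; rewrite lt_neqAle fM// andbT; apply/eqP => qM.
  by apply: no; exists q.
have : \forall r \near M^'-, K `<=` (fun q => f q < r).
  apply: (cK R M^'- (fun r q => f q < r)) => p Kp.
  pose m := (f p + M) / 2.
  have pm : f p < m by have := fltM p Kp; rewrite /m; lra.
  have mM : m < M by have := fltM p Kp; rewrite /m; lra.
  have h : \forall q \near p, K q -> f q < m by exact: uf.
  have h2 : \forall r \near M^'-, m <= r by exact: nbhs_left_ge.
  near=> q r => /= Kq.
  apply: (@lt_le_trans _ _ m); first by move: Kq; near: q.
  by near: r.
move=> h.
have [r [rM hr]] : exists r, r < M /\ K `<=` (fun q => f q < r).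
  have h2 : \forall r \near M^'-, r < M by exact: nbhs_left_lt.
  have [r [? ?]] := @filter_ex _ _ _ _ (filterI h2 h).
  by exists r.
have : M <= r by apply: sup_le_ub => // _ [q Kq <-]; apply/ltW/hr.
by rewrite leNgt rM.
Unshelve. all: by end_near. Qed.

(** Maximization on an unbounded set, once the values outside a compact set are
    dominated by the value at a point inside. *)
Lemma usc_in_coercive_max (V : topologicalType) (S K : set V) (f : V -> R) p0 :
  compact K -> K `<=` S -> K p0 -> usc_in S f ->
  (forall q, S q -> ~ K q -> f q <= f p0) ->
  exists2 p, S p & forall q, S q -> f q <= f p.
Proof.
move=> cK KS Kp0 uf out.
have [p Kp pmax] := usc_in_compact_max cK (ex_intro _ _ Kp0) (usc_inS KS uf).
exists p => [|q Sq]; first exact: KS.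
have [/pmax//|nKq] := pselect (K q).
exact: le_trans (out _ Sq nKq) (pmax _ Kp0).
Qed.

Context {N : nat}.
Local Notation X := 'rV[R]_N.
Variable T : R.

Lemma usc_on_stripP (u : X * R -> R) :
  usc_on_strip T u <-> usc_in (strip T) u.
Proof.
split=> [h p Sp a pa|h p a].
  have [V pV hV] := h p (- a) (@eqbRL _ _ (lte_fin _ _) (@eqbRL _ _ (ltrN2 _ _) pa)).
  have : within (strip T) (nbhs p) V by rewrite (nbhs_subspace_in Sp).
  by rewrite /within/=; apply: filterS => q hq /hq /hV; rewrite /= lte_fin ltrN2.
rewrite lte_fin ltrNr => pa.
case: (nbhs_subspaceP (strip T) p) => Sp.
  exists [set q | - u q > a]; last by move=> q /=; rewrite lte_fin.
  have := h p Sp _ pa; rewrite /within/=; apply: filterS => q hq /hq.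
  by rewrite ltrNr.
exists [set p] => // q ->; by rewrite lte_fin ltrNr.
Qed.

Lemma compact_strip_ball (a : X) r :
  compact [set p : X * R | enorm (p.1 - a) <= r /\ 0 <= p.2 <= T].
Proof.
have -> : [set p : X * R | enorm (p.1 - a) <= r /\ 0 <= p.2 <= T] =
   [set x : X | enorm (x - a) <= r] `*` `[0, T]%classic.
  by apply/seteqP; split=> p /=; rewrite in_itv.
apply: compact_setX; [exact: compact_enorm_ball|exact: segment_compact].
Qed.

End upper_semicontinuity.

(** * Subsolutions with bounded speed *)

Section growth.
Context {R : realType}.

(** A criterion for differentiability at the points where two formulas are glued. *)
Lemma is_derive_quadratic_bound (f : R -> R) (r d c : R) : 0 <= c ->
  (forall z, `|f z - f r - d * (z - r)| <= c * (z - r) ^+ 2) ->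
  is_derive r (1 : R) f d.
Proof.
move=> c0 h; apply/is_derive1_caratheodory.
exists (fun z => if z == r then d else (f z - f r) / (z - r)); split.
- move=> z; case: eqP => [->|/eqP zr]; first by rewrite !subrr mulr0.
  by rewrite divfK// subr_eq0.
- apply/cvgrPdist_le => e e0; rewrite eqxx.
  have : \forall z \near r, `|r - z| <= e / (c + 1).
    apply/nbhs_ballP; exists (e / (c + 1)) => [|z]; last exact: ltW.
    by rewrite /= divr_gt0//; lra.
  apply: filterS => z hz; case: eqP => [_|/eqP zr]; first by rewrite subrr normr0 ltW.
  have zr0 : 0 < `|z - r| by rewrite normr_gt0 subr_eq0.
  rewrite distrC -(ler_pM2r zr0) -normrM mulrBl divfK ?subr_eq0//.
  rewrite (le_trans (h z))// -real_normK ?num_real// expr2 mulrA ler_pM2r//.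
  rewrite distrC; move: hz; set y := `|r - z| => hz.
  have y0 : 0 <= y by rewrite /y.
  rewrite ler_pdivlMr in hz; last lra.
  apply: le_trans hz; rewrite mulrC mulrDr mulr1; lra.
- by rewrite eqxx.
Qed.

Definition ppart (r : R) := Num.max r 0.

Lemma ppart_ge0 r : 0 <= ppart r.
Proof. by rewrite /ppart le_max lexx orbT. Qed.

Lemma is_derive_sqr_ppart (r : R) :
  is_derive r (1 : R) (fun s => ppart s ^+ 2) (2 * ppart r).
Proof.
apply: (@is_derive_quadratic_bound _ _ _ 1) => // z; rewrite mul1r /ppart.
have := sqr_ge0 z; have := sqr_ge0 r; have := sqr_ge0 (z - r).
have [z0|/ltW z0] := leP z 0; have [r0|/ltW r0] := leP r 0; rewrite ler_norml.
- by move=> h1 h2 h3; apply/andP; split; nra.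
- have h : 0 <= (- z) * r by rewrite mulr_ge0 ?oppr_ge0.
  by move=> h1 h2 h3; apply/andP; split; nra.
- have h : 0 <= z * (- r) by rewrite mulr_ge0 ?oppr_ge0.
  by move=> h1 h2 h3; apply/andP; split; nra.
- by move=> h1 h2 h3; apply/andP; split; nra.
Qed.

Lemma ppart_continuous : continuous ppart.
Proof.
move=> r; apply: (@continuous_max _ _ id (fun=> 0) r); [exact: cvg_id|exact: cvg_cst].
Qed.

Variables (a : nat -> R) (b : nat).
Hypothesis a0 : forall k, 0 <= a k.

Let S n r := \sum_(b <= k < n) a k * ppart (r - k%:R) ^+ 2.
Let dS n r := \sum_(b <= k < n) a k * (2 * ppart (r - k%:R)).

Let ppart0 r k : r <= k -> ppart (r - k) = 0.
Proof. by move=> rk; rewrite /ppart max_r// subr_le0. Qed.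

Let S_stable n j r : r <= n%:R -> S (n + j) r = S n r.
Proof.
move=> rn; elim: j => [|j IH]; first by rewrite addn0.
rewrite addnS; have [bj|bj] := leqP b (n + j).
  rewrite {1}/S big_nat_recr//= -/(S _ _) IH ppart0 ?expr0n ?mulr0 ?addr0//.
  by rewrite (le_trans rn)// ler_nat leq_addr.
by rewrite /S !big_geq// (leq_trans (leq_addr j n))// ltnW.
Qed.

Let dS_stable n j r : r <= n%:R -> dS (n + j) r = dS n r.
Proof.
move=> rn; elim: j => [|j IH]; first by rewrite addn0.
rewrite addnS; have [bj|bj] := leqP b (n + j).
  rewrite {1}/dS big_nat_recr//= -/(dS _ _) IH ppart0 ?mulr0 ?addr0//.
  by rewrite (le_trans rn)// ler_nat leq_addr.
by rewrite /dS !big_geq// (leq_trans (leq_addr j n))// ltnW.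
Qed.

Let m (r : R) := (Num.truncn `|r|).+1.

Let rm r : r < (m r)%:R.
Proof. by rewrite (le_lt_trans (ler_norm r))// truncnS_gt. Qed.

Let S_eq n r : r <= n%:R -> S (m r) r = S n r.
Proof.
move=> rn; have [h|h] := leqP n (m r).
  by rewrite -(subnKC h) S_stable.
by rewrite -(subnKC (ltnW h)) S_stable// ltW.
Qed.

Let dS_eq n r : r <= n%:R -> dS (m r) r = dS n r.
Proof.
move=> rn; have [h|h] := leqP n (m r).
  by rewrite -(subnKC h) dS_stable.
by rewrite -(subnKC (ltnW h)) dS_stable// ltW.
Qed.

(** There are C^1 functions growing faster than any prescribed sequence: sum the
    terms [a k * (r - k)_+^2], of which finitely many are nonzero near each [r].
    The index [b] makes the function vanish on [r <= b]. *)
Lemma fast_growing_C1 : exists Phi dPhi : R -> R,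
  [/\ forall r, is_derive r (1 : R) Phi (dPhi r), continuous dPhi,
      forall r, 0 <= dPhi r /\ 0 <= Phi r,
      forall r, r <= b%:R -> Phi r = 0 &
      forall k r, (b <= k)%N -> k.+1%:R <= r -> a k <= Phi r].
Proof.
exists (fun r => S (m r) r), (fun r => dS (m r) r); split.
- move=> r.
  have D : is_derive r (1 : R) (S (m r)) (dS (m r) r).
    rewrite /S /dS; elim: (m r) => [|n IH].
      rewrite big_geq//; under eq_fun do rewrite big_geq//.
      exact: is_derive_cst.
    have [bn|bn] := leqP b n; last first.
      rewrite big_geq//; under eq_fun do rewrite big_geq//.
      exact: is_derive_cst.
    rewrite big_nat_recr//=; under eq_fun do rewrite big_nat_recr//=.
    apply: (is_deriveD IH).
    suff D2 : is_derive r (1 : R) (fun s => ppart (s - n%:R) ^+ 2)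
        (2 * ppart (r - n%:R)) by exact: (is_deriveZ (a n) D2).
    rewrite -[X in is_derive _ _ _ X]mulr1.
    have D3 := @is_derive_shift R r 1 (- n%:R).
    exact: (is_derive_compR (is_derive_sqr_ppart _) D3).
  apply: near_eq_is_derive D.
  have : \forall s \near r, s < (m r)%:R by exact: lt_nbhsl.
  by apply: filterS => s sr; rewrite (S_eq (ltW sr)).
- move=> r.
  have D : dS (m r) s @[s --> r] --> dS (m r) r.
    rewrite /dS; apply: cvg_big => [|i _]; first by apply: add_continuous.
    apply: cvgM; first exact: cvg_cst.
    apply: cvgM; first exact: cvg_cst.
    have h : s - i%:R @[s --> r] --> r - i%:R.
      by apply: cvgB; [exact: cvg_id|exact: cvg_cst].
    exact: (continuous_cvg _ (@ppart_continuous _) h).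
  apply: cvg_trans D; apply: near_eq_cvg.
  have : \forall s \near r, s < (m r)%:R by exact: lt_nbhsl.
  by apply: filterS => s sr; rewrite (dS_eq (ltW sr)).
- move=> r; split; apply: sumr_ge0 => k _; rewrite mulr_ge0//;
    [by rewrite mulr_ge0 ?ppart_ge0|exact: sqr_ge0].
- move=> r rb; rewrite (S_eq rb) /S big_geq//.
- move=> k r bk kr; have h : (k < m r)%N.
    by rewrite -(ltr_nat R) (lt_trans _ (rm r))// (lt_le_trans _ kr)// ltr_nat.
  have -> : S (m r) r = S k r + \sum_(k <= j < m r) a j * ppart (r - j%:R) ^+ 2.
    by rewrite /S (big_cat_nat (n := k))// ltnW.
  rewrite big_ltn//= addrCA; apply: ler_wpDr.
    apply: addr_ge0; apply: sumr_ge0 => j _;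
      by rewrite mulr_ge0// sqr_ge0.
  rewrite ler_peMr// exprn_ege1// /ppart le_max lerBrDr.
  by rewrite -natr1 addrC in kr; rewrite kr.
Qed.

End growth.

Section barriers.
Context {R : realType} {N : nat}.
Local Notation X := 'rV[R]_N.

Lemma enorm0 : enorm (0 : X) = 0.
Proof.
by apply/eqP; rewrite eq_le enorm_ge0 andbT (le_trans (enorm_le_norm _))// normr0 mulr0.
Qed.

(** A spatial weight with compact sublevel sets whose gradient is bounded by [1]:
    a multiple [d *: log_dist] costs at most [C * d] in an equation with speed
    bounded by [C]. *)
Definition log_dist (a : X) (p : X * R) : R := ln (1 + enorm (p.1 - a) ^+ 2).

Definition log_dist_grad (a : X) (p : X * R) : X :=
  (1 + enorm (p.1 - a) ^+ 2)^-1 *: (2 *: (p.1 - a)).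

Lemma log_dist_arg_gt0 (a x : X) : 0 < 1 + enorm (x - a) ^+ 2.
Proof. by rewrite ltr_pwDl// sqr_ge0. Qed.

Lemma log_dist_ge0 a p : 0 <= log_dist a p.
Proof. by rewrite /log_dist ln_ge0// lerDl sqr_ge0. Qed.

Lemma log_dist_center a t : log_dist a (a, t) = 0.
Proof. by rewrite /log_dist subrr enorm0 expr0n addr0 ln1. Qed.

Lemma C1_global_log_dist a :
  C1_global (log_dist a) (fun=> 0) (log_dist_grad a).
Proof.
have h := C1_globalD (C1_global_cst (1 : R)) (C1_global_sqdist a).
have h1 (p : X * R) := log_dist_arg_gt0 a p.1.
have h2 (p : X * R) : is_derive (1 + enorm (p.1 - a) ^+ 2) (1 : R) (@ln R)
   ((1 + enorm (p.1 - a) ^+ 2)^-1) by apply: is_derive1_ln; exact: h1.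
have h3 (p : X * R) : {for (1 + enorm (p.1 - a) ^+ 2), continuous (fun r : R => r^-1)}.
  by apply: inv_continuous; rewrite gt_eqF.
apply: eq_C1_global (C1_global_comp h2 h3 h) _ _ _ => p //.
  by rewrite addr0 mulr0.
by rewrite add0r.
Qed.

Lemma log_dist_grad_le1 a p : enorm (log_dist_grad a p) <= 1.
Proof.
have h := log_dist_arg_gt0 a p.1.
rewrite /log_dist_grad !enormZ normfV !gtr0_norm//.
rewrite mulrC ler_pdivrMr// mul1r; have := sqr_ge0 (enorm (p.1 - a) - 1); lra.
Qed.

Lemma log_dist_ball a p r : 0 <= r -> expR r < enorm (p.1 - a) -> r < log_dist a p.
Proof.
move=> r0 h; rewrite -(expRK r) ltr_ln ?posrE ?expR_gt0 ?log_dist_arg_gt0//.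
have : 1 <= expR r by rewrite -expR0 ler_expR.
move: h; move: (enorm _) (expR r) => e x; nra.
Qed.

(** The weight grows by a bounded amount, independent of the base point, when the
    point moves by at most [r]. *)
Lemma log_distD a (x z : X) (t s r : R) : enorm (x - z) <= r ->
  log_dist a (z, t) <= log_dist a (x, s) + ln (2 * (1 + r ^+ 2)).
Proof.
move=> h; have r0 : 0 <= r by apply: le_trans h; exact: enorm_ge0.
have r2 : 0 < 1 + r ^+ 2 by nra.
have r1 : 0 < 2 * (1 + r ^+ 2) by lra.
rewrite /log_dist -lnM ?posrE ?log_dist_arg_gt0//.
rewrite ler_ln ?posrE ?mulr_gt0 ?log_dist_arg_gt0//=.
have : enorm (z - a) <= r + enorm (x - a).
  rewrite (_ : z - a = (z - x) + (x - a)); last by rewrite addrA subrK.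
  by rewrite (le_trans (enormD _ _))// lerD2r enorm_distC.
have := enorm_ge0 (z - a); have := enorm_ge0 (x - a).
move: (enorm (z - a)) (enorm (x - a)) => p q q0 p0 pq.
have h1 : p ^+ 2 <= (r + q) ^+ 2 by rewrite lerXn2r ?nnegrE ?addr_ge0.
have h2 := sqr_ge0 (r - q); have h3 := sqr_ge0 (r * q).
have h4 := sqr_ge0 q; have h5 := sqr_ge0 r; nra.
Qed.

Variable T : R.
Hypothesis T0 : 0 < T.
Variables (C : R) (u0 : X -> R).
Hypothesis C0 : 0 <= C.

(** Viscosity subsolutions of [u_t <= C |Du|].  Every sub- or supersolution of the
    nonlocal equation is one, up to sign, as soon as [C] bounds the speed. *)
Definition speed_subsolution (u : X * R -> R) :=
  usc_in (strip T) u /\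
  forall phi dt Dx, C1_with T phi dt Dx -> forall p, max_point T (u \- phi) p ->
    (0 < p.2 -> dt p <= C * enorm (Dx p)) /\ (p.2 = 0 -> u p <= u0 p.1).

Lemma strip0 (x : X) : strip T (x, 0).
Proof. by rewrite /strip/= lexx ltW. Qed.

(** A strict classical supersolution is never touched from below at a positive time,
    so the maximum of [u - phi] is attained initially. *)
Lemma speed_subsolution_le (u phi dt : X * R -> R) (Dx : X * R -> X) (B : R) :
  speed_subsolution u -> C1_with T phi dt Dx ->
  (forall p, strip T p -> C * enorm (Dx p) < dt p) ->
  (exists p, max_point T (u \- phi) p) ->
  (forall x, u0 x - phi (x, 0) <= B) ->
  forall q, strip T q -> u q <= phi q + B.
Proof.
move=> [_ sub] C1 strict [p [Sp pmax]] hB q Sq.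
have [h1 h2] := sub _ _ _ C1 p (conj Sp pmax).
have p0 : p.2 = 0.
  apply/eqP; rewrite eq_le; apply/andP; split; last by case/andP: Sp.
  by rewrite leNgt; apply/negP => /h1; rewrite leNgt strict.
have := pmax q Sq; have := hB p.1; have := h2 p0.
rewrite /= -p0 -surjective_pairing; lra.
Qed.

(** The supremum over a ball is only known to be finite; it is the input of
    [fast_growing_C1]. *)
Lemma usc_in_bounded_ball (u : X * R -> R) (a : X) r : usc_in (strip T) u ->
  exists M, forall p, strip T p -> enorm (p.1 - a) <= r -> u p <= M.
Proof.
move=> uu; pose K := [set p : X * R | enorm (p.1 - a) <= r /\ 0 <= p.2 <= T].
have [K0|/set0P Kne] := eqVneq K set0.
  by exists 0 => p Sp pr; have : K p by []; rewrite K0.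
have KS : K `<=` strip T by move=> p [].
have [p _ pmax] := usc_in_compact_max (@compact_strip_ball _ _ T a r) Kne (usc_inS KS uu).
by exists (u p) => q Sq qr; apply: pmax.
Qed.

Lemma le_eps (x y c : R) : (forall e, 0 < e -> x <= y + e * c) -> x <= y.
Proof.
move=> h; rewrite leNgt; apply/negP => yx.
have c1 : 0 < `|c| + 1 by rewrite ltr_wpDl.
have e0 : 0 < (x - y) / 2 / (`|c| + 1) by rewrite !divr_gt0// subr_gt0.
have := h _ e0; rewrite leNgt => /negP; apply.
rewrite -ltrBrDl; apply: (@le_lt_trans _ _ ((x - y) / 2)); last lra.
rewrite mulrAC ler_pdivrMr// ler_wpM2l//; first lra.
by rewrite (le_trans (ler_norm c))// lerDl.
Qed.

(** Finite speed of propagation: the bound holds whatever the growth of [u] at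
    infinity.  With [Phi] vanishing on [r <= C T] and growing faster than [u], the
    function [Phi (log_dist x0 + C t) + eta t] is a strict supersolution which
    beats [u] at infinity and equals [eta t] on the axis through [x0]. *)
Lemma speed_subsolution_bounded (u : X * R -> R) A :
  speed_subsolution u -> (forall x, u0 x <= A) ->
  forall q, strip T q -> u q <= A.
Proof.
move=> su uA [x0 t0] Sq; have uu := su.1.
apply: (@le_eps _ _ t0) => eta eta0.
have /choice[M hM] : forall n : nat, exists M, forall p, strip T p ->
    enorm (p.1 - x0) <= expR n%:R -> u p <= M.
  by move=> n; exact: usc_in_bounded_ball.
pose b := (Num.truncn (C * T)).+1.
have CTb : C * T <= b%:R by rewrite ltW// truncnS_gt.
(* Where [n <= log_dist < n.+1], the point lies in the ball of index [n.+1] and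
   [Phi] is only known to exceed [a n.-1]: whence the shift by 2. *)
pose a n := `|M n.+2| + `|u (x0, 0)|.
have a_ge0 n : 0 <= a n by rewrite addr_ge0.
have [Phi [dPhi [P1 P2 P3 P4 P5]]] := fast_growing_C1 b a_ge0.
pose arg (p : X * R) := log_dist x0 p + C * p.2.
have Carg : C1_global arg (fun=> C) (log_dist_grad x0).
  apply: eq_C1_global (C1_globalD (C1_global_log_dist x0)
    (C1_globalM (C1_global_cst C) C1_global_time)) _ _ _ => p //.
    by rewrite mulr1 mulr0 addr0 add0r.
  by rewrite !scaler0 !addr0.
pose phi p := Phi (arg p) + eta * p.2.
have Cphi : C1_global phi (fun p => dPhi (arg p) * C + eta)
    (fun p => dPhi (arg p) *: log_dist_grad x0 p).
  apply: eq_C1_global (C1_globalD (C1_global_comp (fun p => P1 (arg p))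
    (fun p => P2 (arg p)) Carg)
    (C1_globalM (C1_global_cst eta) C1_global_time)) _ _ _ => p //.
    by rewrite mulr1 mulr0 addr0.
  by rewrite !scaler0 !addr0.
have phi_ge0 p : strip T p -> 0 <= phi p.
  by move=> /andP[p0 _]; rewrite addr_ge0 ?(P3 _).2// mulr_ge0// ltW.
have -> : A + eta * t0 = phi (x0, t0) + A.
  rewrite /phi /arg log_dist_center add0r P4 ?add0r 1?addrC//=.
  by rewrite (le_trans _ CTb)// ler_wpM2l//; case/andP: Sq.
apply: (@speed_subsolution_le u phi _ _ A su (C1_with_global _ Cphi)) => //.
- move=> p _; rewrite enormZ ger0_norm ?(P3 _).1// mulrA.
  rewrite (@le_lt_trans _ _ (C * dPhi (arg p)))//.
    by rewrite ler_piMr ?log_dist_grad_le1// mulr_ge0// (P3 _).1.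
  by rewrite mulrC ltrDl.
- pose K := [set p : X * R | enorm (p.1 - x0) <= expR b.+1%:R /\ 0 <= p.2 <= T].
  have KS : K `<=` strip T by move=> p [].
  have Kx0 : K (x0, 0).
    split; rewrite /= ?lexx ?(ltW T0)//.
    by rewrite subrr enorm0 expR_ge0.
  have [||p Sp pmax] := @usc_in_coercive_max _ _ (strip T) K (u \- phi) (x0, 0)
    (@compact_strip_ball _ _ T x0 _) KS Kx0.
  + apply: usc_inB_continuous => //; apply: continuous_subspaceT.
    by case: Cphi.
  + move=> q Sqs nKq.
    have qb : b.+1%:R < log_dist x0 q.
      apply: log_dist_ball => //; rewrite ltNge; apply/negP => qK.
      by apply: nKq; split.
    pose n := Num.truncn (log_dist x0 q).
    have nq : n%:R <= log_dist x0 q by rewrite truncn_le// log_dist_ge0.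
    have qn : log_dist x0 q < n.+1%:R by rewrite truncnS_gt.
    have bn : (b.+1 <= n)%N by rewrite -ltnS -(ltr_nat R) (lt_trans qb).
    have uM : u q <= M n.+1.
      apply: hM => //; rewrite leNgt; apply/negP => /log_dist_ball.
      by rewrite ltNge (ltW qn) => /(_ (ler0n _ _)).
    have aPhi : a n.-1 <= Phi (arg q).
      apply: P5; first by case: (n) bn.
      rewrite prednK; last exact: leq_trans bn.
      rewrite (le_trans nq)// lerDl mulr_ge0//; by case/andP: Sqs.
    have ph0 : phi (x0, 0) = 0.
      by rewrite /phi /arg log_dist_center /= !mulr0 !addr0 P4.
    rewrite /= ph0 subr0.
    move: aPhi; rewrite /a prednK; last exact: leq_trans bn.
    have := ler_norm (M n.+1); have := ler_norm (- u (x0, 0)); rewrite normrN /phi.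
    have : 0 <= eta * q.2 by rewrite mulr_ge0 ?(ltW eta0)//; case/andP: Sqs.
    lra.
  + by exists p.
- move=> x; have := uA x; have := phi_ge0 _ (strip0 x); lra.
Qed.

(** Uniform continuity gives the estimate for nearby points, boundedness for the
    others, where [log_dist] is bounded from below. *)
Lemma log_dist_modulus (A e : R) : (forall x, `|u0 x| <= A) ->
  unif_continuous u0 -> 0 < e ->
  exists2 k, 0 < k & forall x y t, u0 x <= u0 y + e + k * log_dist y (x, t).
Proof.
move=> uA /unif_continuousP uc e0.
have [d /= d0 hd] := uc e e0.
have A0 : 0 <= A by apply: le_trans (uA 0).
pose L := ln (1 + d ^+ 2).
have L0 : 0 < L by rewrite ln_gt0// ltrDl exprn_gt0.
pose k := 2 * A / L + 1.
have k0 : 0 < k by rewrite ltr_wpDl// divr_ge0 ?mulr_ge0// ltW.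
exists k => // x y t.
have [xd|xd] := ltP (enorm (y - x)) d.
  have : ball y d x by rewrite -ball_normE/= (le_lt_trans (norm_le_enorm _)).
  move=> /(hd (y, x)); rewrite -ball_normE/= distrC => h.
  have := le_lt_trans (ler_norm _) h.
  have : 0 <= k * log_dist y (x, t) by rewrite mulr_ge0 ?log_dist_ge0// ltW.
  lra.
have : L <= log_dist y (x, t).
  rewrite ler_ln ?posrE ?log_dist_arg_gt0//=; last first.
    by rewrite ltr_wpDr// exprn_ge0// ltW.
  by rewrite enorm_distC lerD2l lerXn2r ?nnegrE ?enorm_ge0// ltW.
move=> h; have : 2 * A <= k * log_dist y (x, t).
  apply: (@le_trans _ _ (k * L)); last by rewrite ler_wpM2l// ltW.
  by rewrite /k [leRHS]mulrDl divfK ?gt_eqF// mul1r lerDl ltW.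
have := uA x; have := uA y; rewrite !ler_norml => /andP[? ?] /andP[? ?]; lra.
Qed.

(** The barrier [u0 x0 + e + k log_dist x0 + (k C + 1) t] lies above [u0]
    initially by [log_dist_modulus].  The constant [K] is the same for all
    subsolutions, which Perron's method needs. *)
Lemma speed_subsolution_initial (A e : R) : (forall x, `|u0 x| <= A) ->
  unif_continuous u0 -> 0 < e ->
  exists2 K, 0 <= K & forall u, speed_subsolution u ->
    forall q, strip T q -> u q <= u0 q.1 + e + K * q.2.
Proof.
move=> uA uc e0; have [k k0 hk] := log_dist_modulus uA uc e0.
have kC : 0 <= k * C by rewrite mulr_ge0// ltW.
exists (k * C + 1); first by rewrite addr_ge0.
move=> u su [x0 t0] Sq /=.
have uleA : forall q, strip T q -> u q <= A.
  apply: speed_subsolution_bounded => // x.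
  exact: le_trans (ler_norm _) (uA x).
pose phi p := k * log_dist x0 p + (k * C + 1) * p.2.
have Cphi : C1_global phi (fun p => k * C + 1) (fun p => k *: log_dist_grad x0 p).
  apply: eq_C1_global (C1_globalD (C1_globalM (C1_global_cst k)
    (C1_global_log_dist x0))
    (C1_globalM (C1_global_cst (k * C + 1)) C1_global_time)) _ _ _ => p //.
    by rewrite mulr1 !mulr0 !addr0 add0r.
  by rewrite !scaler0 !addr0.
have -> : u0 x0 + e + (k * C + 1) * t0 = phi (x0, t0) + (u0 x0 + e).
  by rewrite /phi log_dist_center mulr0 add0r addrC.
apply: (@speed_subsolution_le u phi _ _ _ su (C1_with_global _ Cphi)) => //.
- move=> p _; rewrite enormZ gtr0_norm// mulrA.
  rewrite (@le_lt_trans _ _ (C * k))//.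
    by rewrite ler_piMr ?log_dist_grad_le1// mulr_ge0// ltW.
  by rewrite mulrC ltrDl.
- pose r0 := (A - u (x0, 0)) / k.
  have r00 : 0 <= r0.
    by rewrite divr_ge0 ?(ltW k0)// subr_ge0 uleA//; exact: strip0.
  pose K := [set p : X * R | enorm (p.1 - x0) <= expR r0 /\ 0 <= p.2 <= T].
  have KS : K `<=` strip T by move=> p [].
  have Kx0 : K (x0, 0).
    split; rewrite /= ?lexx ?(ltW T0)//.
    by rewrite subrr enorm0 expR_ge0.
  have [||p Sp pmax] := @usc_in_coercive_max _ _ (strip T) K (u \- phi) (x0, 0)
    (@compact_strip_ball _ _ T x0 _) KS Kx0.
  + apply: usc_inB_continuous; first exact: su.1.
    apply: continuous_subspaceT; by case: Cphi.
  + move=> q Sqs nKq.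
    have : r0 < log_dist x0 q.
      apply: log_dist_ball => //; rewrite ltNge; apply/negP => qK.
      by apply: nKq; split.
    rewrite ltr_pdivrMr// mulrC => h.
    have := uleA q Sqs.
    rewrite /= /phi log_dist_center !mulr0 addr0 subr0.
    have : 0 <= (k * C + 1) * q.2.
      by rewrite mulr_ge0 ?addr_ge0//; case/andP: Sqs.
    lra.
  + by exists p.
- by move=> x; rewrite /phi /= mulr0 addr0 lerBlDr hk.
Qed.

End barriers.

(** * Superlevel sets at a fixed time *)

Section slices.
Context {R : realType} {N : nat}.
Local Notation X := 'rV[R]_N.
Variable T : R.

Lemma closed_superlevel (u : X * R -> R) t a : usc_in (strip T) u ->
  0 <= t <= T -> closed [set y | a <= u (y, t)].
Proof.
move=> uu tT; rewrite -[X in closed X]setCK; apply: open_closedC.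
rewrite openE => y /= /negP; rewrite -ltNge => ya.
have cg : continuous (fun y : X => (y, t)).
  move=> z B [[/= U V] [/= zU tV] UVB]; rewrite /nbhs/=.
  by apply: filterS zU => w Uw; apply: (UVB (w, t)); split => //=; exact: nbhs_singleton.
have h : usc_in setT (u \o (fun y : X => (y, t))) by apply: (usc_in_comp cg) uu.
have := h y I a ya; rewrite /interior/=; apply: filterS => z /(_ I) /= za.
by apply/negP; rewrite -ltNge.
Qed.

Lemma open_superlevel (v : X * R -> R) t a : usc_in (strip T) (fun q => - v q) ->
  0 <= t <= T -> open [set y | a < v (y, t)].
Proof.
move=> uv tT; rewrite -[X in open X]setCK; apply: closed_openC.
rewrite (_ : ~` _ = [set y | - a <= - v (y, t)]).
  exact: (closed_superlevel uv tT).
by apply/seteqP; split=> y /=; rewrite lerN2 leNgt => /negP.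
Qed.

(** Uniform continuity in the time variable over a compact set of points, by a
    covering argument in which the modulus [d] varies along with the point. *)
Lemma uniform_in_time (K : set X) (f : X * R -> R) (e : R) :
  compact K -> {within strip T, continuous f} -> 0 < e ->
  exists2 d, 0 < d & forall x t s, K x -> 0 <= t <= T -> 0 <= s <= T ->
    `|t - s| < d -> `|f (x, t) - f (x, s)| <= e.
Proof.
move=> cK /subspace_continuousP cf e0.
have : compact (K `*` `[0, T]%classic).
  by apply: compact_setX => //; exact: segment_compact.
move=> /compact_near_coveringP/near_covering_withinP cc.
have : \forall d \near 0^'+, (K `*` `[0, T]%classic) `<=`
    (fun p : X * R => forall s, 0 <= s <= T -> `|p.2 - s| < d ->
      `|f p - f (p.1, s)| <= e).
  apply: (cc R 0^'+ (fun d (p : X * R) => forall s, 0 <= s <= T -> `|p.2 - s| < d ->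
      `|f p - f (p.1, s)| <= e)) => -[x t] [/= Kx]; rewrite in_itv/= => tT.
  have e20 : 0 < e / 2 by rewrite divr_gt0.
  have /cvgrPdist_le /(_ _ e20) := cf (x, t) tT.
  rewrite near_withinE => /nbhs_ballP[d /= d0 hd].
  have d20 : 0 < d / 2 by rewrite divr_gt0.
  near=> p r => -[/= Kp]; rewrite in_itv/= => pT s sT ps.
  have hp : ball (x, t) (d / 2) p by near: p; exact: nbhsx_ballx.
  have rd : r <= d / 2 by near: r; apply: nbhs_right_le.
  have [hp1 hp2] := hp.
  have h1 : `|f (x, t) - f p| <= e / 2.
    by apply: hd => //; apply: le_ball hp; lra.
  have h2 : `|f (x, t) - f (p.1, s)| <= e / 2.
    apply: hd => //; split => /=.
      by apply: le_ball hp1; lra.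
    rewrite (splitr d); apply: ball_triangle hp2 _.
    exact: lt_le_trans ps rd.
  rewrite (_ : f p - _ = (f (x, t) - f (p.1, s)) - (f (x, t) - f p)); last by ring.
  by rewrite (le_trans (ler_normB _ _))//; lra.
move=> h.
have h2 : \forall d \near 0^'+, (0 : R) < d by exact: nbhs_right_gt.
have [d [d0 hd]] := @filter_ex _ _ _ _ (filterI h2 h).
exists d => // x t s Kx tT sT ts.
by apply: (hd (x, t)) => //=; split => //=; rewrite in_itv.
Unshelve. all: by end_near. Qed.

End slices.

(** * The comparison principle *)

Section penalisation.
Context {R : realType} {N : nat}.
Local Notation X := 'rV[R]_N.
Variables (x0 : X) (al la be de et : R).

(** The exponential factor is there for its time derivative, which produces the
    term [la * al e^{la t} |x - y|^2] absorbing the Lipschitz error of the speeds. *)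
Definition penalty (p q : X * R) : R :=
  al * expR (la * p.2) * enorm (p.1 - q.1) ^+ 2 + be * (p.2 - q.2) ^+ 2 +
  de * log_dist x0 p + et * p.2.

Lemma C1_global_sqtime (b s : R) :
  C1_global (fun p : X * R => b * (p.2 - s) ^+ 2)
    (fun p => 2 * b * (p.2 - s)) (fun=> 0).
Proof.
have h : C1_global (fun p : X * R => p.2 - s) (fun=> 1) (fun=> 0).
  apply: eq_C1_global (C1_globalD C1_global_time (C1_global_cst (- s))) _ _ _ => p //;
    by rewrite addr0.
apply: eq_C1_global (C1_globalM (C1_global_cst b) (C1_globalM h h)) _ _ _ => p.
- by rewrite expr2.
- by rewrite !mulr1 mulr0 addr0; ring.
- by rewrite !scaler0 !addr0 scaler0.
Qed.

Lemma C1_global_penalty_left q : C1_global (fun p => penalty p q)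
  (fun p => la * (al * expR (la * p.2) * enorm (p.1 - q.1) ^+ 2) +
     2 * be * (p.2 - q.2) + et)
  (fun p => (2 * (al * expR (la * p.2))) *: (p.1 - q.1) +
     de *: log_dist_grad x0 p).
Proof.
have h1 : C1_global (fun p : X * R => la * p.2) (fun=> la) (fun=> 0).
  apply: eq_C1_global (C1_globalM (C1_global_cst la) C1_global_time) _ _ _ => p //.
    by rewrite mulr1 mulr0 addr0.
  by rewrite !scaler0 addr0.
have h2 : C1_global (fun p : X * R => expR (la * p.2))
    (fun p => expR (la * p.2) * la) (fun=> 0).
  apply: eq_C1_global (C1_global_comp (fun p => is_derive_expR _)
    (fun p => @continuous_expR R _) h1) _ _ _ => p //.
  by rewrite scaler0.
have h3 := C1_globalM (C1_globalM (C1_global_cst al) h2) (C1_global_sqdist q.1).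
have h4 := C1_globalM (C1_global_cst de) (C1_global_log_dist x0).
have h5 := C1_globalM (C1_global_cst et) (@C1_global_time R N).
apply: eq_C1_global (C1_globalD (C1_globalD (C1_globalD h3
  (C1_global_sqtime be q.2)) h4) h5) _ _ _ => p //.
- by rewrite !mulr0 mulr1 !addr0 add0r; ring.
- rewrite !scaler0 !addr0 scaler0 addr0 scalerA mulrC.
  by congr (_ *: _ + _).
Qed.

Lemma C1_global_penalty_right p : C1_global (fun q => - penalty p q)
  (fun q => 2 * be * (p.2 - q.2))
  (fun q => (2 * (al * expR (la * p.2))) *: (p.1 - q.1)).
Proof.
have h1 := C1_globalM (C1_global_cst (- (al * expR (la * p.2))))
   (C1_global_sqdist p.1).
have h2 := C1_globalD (C1_globalD h1 (C1_global_sqtime (- be) p.2))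
  (C1_global_cst (- (de * log_dist x0 p + et * p.2))).
apply: eq_C1_global h2 _ _ _ => q //.
- by rewrite /penalty [enorm (p.1 - q.1)]enorm_distC; ring.
- by ring.
- rewrite !scaler0 !addr0 scalerA -[p.1 - q.1]opprB scalerN -scaleNr.
  by congr (_ *: _); ring.
Qed.

Lemma continuous_penalty :
  continuous (fun pq : (X * R) * (X * R) => penalty pq.1 pq.2).
Proof.
move=> pq.
have c1 : (pq : (X * R) * (X * R)).1 @[pq --> pq] --> pq.1 by exact: cvg_fst.
have c2 : (pq : (X * R) * (X * R)).2 @[pq --> pq] --> pq.2 by exact: cvg_snd.
have c11 : (pq : (X * R) * (X * R)).1.1 @[pq --> pq] --> pq.1.1.
  exact: (continuous_cvg _ (@cvg_fst _ _ _ _ _) c1).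
have c12 : (pq : (X * R) * (X * R)).1.2 @[pq --> pq] --> pq.1.2.
  exact: (continuous_cvg _ (@cvg_snd _ _ _ _ _) c1).
have c21 : (pq : (X * R) * (X * R)).2.1 @[pq --> pq] --> pq.2.1.
  exact: (continuous_cvg _ (@cvg_fst _ _ _ _ _) c2).
have c22 : (pq : (X * R) * (X * R)).2.2 @[pq --> pq] --> pq.2.2.
  exact: (continuous_cvg _ (@cvg_snd _ _ _ _ _) c2).
rewrite /penalty; apply: cvgD; last by apply: cvgM => //; exact: cvg_cst.
apply: cvgD; last first.
  apply: cvgM; first exact: cvg_cst.
  have [_ _ cl _ _] := C1_global_log_dist x0.
  exact: (continuous_cvg _ (cl _) c1).
apply: cvgD.
  apply: cvgM.
    apply: cvgM; first exact: cvg_cst.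
    apply: (continuous_cvg _ (@continuous_expR R _)).
    by apply: cvgM => //; exact: cvg_cst.
  have h : enorm ((pq : (X * R) * (X * R)).1.1 - pq.2.1) @[pq --> pq] -->
     enorm (pq.1.1 - pq.2.1) by apply: cvg_enorm; exact: cvgB.
  rewrite expr2; under eq_fun do rewrite expr2; exact: cvgM.
apply: cvgM; first exact: cvg_cst.
rewrite expr2; under eq_fun do rewrite expr2.
by apply: cvgM; exact: cvgB.
Qed.

End penalisation.

(** The sets on which the nonlocal term is evaluated: [{u >= a}] is closed for a
    subsolution and [{v > a}] is open for a supersolution. *)
Definition open_or_closed {R : realType} {N : nat} (Z : set 'rV[R]_N) :=
  open Z \/ closed Z.

(** The properties of the nonlocal term on which comparison and existence rest.
    [J x t Z] stands for [(c0(.,t) * 1_Z)(x)].  One-sided inequalities suffice,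
    and [J_tail] and [J_limit] compare sets by an inclusion that may fail far away
    or along a beginning of the sequence. *)
Record nonlocal_data {R : realType} {N : nat} (T : R)
    (J : 'rV[R]_N -> R -> set 'rV[R]_N -> R) (c1 : 'rV[R]_N * R -> R)
    (u0 : 'rV[R]_N -> R) (m0 M1 L L1 A : R) : Prop := {
  T_gt0 : 0 < T;
  L_ge0 : 0 <= L;
  L1_ge0 : 0 <= L1;
  J_bound : forall x t Z, 0 <= t <= T -> open_or_closed Z -> 0 <= J x t Z <= m0;
  J_lip : forall e, 0 < e -> exists2 d, 0 < d &
    forall x y t s Z, 0 <= t <= T -> 0 <= s <= T -> open_or_closed Z ->
      `|t - s| < d -> J x t Z <= J y s Z + L * enorm (x - y) + e;
  J_mono : forall x t Y Z, 0 <= t <= T -> open_or_closed Y -> open_or_closed Z ->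
    Y `<=` Z -> J x t Y <= J x t Z;
  J_tail : forall e, 0 < e -> exists r, forall x t Y Z, 0 <= t <= T ->
    open_or_closed Y -> open_or_closed Z ->
    (forall z, enorm (x - z) <= r -> Y z -> Z z) -> J x t Y <= J x t Z + e;
  J_limit : forall x t (Y Z : nat -> set 'rV[R]_N) e, 0 <= t <= T -> 0 < e ->
    (forall n, open_or_closed (Y n)) -> (forall n, open_or_closed (Z n)) ->
    (forall z, \forall n \near \oo, Y n z -> Z n z) ->
    \forall n \near \oo, J x t (Y n) <= J x t (Z n) + e;
  c1_cont : {within strip T, continuous c1};
  c1_bound : forall x t, 0 <= t <= T -> `|c1 (x, t)| <= M1;
  c1_lip : forall x y t, 0 <= t <= T ->
    `|c1 (x, t) - c1 (y, t)| <= L1 * enorm (x - y);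
  u0_bound : forall x, `|u0 x| <= A;
  u0_uc : unif_continuous u0
}.

Section nonlocal.
Context {R : realType} {N : nat}.
Local Notation X := 'rV[R]_N.
Variables (T : R) (J : X -> R -> set X -> R) (c1 : X * R -> R) (u0 : X -> R).
Variables (m0 M1 L L1 A : R).

Definition speed_ge (u : X * R -> R) p :=
  c1 p + J p.1 p.2 [set y | u p <= u (y, p.2)].
Definition speed_gt (u : X * R -> R) p :=
  c1 p + J p.1 p.2 [set y | u p < u (y, p.2)].

Definition nonlocal_sub (u : X * R -> R) :=
  usc_in (strip T) u /\
  forall phi dt Dx, C1_with T phi dt Dx -> forall p, max_point T (u \- phi) p ->
    (0 < p.2 -> dt p <= speed_ge u p * enorm (Dx p)) /\
    (p.2 = 0 -> u p <= u0 p.1).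

Definition nonlocal_super (u : X * R -> R) :=
  usc_in (strip T) (fun q => - u q) /\
  forall phi dt Dx, C1_with T phi dt Dx -> forall p, min_point T (u \- phi) p ->
    (0 < p.2 -> dt p >= speed_gt u p * enorm (Dx p)) /\
    (p.2 = 0 -> u p >= u0 p.1).

Hypothesis D : nonlocal_data T J c1 u0 m0 M1 L L1 A.
Local Notation C := (M1 + m0).

Lemma speed_ge_bound u p : usc_in (strip T) u -> strip T p ->
  `|speed_ge u p| <= C.
Proof.
case: p => x t uu Sp; have Z : closed [set y | u (x, t) <= u (y, t)] := closed_superlevel uu Sp.
have /andP[h1 h2] := J_bound D x Sp (or_intror Z).
rewrite /speed_ge (le_trans (ler_normD _ _))// lerD ?(c1_bound D)//.
by rewrite ger0_norm.
Qed.

Lemma speed_gt_bound u p : usc_in (strip T) (fun q => - u q) -> strip T p ->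
  `|speed_gt u p| <= C.
Proof.
case: p => x t uu Sp; have Z : open [set y | u (x, t) < u (y, t)] := open_superlevel uu Sp.
have /andP[h1 h2] := J_bound D x Sp (or_introl Z).
rewrite /speed_gt (le_trans (ler_normD _ _))// lerD ?(c1_bound D)//.
by rewrite ger0_norm.
Qed.

Lemma C_ge0 : 0 <= C.
Proof.
have S0 : 0 <= (0 : R) <= T by rewrite lexx ltW// (T_gt0 D).
have /andP[h1 h2] := J_bound D 0 S0 (or_introl openT).
rewrite addr_ge0//; last exact: le_trans h1 h2.
exact: le_trans (normr_ge0 _) (c1_bound D 0 S0).
Qed.

Lemma nonlocal_sub_speed u : nonlocal_sub u -> speed_subsolution T C u0 u.
Proof.
move=> [uu su]; split=> // phi dt Dx h p mp; have [h1 h2] := su _ _ _ h p mp.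
split=> // /h1 /le_trans; apply; rewrite ler_wpM2r ?enorm_ge0//.
exact: le_trans (ler_norm _) (speed_ge_bound uu mp.1).
Qed.

Lemma nonlocal_super_speed v : nonlocal_super v ->
  speed_subsolution T C (fun x => - u0 x) (fun q => - v q).
Proof.
move=> [uv sv]; split=> // phi dt Dx h p [Sp mp].
have [|h1 h2] := sv _ _ _ (C1_withN h) p.
  by split=> // q Sq; have := mp q Sq; rewrite /=; lra.
split=> [/h1|/h2]; last by rewrite lerN2.
rewrite lerNr enormN => /le_trans; apply; rewrite -mulNr ler_wpM2r ?enorm_ge0//.
by apply: le_trans (ler_norm _) _; rewrite normrN (speed_gt_bound uv).
Qed.

(** The heart of comparison.  Maximality at [(p, q)] is tested at two points with
    the same space coordinate [z], where the quadratic penalty vanishes; the gain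
    [al e^{la t} |x - y|^2] exceeds the possible increase of the weight
    [log_dist], so that the inequality on the right is strict. *)
Lemma superlevel_inclusion (u v : X * R -> R) (x0 : X) al la be de et p q r z :
  (forall p' q', strip T p' -> strip T q' ->
    u p' - v q' - penalty x0 al la be de et p' q' <=
    u p - v q - penalty x0 al la be de et p q) ->
  strip T p -> strip T q -> 0 <= de ->
  de * ln (2 * (1 + r ^+ 2)) < al * expR (la * p.2) * enorm (p.1 - q.1) ^+ 2 ->
  enorm (p.1 - z) <= r -> u p <= u (z, p.2) -> v q < v (z, q.2).
Proof.
move=> mx Sp Sq de0 hde zr uz.
have := mx (z, p.2) (z, q.2) Sp Sq.
rewrite /penalty /= subrr enorm0 expr0n mulr0 add0r.
have := log_distD x0 p.2 p.2 zr; rewrite -surjective_pairing.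
move=> /(ler_wpM2l de0); rewrite mulrDr; lra.
Qed.

End nonlocal.

(** Assume that [u - v] is positive at [p0] and double the variables with [penalty],
    centred at [p0].  The penalty forces the maximum point [(p, q)] of the doubled
    function to have [p] and [q] close to each other, and the common initial datum
    then forces positive times.  The two
    viscosity inequalities at [(p, q)] differ by [et > 0], while the speeds are
    almost ordered by [superlevel_inclusion]. *)
Lemma comparison {R : realType} {N : nat} (T : R)
    (J : 'rV[R]_N -> R -> set 'rV[R]_N -> R) (c1 : 'rV[R]_N * R -> R)
    (u0 : 'rV[R]_N -> R) (m0 M1 L L1 A : R) (u v : 'rV[R]_N * R -> R) :
  nonlocal_data T J c1 u0 m0 M1 L L1 A ->
  nonlocal_sub T J c1 u0 u -> nonlocal_super T J c1 u0 v ->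
  forall q, strip T q -> u q <= v q.
Proof.
set X := 'rV[R]_N.
move=> D su sv p0 Sp0; rewrite leNgt; apply/negP => vu.
have C0 := C_ge0 D.
have su' := nonlocal_sub_speed D su; have sv' := nonlocal_super_speed D sv.
have cpC p := speed_ge_bound D (p := p) su.1.
have cmC p := speed_gt_bound D (p := p) sv.1.
set C := M1 + m0 in C0 su' sv' cpC cmC.
clearbody C.
case: D => T0 L0 L10 _ J_lip _ J_tail _ c1_cont _ c1_lip u0_bound u0_uc.
have A0 : 0 <= A by apply: le_trans (u0_bound 0).
have uA : forall q, strip T q -> u q <= A.
  apply: (speed_subsolution_bounded T0 C0 su') => x.
  exact: le_trans (ler_norm _) (u0_bound x).
have vA : forall q, strip T q -> - v q <= A.
  apply: (speed_subsolution_bounded T0 C0 sv') => x.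
  by apply: le_trans (ler_norm _) _; rewrite normrN.
pose th := (u p0 - v p0) / 4.
have th0 : 0 < th by rewrite divr_gt0// subr_gt0.
have thE : u p0 - v p0 = 4 * th by rewrite /th mulrC divfK.
clearbody th.
(* Slopes in time, common to all subsolutions, for [u] and [- v] near time 0;
   they will exclude a maximum at an initial time. *)
have th20 : 0 < th / 2 by rewrite divr_gt0.
have [K1 K10 hK1] := speed_subsolution_initial T0 C0 u0_bound u0_uc th20.
have Nu0_bound x : `|- u0 x| <= A by rewrite normrN.
have Nu0_uc : unif_continuous (fun x => - u0 x).
  apply/unif_continuousP => e e0; have /unif_continuousP := u0_uc.
  move=> /(_ e e0)[d d0 hd]; exists d => // xy /hd.
  by rewrite -!ball_normE/= -opprD normrN.
have [K2 K20 hK2] := speed_subsolution_initial T0 C0 Nu0_bound Nu0_uc th20.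
have [d /= d0 hd] := (unif_continuousP u0).1 u0_uc _ th0.
have T1 : 0 < T + 1 by rewrite addr_gt0.
(* The strict gain [et] in time costs at most [th] over [0,T]. *)
pose et := th / (T + 1).
have et0 : 0 < et by rewrite divr_gt0.
have etT t : 0 <= t <= T -> et * t <= th.
  move=> /andP[t0 tT]; rewrite /et mulrAC ler_pdivrMr// ler_wpM2l//.
    exact: ltW.
  by rewrite (le_trans tT)// lerDl.
clearbody et.
(* The rate making the exponential term absorb the Lipschitz error:
   [la * W = (L + L1) * n * D] for the quadratic term [W], the distance [n] and
   the slope [D] below. *)
pose la := 2 * (L + L1).
have la0 : 0 <= la by rewrite mulr_ge0// addr_ge0.
have laE : la = 2 * (L + L1) by [].
clearbody la.
pose E := expR (la * T).
have eE t : 0 <= t <= T -> 1 <= expR (la * t) <= E.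
  move=> /andP[t0 tT]; rewrite -expR0 !ler_expR mulr_ge0//=.
  by rewrite ler_wpM2l.
have E0 : 0 < E by exact: expR_gt0.
clearbody E.
have A1 : 0 < 2 * A + 1 by rewrite ltr_wpDl// mulr_ge0.
(* As [u - v <= 2 * A], this penalizes any distance larger than [d], the modulus
   of [u0] for the accuracy [th]. *)
pose al := (2 * A + 1) / d ^+ 2.
have al0 : 0 < al by rewrite divr_gt0 ?exprn_gt0.
have ald : al * d ^+ 2 = 2 * A + 1 by rewrite divfK// gt_eqF// exprn_gt0.
clearbody al.
have alE0 : 0 < al * E by rewrite mulr_gt0.
(* An upper bound for the slope [D], from [D ^+ 2 <= 4 * (al * E) * W] and
   [W <= 2 * A]. *)
pose Pm := 4 * (al * E) * (2 * A) + 1.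
have PmE : Pm = 4 * (al * E) * (2 * A) + 1 by [].
have Pm1 : 1 <= Pm by rewrite lerDr mulr_ge0 ?mulr_ge0// ltW.
clearbody Pm.
have Pm0 : 0 < Pm by apply: lt_le_trans Pm1.
have C1 : 0 < C + 1 by rewrite ltr_wpDl.
(* Slopes below [ka] are harmless, the speeds being bounded by [C]; slopes above
   [ka] make the quadratic term at least [tau]. *)
pose ka := et / (8 * (C + 1)).
have ka0 : 0 < ka by rewrite divr_gt0// mulr_gt0.
have kaE : ka * (8 * (C + 1)) = et by rewrite divfK// gt_eqF// mulr_gt0.
clearbody ka.
pose tau := ka ^+ 2 / (4 * (al * E)).
have tau0 : 0 < tau by rewrite divr_gt0 ?exprn_gt0// mulr_gt0.
have tauE : tau * (4 * (al * E)) = ka ^+ 2 by rewrite divfK// gt_eqF// mulr_gt0.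
clearbody tau.
(* The accuracy of the comparison of speeds; the error [3 * e1 * D] stays below
   [et].  It determines the radius [r] outside of which points are ignored. *)
pose e1 := et / (8 * Pm).
have e10 : 0 < e1 by rewrite divr_gt0// mulr_gt0.
have e1E : e1 * (8 * Pm) = et by rewrite divfK// gt_eqF// mulr_gt0.
clearbody e1.
have [r hr] := J_tail _ e10.
pose G := ln (2 * (1 + r ^+ 2)).
have G0 : 0 <= G by rewrite ln_ge0//; have := sqr_ge0 r; clear; lra.
have G1 : 0 < G + 1 by rewrite ltr_wpDl.
(* Small against the speed bound, and small enough
   for [superlevel_inclusion] at radius [r] as soon as [W >= tau]. *)
pose de := Num.min (et / (4 * (C + 1))) (tau / (2 * (G + 1))).
have de0 : 0 < de by rewrite lt_min divr_gt0 ?divr_gt0// mulr_gt0.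
have deC : de * C <= et / 4.
  have : de <= et / (4 * (C + 1)) by rewrite ge_min lexx.
  rewrite ler_pdivlMr ?mulr_gt0// => h; clear -h et0 de0; lra.
have deG : de * G < tau.
  have : de <= tau / (2 * (G + 1)) by rewrite ge_min lexx orbT.
  rewrite ler_pdivlMr ?mulr_gt0// => h.
  have : 0 <= de * G by rewrite mulr_ge0// ltW.
  clear -h tau0 de0; lra.
clearbody de.
(* Beyond this radius the weight alone defeats [u - v]. *)
pose R1 := expR (2 * A / de).
have R10 : 0 <= R1 by exact: expR_ge0.
have R1P p : strip T p -> R1 < enorm (p.1 - p0.1) -> 2 * A < de * log_dist p0.1 p.
  have r0 : 0 <= 2 * A / de by rewrite divr_ge0 ?mulr_ge0// ltW.
  by move=> Sp /(log_dist_ball r0); rewrite ltr_pdivrMr// [_ * de]mulrC.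
clearbody R1.
have [d2 d20 hd2] := J_lip _ e10.
have [d3 d30 hd3] := uniform_in_time (@compact_enorm_ball _ _ p0.1 R1) c1_cont e10.
pose K := K1 + K2.
have K0 : 0 <= K by rewrite addr_ge0.
have KE : K = K1 + K2 by [].
clearbody K.
have KK : 0 < K + 1 by rewrite ltr_wpDl.
(* The two times must be so close that [J] and [c1] change by at most [e1] between
   them, and that, if one of them vanishes, the other one is small against
   [th / K]. *)
pose si := Num.min (Num.min d2 d3) (th / (2 * (K + 1))).
have si0 : 0 < si by rewrite !lt_min d20 d30 divr_gt0// mulr_gt0.
have si2 : si <= d2 by rewrite !ge_min lexx.
have si3 : si <= d3 by rewrite !ge_min lexx orbT.
have siK : si * (2 * (K + 1)) <= th.
  by rewrite -ler_pdivlMr ?mulr_gt0// ge_min lexx orbT.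
clearbody si.
pose be := (2 * A + 1) / si ^+ 2.
have be0 : 0 < be by rewrite divr_gt0 ?exprn_gt0.
have besi : be * si ^+ 2 = 2 * A + 1 by rewrite divfK// gt_eqF// exprn_gt0.
clearbody be.
pose pen := penalty p0.1 al la be de et.
have pen_ge p q : strip T p -> strip T q ->
  [/\ al * enorm (p.1 - q.1) ^+ 2 <= pen p q, be * (p.2 - q.2) ^+ 2 <= pen p q &
      de * log_dist p0.1 p <= pen p q].
  move=> Sp Sq; have /andP[e1p _] := eE _ Sp.
  have h1 : al * enorm (p.1 - q.1) ^+ 2 <=
      al * expR (la * p.2) * enorm (p.1 - q.1) ^+ 2.
    by rewrite ler_wpM2r ?sqr_ge0// ler_peMr// ltW.
  have h2 : 0 <= al * enorm (p.1 - q.1) ^+ 2 by rewrite mulr_ge0 ?sqr_ge0// ltW.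
  have h3 : 0 <= be * (p.2 - q.2) ^+ 2 by rewrite mulr_ge0 ?sqr_ge0// ltW.
  have h4 : 0 <= de * log_dist p0.1 p by rewrite mulr_ge0 ?log_dist_ge0// ltW.
  have h5 : 0 <= et * p.2 by rewrite mulr_ge0 ?(ltW et0)//; case/andP: Sp.
  rewrite /pen /penalty; clear -h1 h2 h3 h4 h5; split; lra.
pose F (pq : (X * R) * (X * R)) := u pq.1 - v pq.2 - pen pq.1 pq.2.
have Fp0 : 3 * th <= F (p0, p0).
  rewrite /F /pen /penalty /= !subrr enorm0 expr0n !mulr0 !add0r.
  have := log_dist_center p0.1 p0.2; rewrite -surjective_pairing => ->.
  rewrite mulr0 add0r.
  by have := etT _ Sp0; clear -thE; lra.
have [p [q [Sp Sq mx F3]]] : exists p q, [/\ strip T p, strip T q,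
    forall p' q', strip T p' -> strip T q' -> F (p', q') <= F (p, q) &
    3 * th <= F (p, q)].
  pose KA := [set p : X * R | enorm (p.1 - p0.1) <= R1 /\ 0 <= p.2 <= T].
  pose KB := [set p : X * R | enorm (p.1 - p0.1) <= R1 + d /\ 0 <= p.2 <= T].
  have cK : compact (KA `*` KB) by apply: compact_setX; exact: compact_strip_ball.
  have KS : KA `*` KB `<=` strip T `*` strip T by move=> pq [[_ ?] [_ ?]].
  have K0' : (KA `*` KB) (p0, p0).
    by split; split => //; rewrite /= subrr enorm0 ?addr_ge0 ?expR_ge0// ltW.
  have uF : usc_in (strip T `*` strip T) F.
    apply: usc_inB_continuous; last first.
      exact/continuous_subspaceT/continuous_penalty.
    apply: usc_inD.
      by apply: (@usc_in_comp _ _ _ (strip T) _ fst u) su.1 => [pq|pq []//]; exact: cvg_fst.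
    by apply: (@usc_in_comp _ _ _ (strip T) _ snd (fun q => - v q)) sv.1 => [pq|pq []//]; exact: cvg_snd.
  have [|[p q] [Sp Sq] mx] := usc_in_coercive_max cK KS K0' uF.
    move=> [p q] [/= Sp Sq] nK; apply: le_trans (_ : 0 <= _); last first.
      by apply: le_trans Fp0; rewrite mulr_ge0// ltW.
    have := uA p Sp; have := vA q Sq; have [h1 h2 h3] := pen_ge p q Sp Sq.
    suff : 2 * A <= pen p q by rewrite /F /=; clear; lra.
    have [pR|pR] := leP (enorm (p.1 - p0.1)) R1; last first.
      by apply: le_trans h3; apply/ltW/R1P.
    have [qR|qR] := leP (enorm (q.1 - p0.1)) (R1 + d).
      by exfalso; apply: nK; split; split.
    have dpq : d <= enorm (p.1 - q.1).
      have := enormD (q.1 - p.1) (p.1 - p0.1); rewrite addrA subrK.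
      by rewrite (enorm_distC q.1 p.1); clear -qR pR; lra.
    apply: le_trans h1; apply: (@le_trans _ _ (al * d ^+ 2)).
      by rewrite ald; clear; lra.
    by rewrite ler_wpM2l ?(ltW al0)// lerXn2r ?nnegrE ?enorm_ge0// ltW.
  exists p, q; split => // [p' q' Sp' Sq'|]; first exact: (mx (p', q')).
  exact: le_trans Fp0 (mx (p0, p0) _).
have [pe1 pe2 pe3] := pen_ge p q Sp Sq.
have penle : pen p q + 3 * th <= 2 * A.
  by have := uA p Sp; have := vA q Sq; move: F3; rewrite /F /=; clear; lra.
have uv3 : 3 * th <= u p - v q.
  have : 0 <= pen p q by apply: le_trans pe1; rewrite mulr_ge0 ?sqr_ge0// ltW.
  by move: F3; rewrite /F /=; clear; lra.
pose n := enorm (p.1 - q.1).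
have n0 : 0 <= n by exact: enorm_ge0.
have nd : n < d.
  rewrite ltNge; apply/negP => dn.
  have : al * d ^+ 2 <= al * n ^+ 2.
    by rewrite ler_wpM2l ?(ltW al0)// lerXn2r ?nnegrE// ltW.
  rewrite ald; move: pe1 penle th0; rewrite -/n; clear; lra.
have tsi : `|p.2 - q.2| < si.
  rewrite ltNge; apply/negP => sn.
  have : be * si ^+ 2 <= be * `|p.2 - q.2| ^+ 2.
    by rewrite ler_wpM2l ?(ltW be0)// lerXn2r ?nnegrE// ltW.
  rewrite besi real_normK ?num_real//; clear -pe2 penle th0; lra.
have [p2 _] := andP Sp; have [q2 _] := andP Sq.
(* If one time is 0 then both are at most [si], and the estimates at time 0 bound
   [u p - v q] by [u0 p.1 - u0 q.1 + 3 / 2 * th < 3 * th]. *)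
have pos : ~ (p.2 = 0 \/ q.2 = 0).
  move=> h; have pq2 : p.2 + q.2 = `|p.2 - q.2|.
    case: h => ->; first by rewrite add0r sub0r normrN ger0_norm.
    by rewrite addr0 subr0 ger0_norm.
  have h1 : K1 * p.2 + K2 * q.2 <= th / 2.
    have : (p.2 + q.2) * (2 * (K + 1)) <= th.
      apply: le_trans siK; rewrite pq2 ler_wpM2r ?(ltW tsi)// mulr_ge0//.
      exact: ltW.
    rewrite KE => h1.
    have : 0 <= p.2 + q.2 by rewrite addr_ge0.
    have : 0 <= K1 * q.2 by rewrite mulr_ge0.
    have : 0 <= K2 * p.2 by rewrite mulr_ge0.
    clear -h1; lra.
  have := hK1 u su' p Sp; have := hK2 _ sv' q Sq.
  have : ball p.1 d q.1.
    by rewrite -ball_normE/= (le_lt_trans (norm_le_enorm _)).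
  move=> /(hd (p.1, q.1)); rewrite -ball_normE/= ltr_norml => /andP[_].
  move: uv3 h1 th0; clear; lra.
have p2' : 0 < p.2.
  by rewrite lt_neqAle p2 andbT eq_sym; apply/eqP => h; apply: pos; left.
have q2' : 0 < q.2.
  by rewrite lt_neqAle q2 andbT eq_sym; apply/eqP => h; apply: pos; right.
pose ex := expR (la * p.2).
have ex0 : 0 < ex by exact: expR_gt0.
have exE : ex <= E by have /andP[] := eE _ Sp.
pose W := al * ex * n ^+ 2.
have W0 : 0 <= W by rewrite mulr_ge0 ?sqr_ge0// mulr_ge0// ltW.
pose P := (2 * (al * ex)) *: (p.1 - q.1).
pose D := enorm P.
have Dn : D = 2 * (al * ex) * n by rewrite /D enormZ gtr0_norm// !mulr_gt0.
have D0 : 0 <= D by exact: enorm_ge0.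
pose cp := speed_ge J c1 u p. pose cm := speed_gt J c1 v q.
have {}cpC : `|cp| <= C by exact: cpC.
have {}cmC : `|cm| <= C by exact: cmC.
have uineq : la * W + 2 * be * (p.2 - q.2) + et <= cp * D + C * de.
  have [|h _] := su.2 _ _ _ (C1_with_global T
    (C1_global_penalty_left p0.1 al la be de et q)) p.
    split=> // p' Sp'; have := mx p' q Sp' Sq; rewrite /F /pen /=; clear; lra.
  apply: (le_trans (h p2')); rewrite -/cp -/ex -/P.
  set Q := de *: _.
  have Qde : enorm Q <= de.
    by rewrite enormZ gtr0_norm// ler_piMr ?log_dist_grad_le1// ltW.
  have h1 : `|enorm (P + Q) - D| <= de.
    rewrite ler_norml lerBlDl (le_trans (enormD _ _)) ?lerD2l// andbT.
    by rewrite lerBrDl (le_trans _ (enormDl_ge _ _))// lerD2l lerN2.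
  rewrite -lerBlDl -mulrBr (le_trans (ler_norm _))// normrM.
  by rewrite ler_pM.
have vineq : cm * D <= 2 * be * (p.2 - q.2).
  have [|h _] := sv.2 _ _ _ (C1_with_global T
    (C1_global_penalty_right p0.1 al la be de et p)) q.
    split=> // q' Sq'; have := mx p q' Sp Sq'; rewrite /F /pen /=; clear; lra.
  exact: (h q2').
(* Subtracting the two viscosity inequalities; the weight only costs [C * de]. *)
have key : la * W + et <= (cp - cm) * D + et / 4.
  by rewrite mulrBl; clear -deC uineq vineq; lra.
have [Dka|kaD] := leP D ka.
  have h1 : (cp - cm) * D <= (2 * C) * ka.
    rewrite (le_trans (ler_norm _))// normrM (ger0_norm D0).
    by rewrite ler_pM// (le_trans (ler_normB _ _))// mulr_natl mulr2n lerD.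
  have : 0 <= la * W by rewrite mulr_ge0.
  by clear -key h1 kaE et0 ka0; lra.
have D2 : D ^+ 2 = 4 * (al * ex) * W by rewrite Dn /W; ring.
have tauW : tau <= W.
  have h1 : ka ^+ 2 <= D ^+ 2 by rewrite lerXn2r ?nnegrE ?(ltW ka0)// ltW.
  have k1 : 0 < 4 * (al * E) by rewrite mulr_gt0.
  rewrite -(ler_pM2r k1) tauE; apply: le_trans h1 _.
  rewrite D2 [leRHS]mulrC; apply: ler_wpM2r => //; apply: ler_wpM2l => //.
  by apply: ler_wpM2l => //; exact: ltW.
have WA : W <= 2 * A.
  have : W <= pen p q.
    have h2 : 0 <= be * (p.2 - q.2) ^+ 2 by rewrite mulr_ge0 ?sqr_ge0// ltW.
    have h3 : 0 <= de * log_dist p0.1 p by rewrite mulr_ge0 ?log_dist_ge0// ltW.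
    have h4 : 0 <= et * p.2 by rewrite mulr_ge0// ltW.
    by rewrite /pen /penalty -/ex -/n -/W; clear -h2 h3 h4; lra.
  by clear -penle th0; lra.
have DPm : D <= Pm.
  rewrite leNgt; apply/negP => PD.
  have : D ^+ 2 <= Pm - 1.
    rewrite D2 PmE addrK; apply: ler_pM => //.
      by rewrite mulr_ge0// mulr_ge0// ltW.
    by rewrite ler_wpM2l// ler_wpM2l// ltW.
  by rewrite expr2; clear -PD Pm1; nra.
pose Y := [set y | u p <= u (y, p.2)]. pose Z := [set y | v q < v (y, q.2)].
have oY : open_or_closed Y by right; exact: (closed_superlevel su.1 Sp).
have oZ : open_or_closed Z by left; exact: (open_superlevel sv.1 Sq).
have incl z : enorm (p.1 - z) <= r -> Y z -> Z z.
  exact: (@superlevel_inclusion R N T u v p0.1 al la be de et p q r z mx Sp Sq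
    (ltW de0) (lt_le_trans deG tauW)).
have J1 := hr p.1 p.2 Y Z Sp oY oZ incl.
have td2 : `|p.2 - q.2| < d2 by exact: lt_le_trans tsi si2.
have td3 : `|p.2 - q.2| < d3.
  exact: lt_le_trans tsi si3.
have J2 := hd2 p.1 q.1 p.2 q.2 Z Sp Sq oZ td2.
have pR1 : enorm (p.1 - p0.1) <= R1.
  rewrite leNgt; apply/negP => /(R1P p Sp); move: pe3 penle th0; clear; lra.
have J3 := hd3 p.1 p.2 q.2 pR1 Sp Sq td3.
have J4 := c1_lip p.1 q.1 q.2 Sq.
have cc : cp - cm <= (L + L1) * n + 3 * e1.
  rewrite /cp /cm /speed_ge /speed_gt -/Y -/Z.
  move: J3 J4; rewrite !ler_norml -!surjective_pairing => /andP[_ J3] /andP[_ J4].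
  move: J1 J2; rewrite -/n in J4 *; clear -J3 J4; lra.
have h1 : (cp - cm) * D <= ((L + L1) * n + 3 * e1) * D by rewrite ler_wpM2r.
have h2 : (L + L1) * n * D = la * W by rewrite Dn laE /W; ring.
have h3 : e1 * D <= et / 8.
  have : e1 * D <= e1 * Pm by rewrite ler_wpM2l// ltW.
  by move: e1E; clear; lra.
by move: key h1 h3 et0; rewrite [(_ + 3 * e1) * D]mulrDl h2; clear; lra.
Qed.

(** * Semicontinuous envelopes *)

Section envelopes.
Context {R : realType} {N : nat}.
Local Notation X := 'rV[R]_N.
Variable T : R.
Implicit Types u : X * R -> R.

Lemma locally_boundedN u : locally_bounded T u -> locally_bounded T (\- u).
Proof.
move=> bu p Sp; have := bu p Sp; rewrite /bounded_near.
by apply: filterS => M; apply: filterS => q /=; rewrite normrN.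
Qed.

(** Local boundedness makes the extended-real limit superior finite, so that taking
    its real part loses nothing. *)
Lemma usc_envelope_fin u p : locally_bounded T u -> strip T p ->
  limf_esup (EFin \o u) (within (strip T) (nbhs p)) \is a fin_num.
Proof.
move=> bu Sp; have := bu p Sp; rewrite /bounded_near => bM.
have [M hM] := @filter_ex _ _ _ _ bM.
rewrite fin_numElt; apply/andP; split.
  apply: (@lt_le_trans _ _ (u p)%:E); first exact: ltNyr.
  rewrite limf_esupE; apply: le_ereal_inf_tmp => _ [V FV <-].
  apply: ereal_sup_ubound; exists p => //.
  by have := nbhs_singleton FV; apply.
apply: (@le_lt_trans _ _ M%:E); last exact: ltry.
rewrite limf_esupE; apply: ge_ereal_inf.
exists (ereal_sup ((EFin \o u) @` [set q | `|u q| <= M])).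
  by exists [set q | `|u q| <= M].
apply: ge_ereal_sup => _ [q /= qM <-]; rewrite lee_fin.
exact: le_trans (ler_norm _) qM.
Qed.

Lemma le_usc_envelope u p : locally_bounded T u -> strip T p ->
  u p <= usc_envelope T u p.
Proof.
move=> bu Sp; rewrite -lee_fin fineK ?usc_envelope_fin//.
rewrite limf_esupE; apply: le_ereal_inf_tmp => _ [V FV <-].
apply: ereal_sup_ubound; exists p => //.
by have := nbhs_singleton FV; apply.
Qed.

(** With [usc_envelope_approx], the envelope in terms of levels: the values nearby
    are not much larger, and some of them are almost as large. *)
Lemma near_lt_usc_envelope u p a : locally_bounded T u -> strip T p ->
  usc_envelope T u p < a -> \forall q \near p, strip T q -> u q < a.
Proof.
move=> bu Sp; rewrite -lte_fin fineK ?usc_envelope_fin//.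
rewrite limf_esupE => /ereal_inf_lt[_ [V FV <-] Va].
move: FV; rewrite /within/=; apply: filterS => q qV /qV Vq.
by rewrite -lte_fin (le_lt_trans _ Va)//; apply: ereal_sup_ubound; exists q.
Qed.

Lemma usc_envelope_approx u p a (B : set (X * R)) : locally_bounded T u ->
  strip T p -> a < usc_envelope T u p -> nbhs p B ->
  exists q, [/\ strip T q, B q & a < u q].
Proof.
move=> bu Sp; rewrite -lte_fin fineK ?usc_envelope_fin// => ap pB.
have : (a%:E < ereal_sup ((EFin \o u) @` (B `&` strip T)))%E.
  apply: (lt_le_trans ap); rewrite limf_esupE; apply: ereal_inf_lbound.
  exists (B `&` strip T) => //; rewrite /within/=.
  by apply: filterS pB => q Bq Sq.
move=> /ereal_sup_gt[_ [q [Bq Sq] <-]] aq; exists q; split => //.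
Qed.

Lemma usc_envelope_usc u : locally_bounded T u -> usc_in (strip T) (usc_envelope T u).
Proof.
move=> bu p Sp a pa; pose b := (usc_envelope T u p + a) / 2.
have pb : usc_envelope T u p < b by rewrite /b; lra.
have ba : b < a by rewrite /b; lra.
have := near_lt_usc_envelope bu Sp pb; rewrite -nbhs_nearE => /nbhs_interior.
apply: filterS => q qB Sq; rewrite (le_lt_trans _ ba)//.
rewrite leNgt; apply/negP => bq.
have [r [Sr Br br]] := usc_envelope_approx bu Sq bq qB.
by have := Br Sr; rewrite ltNge (ltW br).
Qed.

(** Transports every statement on upper envelopes to lower ones. *)
Lemma lsc_envelopeE u p : lsc_envelope T u p = - usc_envelope T (\- u) p.
Proof.
rewrite /lsc_envelope /usc_envelope /limf_einf fineN.
by congr (- fine (limf_esup _ _)); apply/funext => q.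
Qed.

Lemma lsc_envelope_le u p : locally_bounded T u -> strip T p ->
  lsc_envelope T u p <= u p.
Proof.
move=> bu Sp; rewrite lsc_envelopeE lerNl.
exact: (le_usc_envelope (locally_boundedN bu)).
Qed.

Lemma lsc_envelope_lsc u : locally_bounded T u ->
  usc_in (strip T) (fun q => - lsc_envelope T u q).
Proof.
move=> bu; rewrite (_ : (fun q => _) = usc_envelope T (\- u)).
  exact/usc_envelope_usc/locally_boundedN.
by apply/funext => q; rewrite lsc_envelopeE opprK.
Qed.

(** The values of [u] that approach the lower envelope at [p] dominate those of [w],
    which tend to [w p]. *)
Lemma continuous_le_lsc_envelope u w : locally_bounded T u ->
  {within strip T, continuous w} -> (forall q, strip T q -> w q <= u q) ->
  forall p, strip T p -> w p <= lsc_envelope T u p.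
Proof.
move=> bu /subspace_continuousP cw wu p Sp; rewrite lsc_envelopeE leNgt.
apply/negP => h; pose b := (w p - usc_envelope T (\- u) p) / 2.
have b1 : - b < usc_envelope T (\- u) p by rewrite /b; lra.
have b2 : b < w p by rewrite /b; lra.
have pB : \forall q \near p, strip T q -> b < w q.
  by have := cw p Sp; move/cvgr_gt => /(_ _ b2); rewrite near_withinE.
have [q [Sq Bq bq]] := usc_envelope_approx (locally_boundedN bu) Sp b1 pB.
by have := Bq Sq; have := wu q Sq; move: bq => /=; lra.
Qed.

End envelopes.

Section sequences_in_strip.
Context {R : realType} {N : nat}.
Local Notation X := 'rV[R]_N.

(** The squared distance in space-time: smooth, hence usable inside test functions,
    to make a maximum strict. *)
Definition sqdist (p q : X * R) : R :=
  enorm (q.1 - p.1) ^+ 2 + (q.2 - p.2) ^+ 2.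

Lemma sqdist_ge0 p q : 0 <= sqdist p q.
Proof. by rewrite addr_ge0 ?sqr_ge0. Qed.

Lemma sqdist0 p : sqdist p p = 0.
Proof. by rewrite /sqdist !subrr enorm0 expr0n addr0. Qed.

Lemma C1_global_sqdist2 p : C1_global (sqdist p)
  (fun q => 2 * (q.2 - p.2)) (fun q => 2 *: (q.1 - p.1)).
Proof.
apply: eq_C1_global (C1_globalD (C1_global_sqdist p.1) (C1_global_sqtime 1 p.2)) _ _ _.
- by move=> q; rewrite mul1r.
- by move=> q; rewrite add0r mulr1.
- by move=> q; rewrite addr0.
Qed.

Lemma continuous_sqdist p : continuous (sqdist p).
Proof. by case: (C1_global_sqdist2 p). Qed.

Lemma cvg_sqdist (p : X * R) (p_ : nat -> X * R) :
  sqdist p (p_ n) @[n --> \oo] --> 0 -> p_ n @[n --> \oo] --> p.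
Proof.
move=> h; apply/cvg_ballP => e e0.
have e20 : 0 < e ^+ 2 by rewrite exprn_gt0.
have := h; move/cvgr_lt => /(_ _ e20); apply: filterS => n hn.
have h1 : enorm ((p_ n).1 - p.1) < e.
  rewrite ltNge; apply/negP => he.
  have : e ^+ 2 <= enorm ((p_ n).1 - p.1) ^+ 2 by rewrite lerXn2r ?nnegrE ?enorm_ge0 ?(ltW e0).
  by move: hn; rewrite /sqdist; have := sqr_ge0 ((p_ n).2 - p.2); lra.
have h2 : `|(p_ n).2 - p.2| < e.
  rewrite ltNge; apply/negP => he.
  have : e ^+ 2 <= `|(p_ n).2 - p.2| ^+ 2 by rewrite lerXn2r ?nnegrE ?(ltW e0).
  rewrite real_normK ?num_real//.
  by move: hn; rewrite /sqdist; have := sqr_ge0 (enorm ((p_ n).1 - p.1)); lra.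
split; last by rewrite /ball/= distrC.
by rewrite -ball_normE/= distrC (le_lt_trans (norm_le_enorm _)).
Qed.

Lemma cvg_in_strip (W : topologicalType) (S : set (X * R)) (f : X * R -> W) p
    (p_ : nat -> X * R) : {within S, continuous f} -> S p -> (forall n, S (p_ n)) ->
  p_ n @[n --> \oo] --> p -> f (p_ n) @[n --> \oo] --> f p.
Proof.
move=> /subspace_continuousP cf Sp Sp_ cp A hA.
have := cf p Sp A hA; rewrite /nbhs/= /within/= => /cp.
by rewrite /nbhs/=; apply: filterS => n; exact.
Qed.

Lemma cvg_harmonic_le (f : nat -> R) (c : R) :
  (forall n, 0 <= f n <= c * n.+1%:R^-1) -> f n @[n --> \oo] --> 0.
Proof.
move=> h; apply: (@squeeze_cvgr _ _ _ _ (fun=> 0) (fun n => c * n.+1%:R^-1)).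
- by apply: nearW => n; exact: h.
- exact: cvg_cst.
- rewrite -[X in _ --> X](mulr0 c); apply: cvgM; first exact: cvg_cst.
  exact: cvg_harmonic.
Qed.

End sequences_in_strip.

(** * Stability of the nonlocal term *)

Section stability.
Context {R : realType} {N : nat}.
Local Notation X := 'rV[R]_N.
Variables (T : R) (J : X -> R -> set X -> R) (c1 : X * R -> R) (u0 : X -> R).
Variables (m0 M1 L L1 A : R).
Hypothesis D : nonlocal_data T J c1 u0 m0 M1 L L1 A.

Lemma cvg_slice (p : X * R) (p_ : nat -> X * R) (z : X) :
  p_ n @[n --> \oo] --> p -> (z, (p_ n).2) @[n --> \oo] --> (z, p.2).
Proof.
move=> cp B [[/= U V] [/= zU pV] UVB]; rewrite /nbhs/=.
have h2 : (p_ n).2 @[n --> \oo] --> p.2 by exact: (continuous_cvg _ (@cvg_snd _ _ _ _ _) cp).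
have := h2 V pV; rewrite /nbhs/=; apply: filterS => n Vn.
by apply: (UVB (z, (p_ n).2)); split => //=; exact: nbhs_singleton.
Qed.

(** Continuity of [J] in [(x, t)], uniformly in the set. *)
Lemma J_near_le (p : X * R) (p_ : nat -> X * R) e : strip T p ->
  (forall n, strip T (p_ n)) -> p_ n @[n --> \oo] --> p -> 0 < e ->
  \forall n \near \oo, forall Z, open_or_closed Z ->
    J (p_ n).1 (p_ n).2 Z <= J p.1 p.2 Z + e /\
    J p.1 p.2 Z <= J (p_ n).1 (p_ n).2 Z + e.
Proof.
move=> Sp Sp_ cp e0; have e20 : 0 < e / 2 by rewrite divr_gt0.
have [d d0 hd] := J_lip D e20.
have h1 : (p_ n).1 @[n --> \oo] --> p.1 by exact: (continuous_cvg _ (@cvg_fst _ _ _ _ _) cp).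
have h2 : (p_ n).2 @[n --> \oo] --> p.2 by exact: (continuous_cvg _ (@cvg_snd _ _ _ _ _) cp).
have h3 : L * enorm ((p_ n).1 - p.1) @[n --> \oo] --> 0.
  rewrite -(mulr0 L) -(@enorm0 R N) -(subrr p.1); apply: cvgM; first exact: cvg_cst.
  by apply: cvg_enorm; apply: cvgB => //; exact: cvg_cst.
have h4 : \forall n \near \oo, L * enorm ((p_ n).1 - p.1) < e / 2.
  by move: h3 => /cvgr_lt; apply.
have h5 : \forall n \near \oo, `|p.2 - (p_ n).2| < d.
  by move: h2 => /cvgrPdist_lt; apply.
near=> n => Z oZ.
have k4 : L * enorm ((p_ n).1 - p.1) < e / 2 by near: n.
have k5 : `|p.2 - (p_ n).2| < d by near: n.
split.
  have := hd (p_ n).1 p.1 (p_ n).2 p.2 Z (Sp_ n) Sp oZ.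
  rewrite distrC => /(_ k5); lra.
have := hd p.1 (p_ n).1 p.2 (p_ n).2 Z Sp (Sp_ n) oZ k5.
rewrite enorm_distC; lra.
Unshelve. all: by end_near. Qed.

(** Upper semicontinuity of [u |-> J {u >= u(p)}] under the relaxed limits that
    occur in Perron's method: pointwise, [U < U p] at [z] excludes [z] from the
    superlevel sets for large [n], so that [J_limit] applies. *)
Lemma J_superlevel_usc (U : X * R -> R) p (p_ : nat -> X * R) (a_ : nat -> R) e :
  usc_in (strip T) U -> strip T p -> (forall n, strip T (p_ n)) ->
  p_ n @[n --> \oo] --> p ->
  (forall m, m < U p -> \forall n \near \oo, m < a_ n) -> 0 < e ->
  \forall n \near \oo, J (p_ n).1 (p_ n).2 [set y | a_ n <= U (y, (p_ n).2)] <=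
    J p.1 p.2 [set y | U p <= U (y, p.2)] + e.
Proof.
move=> uU Sp Sp_ cp ha e0; have e20 : 0 < e / 2 by rewrite divr_gt0.
have oY n : open_or_closed [set y | a_ n <= U (y, (p_ n).2)].
  by right; exact: (closed_superlevel uU (Sp_ n)).
have oZ : open_or_closed [set y | U p <= U (y, p.2)].
  by right; exact: (closed_superlevel uU Sp).
have h1 : \forall n \near \oo, J p.1 p.2 [set y | a_ n <= U (y, (p_ n).2)] <=
    J p.1 p.2 [set y | U p <= U (y, p.2)] + e / 2.
  apply: (@J_limit _ _ _ _ _ _ _ _ _ _ _ D p.1 p.2
    (fun n => [set y | a_ n <= U (y, (p_ n).2)])
    (fun=> [set y | U p <= U (y, p.2)])) => //.
  move=> z; have [Uz|Uz] := leP (U p) (U (z, p.2)); first exact: nearW.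
  pose m := (U p + U (z, p.2)) / 2.
  have m1 : m < U p by rewrite /m; lra.
  have m2 : U (z, p.2) < m by rewrite /m; lra.
  have k1 := ha m m1.
  have k2 : \forall n \near \oo, strip T (z, (p_ n).2) -> U (z, (p_ n).2) < m.
    have h := uU (z, p.2) Sp m m2.
    exact: (cvg_slice cp h).
  near=> n => /= an; exfalso.
  have q1 : m < a_ n by near: n.
  have q2 : U (z, (p_ n).2) < m by (have : strip T (z, (p_ n).2) by exact: Sp_); near: n.
  lra.
have h2 := J_near_le Sp Sp_ cp e20.
near=> n; have k1 : J p.1 p.2 [set y | a_ n <= U (y, (p_ n).2)] <=
    J p.1 p.2 [set y | U p <= U (y, p.2)] + e / 2 by near: n.
have k2 : J (p_ n).1 (p_ n).2 [set y | a_ n <= U (y, (p_ n).2)] <=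
   J p.1 p.2 [set y | a_ n <= U (y, (p_ n).2)] + e / 2.
  have : forall Z, open_or_closed Z ->
    J (p_ n).1 (p_ n).2 Z <= J p.1 p.2 Z + e / 2 /\
    J p.1 p.2 Z <= J (p_ n).1 (p_ n).2 Z + e / 2 by near: n.
  by move=> /(_ _ (oY n))[].
lra.
Unshelve. all: by end_near. Qed.

(** The mirror image of [J_superlevel_usc]; the strict inequality defining the sets
    is what makes them lower semicontinuous. *)
Lemma J_superlevel_lsc (V : X * R -> R) p (p_ : nat -> X * R) (a_ : nat -> R) e :
  usc_in (strip T) (fun q => - V q) -> strip T p -> (forall n, strip T (p_ n)) ->
  p_ n @[n --> \oo] --> p ->
  (forall m, V p < m -> \forall n \near \oo, a_ n < m) -> 0 < e ->
  \forall n \near \oo, J p.1 p.2 [set y | V p < V (y, p.2)] <=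
    J (p_ n).1 (p_ n).2 [set y | a_ n < V (y, (p_ n).2)] + e.
Proof.
move=> uV Sp Sp_ cp ha e0; have e20 : 0 < e / 2 by rewrite divr_gt0.
have oY n : open_or_closed [set y | a_ n < V (y, (p_ n).2)].
  by left; exact: (open_superlevel uV (Sp_ n)).
have oZ : open_or_closed [set y | V p < V (y, p.2)].
  by left; exact: (open_superlevel uV Sp).
have h1 : \forall n \near \oo, J p.1 p.2 [set y | V p < V (y, p.2)] <=
    J p.1 p.2 [set y | a_ n < V (y, (p_ n).2)] + e / 2.
  apply: (@J_limit _ _ _ _ _ _ _ _ _ _ _ D p.1 p.2
    (fun=> [set y | V p < V (y, p.2)])
    (fun n => [set y | a_ n < V (y, (p_ n).2)])) => //.
  move=> z; have [Vz|Vz] := leP (V (z, p.2)) (V p).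
    by apply: nearW => n /=; rewrite ltNge Vz.
  pose m := (V p + V (z, p.2)) / 2.
  have m1 : V p < m by rewrite /m; lra.
  have m2 : - V (z, p.2) < - m by rewrite /m; lra.
  have k1 := ha m m1.
  have k2 : \forall n \near \oo, strip T (z, (p_ n).2) -> - V (z, (p_ n).2) < - m.
    have h := uV (z, p.2) Sp _ m2.
    exact: (cvg_slice cp h).
  near=> n => /= _.
  have q1 : a_ n < m by near: n.
  have q2 : - V (z, (p_ n).2) < - m
    by (have : strip T (z, (p_ n).2) by exact: Sp_); near: n.
  lra.
have h2 := J_near_le Sp Sp_ cp e20.
near=> n; have k1 : J p.1 p.2 [set y | V p < V (y, p.2)] <=
    J p.1 p.2 [set y | a_ n < V (y, (p_ n).2)] + e / 2 by near: n.
have k2 : J p.1 p.2 [set y | a_ n < V (y, (p_ n).2)] <=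
   J (p_ n).1 (p_ n).2 [set y | a_ n < V (y, (p_ n).2)] + e / 2.
  have : forall Z, open_or_closed Z ->
    J (p_ n).1 (p_ n).2 Z <= J p.1 p.2 Z + e / 2 /\
    J p.1 p.2 Z <= J (p_ n).1 (p_ n).2 Z + e / 2 by near: n.
  by move=> /(_ _ (oY n))[].
lra.
Unshelve. all: by end_near. Qed.

End stability.

(** * Perron's method *)

Section perron.
Context {R : realType} {N : nat}.
Local Notation X := 'rV[R]_N.
Variables (T : R) (J : X -> R -> set X -> R) (c1 : X * R -> R) (u0 : X -> R).
Variables (m0 M1 L L1 A : R).
Hypothesis D : nonlocal_data T J c1 u0 m0 M1 L L1 A.
Local Notation C := (M1 + m0).
Local Notation sub := (nonlocal_sub T J c1 u0).
Local Notation super := (nonlocal_super T J c1 u0).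

Let T0 : 0 < T := T_gt0 D.
Let C0 : 0 <= C := C_ge0 D.

Lemma C1_with_continuous (phi dt : X * R -> R) (Dx : X * R -> X) :
  C1_with T phi dt Dx -> {within strip T, continuous phi}.
Proof. by case. Qed.

(** A C^1 function is touched by a test function only where the derivatives agree,
    so it is a subsolution as soon as it decreases in time fast enough for every
    admissible speed. *)
Lemma classical_sub (w dt : X * R -> R) (Dx : X * R -> X) :
  C1_with T w dt Dx -> (forall p, strip T p -> dt p <= - (C * enorm (Dx p))) ->
  (forall x, w (x, 0) <= u0 x) -> sub w.
Proof.
move=> Cw wC w0; have uw := usc_in_continuous (C1_with_continuous Cw).
split=> // phi dp Dp Cp p [Sp mp]; split=> [p0|p0]; last first.
  by have := w0 p.1; rewrite -p0 -surjective_pairing.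
have [h1 h2] := C1_with_max (C1_withD Cw (C1_withN Cp)) Sp p0 mp.
have -> : Dp p = Dx p by move/eqP: h2; rewrite subr_eq0 => /eqP.
apply: (@le_trans _ _ (dt p)); first by move: h1; rewrite subr_ge0.
apply: le_trans (wC p Sp) _; rewrite -mulNr ler_wpM2r ?enorm_ge0//.
by have := speed_ge_bound D uw Sp; rewrite ler_norml => /andP[].
Qed.

(** These subsolutions show that Perron's supremum is not over the empty set, and
    that it attains the initial datum from below. *)
Lemma lower_barrier (x0 : X) e : 0 < e ->
  exists w, [/\ sub w, {within strip T, continuous w} & w (x0, 0) = u0 x0 - e].
Proof.
move=> e0; have [k k0 hk] := log_dist_modulus (u0_bound D) (u0_uc D) e0.
pose w p := (u0 x0 - e) + ((- k) * log_dist x0 p + (- (k * C)) * p.2).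
have Cw : C1_global w (fun=> - (k * C)) (fun p => (- k) *: log_dist_grad x0 p).
  apply: eq_C1_global (C1_globalD (C1_global_cst (u0 x0 - e)) (C1_globalD
    (C1_globalM (C1_global_cst (- k)) (C1_global_log_dist x0))
    (C1_globalM (C1_global_cst (- (k * C))) C1_global_time))) _ _ _ => p //.
    by rewrite mulr1 !mulr0 !addr0 !add0r.
  by rewrite !scaler0 !addr0 add0r.
exists w; split.
- apply: (classical_sub (C1_with_global T Cw)) => [p _|x].
    rewrite lerN2 enormZ normrN gtr0_norm// mulrCA ler_wpM2l ?(ltW k0)//.
    by rewrite ler_piMr ?log_dist_grad_le1.
  rewrite /w /= mulr0 addr0.
  have := hk x0 x 0; rewrite /log_dist /= enorm_distC; lra.
- by apply: continuous_subspaceT; case: Cw.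
- by rewrite /w log_dist_center /= !mulr0 !addr0.
Qed.

Definition perron_sup (p : X * R) : R := sup [set w p | w in sub].

Local Notation u := perron_sup.
Local Notation U := (usc_envelope T u).
Local Notation V := (lsc_envelope T u).

Lemma sub_le_A w p : sub w -> strip T p -> w p <= A.
Proof.
move=> sw; apply: (speed_subsolution_bounded T0 C0 (nonlocal_sub_speed D sw)).
by move=> x; apply: le_trans (ler_norm _) (u0_bound D x).
Qed.

Lemma sub_nonempty : exists w, sub w /\ {within strip T, continuous w}.
Proof.
have [w [sw cw _]] := @lower_barrier 0 1 ltr01; by exists w.
Qed.

Lemma le_perron w p : sub w -> strip T p -> w p <= u p.
Proof.
move=> sw Sp; apply: ub_le_sup; last by exists w.
by exists A => _ [w' sw' <-]; exact: sub_le_A.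
Qed.

Lemma perron_le p B : strip T p -> (forall w, sub w -> w p <= B) -> u p <= B.
Proof.
move=> Sp h; apply: sup_le_ub; last by move=> _ [w sw <-]; exact: h.
by have [w [sw _]] := sub_nonempty; exists (w p), w.
Qed.

Lemma perron_approx p a : strip T p -> a < u p -> exists2 w, sub w & a < w p.
Proof.
move=> Sp ap; apply: contrapT => no.
have : u p <= a.
  apply: perron_le => // w sw; rewrite leNgt; apply/negP => aw.
  by apply: no; exists w.
by rewrite leNgt ap.
Qed.

Lemma perron_locally_bounded : locally_bounded T u.
Proof.
move=> p Sp; have [w [sw /subspace_continuousP cw]] := sub_nonempty.
have wp : w p - 1 < w p by lra.
have h : \forall q \near within (strip T) (nbhs p), w p - 1 < w q.
  by have := cw p Sp; move/cvgr_gt => /(_ _ wp).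
rewrite /bounded_near.
have hM : \forall M \near +oo, `|A| + `|w p - 1| <= M.
  by apply: nbhs_pinfty_ge; exact: num_real.
apply: filterS hM => M hM; move: h; rewrite !near_withinE.
apply: filterS => q hq Sq /=; have := hq Sq.
have q1 := le_perron sw Sq.
have q2 : u q <= A by apply: perron_le => // w' sw'; exact: sub_le_A.
move=> q3; have n1 := ler_norm A; have n2 := ler_norm (- (w p - 1)).
rewrite normrN in n2; have n3 := normr_ge0 A; have n4 := normr_ge0 (w p - 1).
rewrite ler_norml; apply/andP; split; lra.
Qed.

Let bu := perron_locally_bounded.

Lemma le_U w p : sub w -> strip T p -> w p <= U p.
Proof. by move=> sw Sp; apply: le_trans (le_perron sw Sp) (le_usc_envelope bu Sp). Qed.

(** The modulus at time [0] of [speed_subsolution_initial] is common to all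
    subsolutions, hence passes to their supremum and its envelope. *)
Lemma U_initial x : U (x, 0) <= u0 x.
Proof.
have Sx : strip T (x, 0) by exact: strip0.
(* One [e] for the modulus of [u0], one for the slope in time, one for the barrier. *)
apply: (@le_eps _ _ _ 3) => e e0.
have [K K0 hK] := speed_subsolution_initial T0 C0 (u0_bound D) (u0_uc D) e0.
rewrite leNgt; apply/negP => h.
have [d /= d0 hd] := (unif_continuousP u0).1 (u0_uc D) _ e0.
have K1 : 0 < K + 1 by lra.
have dK : 0 < Num.min d (e / (K + 1)) by rewrite lt_min d0 divr_gt0.
have [q [Sq [q1 q2] uq]] := usc_envelope_approx bu Sx h (nbhsx_ballx (x, 0) _ dK).
move: uq; apply/negP; rewrite -leNgt; apply: perron_le => // w sw.
apply: le_trans (hK w (nonlocal_sub_speed D sw) q Sq) _.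
have : ball x d q.1 by apply: le_ball q1; rewrite ge_min lexx.
move=> /(hd (x, q.1)); rewrite -ball_normE/= ltr_norml => /andP[h1 _].
have q20 : 0 <= q.2 by case/andP: Sq.
move: q2; rewrite /ball/= sub0r normrN ger0_norm// lt_min => /andP[_].
rewrite ltr_pdivlMr// => h2; nra.
Qed.

(** The passage to the limit in a viscosity inequality: [c_] is bounded above in the
    limit by [c], without having to converge. *)
Lemma limit_inequality (a c d : R) (a_ c_ d_ : nat -> R) :
  a_ n @[n --> \oo] --> a -> d_ n @[n --> \oo] --> d -> (forall n, 0 <= d_ n) ->
  (forall e, 0 < e -> \forall n \near \oo, c_ n <= c + e) ->
  (\forall n \near \oo, a_ n <= c_ n * d_ n) -> a <= c * d.
Proof.
move=> ca cd d0 hc h; apply: (@le_eps _ _ _ d) => e e0; rewrite -mulrDl.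
apply: (@ler_cvg_to _ _ _ _ a_ (fun n => (c + e) * d_ n)) ca _ _.
  by apply: cvgM => //; exact: cvg_cst.
have h1 := hc e e0; near=> n.
have k1 : c_ n <= c + e by near: n.
apply: (@le_trans _ _ (c_ n * d_ n)); first by near: n.
by rewrite ler_wpM2r.
Unshelve. all: by end_near. Qed.

(** Let [phi] touch [U] from above at [p].  Adding [sqdist p] makes the maximum
    strict, so subsolutions [w_n] with values approaching [U p] near [p] have
    maxima [q_n -> p] against this test function.  Their speeds are computed on
    superlevel sets of [w_n], contained in those of [U] at level [w_n (q_n)], and
    [J_superlevel_usc] bounds them in the limit. *)
Lemma usc_envelope_perron_sub : sub U.
Proof.
have uU : usc_in (strip T) U := usc_envelope_usc bu.
split=> // phi dt Dx Cphi p [Sp mp]; split; last first.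
  by case: p Sp mp => x t Sp mp /= t0; rewrite t0; exact: U_initial.
move=> p0.
have cphi := C1_with_continuous Cphi.
pose e_ (n : nat) : R := n.+1%:R^-1.
have e_0 n : 0 < e_ n by rewrite invr_gt0.
have e_1 n : e_ n <= 1 by rewrite invf_le1// ler1n.
have ex n : exists w, sub w /\ exists q, [/\ strip T q, sqdist p q <= 3 * e_ n,
    U p - 3 * e_ n + (phi q - phi p) <= w q &
    max_point T (w \- (fun q => phi q + sqdist p q)) q].
  have B1 : \forall q \near p, sqdist p q < e_ n.
    have := @continuous_sqdist _ _ p p; rewrite /continuous_at sqdist0.
    by move/cvgr_lt; apply.
  have B2 : \forall q \near p, strip T q -> phi q < phi p + e_ n.
    by apply: (usc_in_continuous cphi) => //; rewrite ltrDl.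
  have pU : U p - e_ n < U p by rewrite ltrBlDr ltrDl.
  have [q [Sq [q1 /(_ Sq) q2] uq]] := usc_envelope_approx bu Sp pU (filterI B1 B2).
  have [w sw wq] := perron_approx Sq uq.
  exists w; split => //.
  have wU q' : strip T q' -> w q' - (phi q' + sqdist p q') <= U p - phi p - sqdist p q'.
    by move=> Sq'; have := mp q' Sq'; have := le_U sw Sq'; rewrite /=; lra.
  have wq3 : U p - phi p - 3 * e_ n <= w q - (phi q + sqdist p q) by lra.
  pose K := [set q : X * R | enorm (q.1 - p.1) <= 2 /\ 0 <= q.2 <= T].
  have KS : K `<=` strip T by move=> r [].
  have Kq : K q.
    split=> //; rewrite leNgt; apply/negP => h2.
    have : 2 ^+ 2 <= enorm (q.1 - p.1) ^+ 2 by rewrite lerXn2r ?nnegrE ?enorm_ge0 ?ltW.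
    have := sqr_ge0 (q.2 - p.2); have := e_1 n; move: q1; rewrite /sqdist; lra.
  have [||r Sr mr] := @usc_in_coercive_max _ _ (strip T) K
      (w \- (fun q => phi q + sqdist p q)) q (@compact_strip_ball _ _ T p.1 _) KS Kq.
  - apply: usc_inB_continuous; first exact: sw.1.
    have := C1_withD Cphi (C1_with_global T (C1_global_sqdist2 p)).
    exact: C1_with_continuous.
  - move=> r Sr nKr; apply: le_trans (wU r Sr) _; apply: le_trans wq3.
    have r2 : 2 < enorm (r.1 - p.1).
      by rewrite ltNge; apply/negP => h; apply: nKr; split.
    have : 2 ^+ 2 <= enorm (r.1 - p.1) ^+ 2 by rewrite lerXn2r ?nnegrE ?enorm_ge0 ?ltW.
    by have := sqr_ge0 (r.2 - p.2); have := e_1 n; rewrite /sqdist; lra.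
  have := mr q Sq; have := wU r Sr; rewrite /= => h1 h2.
  exists r; split => //; first by lra.
  have := sqdist_ge0 p r; lra.
have {ex} [w_ ex] := choice ex.
have {ex} [sw_ ex] : (forall n, sub (w_ n)) /\ forall n, exists q, [/\ strip T q,
   sqdist p q <= 3 * e_ n, U p - 3 * e_ n + (phi q - phi p) <= w_ n q &
   max_point T (w_ n \- (fun q => phi q + sqdist p q)) q].
  by split=> n; case: (ex n).
have {ex} [q_ hq] := choice ex.
have Sq_ n : strip T (q_ n) by case: (hq n).
have cq : q_ n @[n --> \oo] --> p.
  apply: cvg_sqdist; apply: (@cvg_harmonic_le _ _ 3) => n.
  by rewrite sqdist_ge0; case: (hq n).
have ce : e_ n @[n --> \oo] --> 0 by exact: cvg_harmonic.
pose a_ n := w_ n (q_ n).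
have ha m : m < U p -> \forall n \near \oo, m < a_ n.
  move=> mU.
  have : U p - 3 * e_ n + (phi (q_ n) - phi p) @[n --> \oo] --> U p - 3 * 0 + (phi p - phi p).
    apply: cvgD; [apply: cvgB|apply: cvgB]; try exact: cvg_cst.
      by apply: cvgM => //; exact: cvg_cst.
    exact: (cvg_in_strip cphi).
  rewrite mulr0 subr0 subrr addr0 => /cvgr_gt /(_ _ mU).
  by apply: filterS => n /lt_le_trans; apply; case: (hq n).
have Cs := C1_withD Cphi (C1_with_global T (C1_global_sqdist2 p)).
have [_ _ _ cdt cDx] := Cs.
apply: (@limit_inequality _ _ _ (fun n => dt (q_ n) + 2 * ((q_ n).2 - p.2))
  (fun n => speed_ge J c1 (w_ n) (q_ n))
  (fun n => enorm (Dx (q_ n) + 2 *: ((q_ n).1 - p.1)))).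
- have := cvg_in_strip cdt Sp Sq_ cq.
  by rewrite subrr mulr0 addr0.
- have := cvg_in_strip cDx Sp Sq_ cq.
  by rewrite subrr scaler0 addr0 => /cvg_enorm.
- by move=> n; exact: enorm_ge0.
- move=> e e0; have e20 : 0 < e / 2 by rewrite divr_gt0.
  have h1 := J_superlevel_usc D uU Sp Sq_ cq ha e20.
  have h2 : \forall n \near \oo, c1 (q_ n) < c1 p + e / 2.
    have := cvg_in_strip (c1_cont D) Sp Sq_ cq.
    by move/cvgr_lt; apply; rewrite ltrDl.
  near=> n; rewrite /speed_ge.
  have k1 : J (q_ n).1 (q_ n).2 [set y | a_ n <= U (y, (q_ n).2)] <=
    J p.1 p.2 [set y | U p <= U (y, p.2)] + e / 2 by near: n.
  have k2 : c1 (q_ n) < c1 p + e / 2 by near: n.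
  have k3 : J (q_ n).1 (q_ n).2 [set y | w_ n (q_ n) <= w_ n (y, (q_ n).2)] <=
     J (q_ n).1 (q_ n).2 [set y | a_ n <= U (y, (q_ n).2)].
    apply: (J_mono D) => //; first exact: Sq_.
    + by right; exact: (closed_superlevel (sw_ n).1 (Sq_ n)).
    + by right; exact: (closed_superlevel uU (Sq_ n)).
    + by move=> y /= h; apply: le_trans h _; apply: le_U => //; exact: Sq_.
  lra.
- have h1 : \forall n \near \oo, 0 < (q_ n).2.
    have : (q_ n).2 @[n --> \oo] --> p.2 by exact: (continuous_cvg _ (@cvg_snd _ _ _ _ _) cq).
    by move/cvgr_gt; apply.
  apply: filterS h1 => n q0.
  have [_ _ _ mq] := hq n.
  by have [h _] := (sw_ n).2 _ _ _ Cs _ mq; exact: h.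
Unshelve. all: by end_near. Qed.

Lemma V_le_U p : strip T p -> V p <= U p.
Proof.
by move=> Sp; apply: le_trans (lsc_envelope_le bu Sp) (le_usc_envelope bu Sp).
Qed.

(** If [V] violates the supersolution property at [p], then
    [psi = phi - phi p + V p + ka - sqdist p] is a classical subsolution near [p].
    It exceeds [V] only where [sqdist p < ka], so [max U psi] is a subsolution; it
    is therefore below the supremum [u], and [psi <= V] by continuity of [psi],
    although [psi p = V p + ka]. *)
Lemma perron_bump (phi dt : X * R -> R) (Dx : X * R -> X) p ka :
  C1_with T phi dt Dx -> min_point T (V \- phi) p -> 0 < ka -> ka < p.2 ^+ 2 ->
  (forall q, strip T q -> sqdist p q < ka ->
    dt q - 2 * (q.2 - p.2) <=
    (c1 q + J q.1 q.2 [set y | phi q - phi p + V p + ka - sqdist p q < V (y, q.2)]) *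
    enorm (Dx q - 2 *: (q.1 - p.1))) -> False.
Proof.
move=> Cphi [Sp mp] ka0 kap strict.
have sU := usc_envelope_perron_sub; have uU := sU.1.
have uV := lsc_envelope_lsc bu.
pose psi q := phi q + (V p - phi p + ka) - sqdist p q.
have Cpsi : C1_with T psi (fun q => dt q - 2 * (q.2 - p.2))
    (fun q => Dx q - 2 *: (q.1 - p.1)).
  have h := C1_withD (C1_withD Cphi (C1_with_global T (C1_global_cst (V p - phi p + ka))))
     (C1_withN (C1_with_global T (C1_global_sqdist2 p))).
  rewrite (_ : (fun q => _) = (fun q => dt q + 0 - 2 * (q.2 - p.2))); last first.
    by apply/funext => q; rewrite addr0.
  rewrite (_ : (fun q => Dx q - _) = (fun q => Dx q + 0 - 2 *: (q.1 - p.1))) //.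
  by apply/funext => q; rewrite addr0.
have cpsi := C1_with_continuous Cpsi.
have psiE q : phi q - phi p + V p + ka - sqdist p q = psi q by rewrite /psi; ring.
have psiV q : strip T q -> psi q <= V q + ka - sqdist p q.
  by move=> Sq; have := mp q Sq; rewrite /psi /=; lra.
pose W q := Num.max (U q) (psi q).
have sW : sub W.
  have uW : usc_in (strip T) W by apply: usc_in_max => //; exact: usc_in_continuous.
  split=> // chi dc Dc Cchi q [Sq mq].
  (* Where [U] realizes the maximum it inherits the property from [U], whose
     superlevel sets are smaller than those of [W]. *)
  have [psiU|Upsi] := leP (psi q) (U q).
    have Wq : W q = U q by rewrite /W max_l.
    have [|h1 h2] := sU.2 _ _ _ Cchi q.
      split=> // r Sr; have := mq r Sr; rewrite /= Wq.
      have : U r <= W r by rewrite /W le_max lexx.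
      lra.
    split=> [q0|q0]; last by rewrite Wq; exact: h2.
    apply: le_trans (h1 q0) _; rewrite ler_wpM2r ?enorm_ge0// /speed_ge lerD2l.
    apply: (J_mono D) => //.
    - by right; exact: (closed_superlevel uU Sq).
    - by right; exact: (closed_superlevel uW Sq).
    - by move=> y /= h; rewrite Wq /W le_max h.
  have Wq : W q = psi q by rewrite /W max_r// ltW.
  have qka : sqdist p q < ka.
    rewrite ltNge; apply/negP => h.
    by have := psiV q Sq; have := V_le_U Sq; move: Upsi h; lra.
  split=> [q0|q0]; last first.
    exfalso; move: qka; apply/negP; rewrite -leNgt; apply/ltW/(lt_le_trans kap).
    by rewrite /sqdist q0 sub0r sqrrN lerDr sqr_ge0.
  have [|h1 h2] := C1_with_max (C1_withD Cpsi (C1_withN Cchi)) Sq q0.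
    move=> r Sr; have := mq r Sr; rewrite /= Wq.
    have : psi r <= W r by rewrite /W le_max lexx orbT.
    lra.
  have -> : Dc q = Dx q - 2 *: (q.1 - p.1).
    by apply/esym/eqP; rewrite -subr_eq0; apply/eqP.
  apply: (@le_trans _ _ (dt q - 2 * (q.2 - p.2))).
    by move: h1; rewrite subr_ge0.
  apply: le_trans (strict q Sq qka) _.
  rewrite ler_wpM2r ?enorm_ge0// /speed_ge lerD2l; apply: (J_mono D) => //.
  - by left; exact: (open_superlevel uV Sq).
  - by right; exact: (closed_superlevel uW Sq).
  - move=> y /=; rewrite psiE Wq => h; rewrite /W le_max; apply/orP; left.
    exact: le_trans (ltW h) (@V_le_U (y, q.2) Sq).
have psiu q : strip T q -> psi q <= u q.
  move=> Sq; apply: le_trans (le_perron sW Sq); by rewrite /W le_max lexx orbT.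
have := continuous_le_lsc_envelope bu cpsi psiu Sp.
rewrite /psi sqdist0; lra.
Qed.

(** At a positive time, a failure of the inequality at [p] would persist, by
    [J_superlevel_lsc], in a small enough neighbourhood, where [perron_bump]
    applies; at time [0] the lower barriers give the inequality. *)
Lemma lsc_envelope_perron_super : super V.
Proof.
have uV := lsc_envelope_lsc bu.
split=> // phi dt Dx Cphi p [Sp mp]; split; last first.
  move=> p0; apply/ler_addgt0Pr => e e0; rewrite -lerBlDr.
  have [w [sw cw we]] := lower_barrier p.1 e0.
  rewrite -we -p0 -surjective_pairing.
  by apply: continuous_le_lsc_envelope => // q Sq; exact: le_perron.
move=> p0; rewrite leNgt; apply/negP => strict.
have p20 : 0 < p.2 ^+ 2 by rewrite exprn_gt0.
(* Heights tending to 0, and below [p.2 ^+ 2] so that the region [sqdist p < ka]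
   stays away from time 0. *)
pose ka n : R := p.2 ^+ 2 / 2 * n.+1%:R^-1.
have ka0 n : 0 < ka n by rewrite mulr_gt0 ?invr_gt0// divr_gt0.
have kap n : ka n < p.2 ^+ 2.
  rewrite (@le_lt_trans _ _ (p.2 ^+ 2 / 2))//; last lra.
  by rewrite ler_piMr ?invf_le1 ?ler1n// divr_ge0// ltW.
have [[n hn]|no] := pselect (exists n, forall q, strip T q -> sqdist p q < ka n ->
    dt q - 2 * (q.2 - p.2) <=
    (c1 q + J q.1 q.2 [set y | phi q - phi p + V p + ka n - sqdist p q < V (y, q.2)]) *
    enorm (Dx q - 2 *: (q.1 - p.1))).
  exact: (perron_bump Cphi (conj Sp mp) (ka0 n) (kap n) hn).
have ex n : exists q, [/\ strip T q, sqdist p q < ka n &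
    (c1 q + J q.1 q.2 [set y | phi q - phi p + V p + ka n - sqdist p q < V (y, q.2)]) *
    enorm (Dx q - 2 *: (q.1 - p.1)) < dt q - 2 * (q.2 - p.2)].
  apply: contrapT => h; apply: no; exists n => q Sq qk; rewrite leNgt.
  by apply/negP => hq; apply: h; exists q.
have {ex} [q_ hq] := choice ex.
have Sq_ n : strip T (q_ n) by case: (hq n).
have cs : sqdist p (q_ n) @[n --> \oo] --> 0.
  apply: (@cvg_harmonic_le _ _ (p.2 ^+ 2 / 2)) => n.
  by rewrite sqdist_ge0 ltW//; case: (hq n).
have cq : q_ n @[n --> \oo] --> p by exact: cvg_sqdist.
have ck : ka n @[n --> \oo] --> 0.
  by apply: (@cvg_harmonic_le _ _ (p.2 ^+ 2 / 2)) => n; rewrite lexx ltW.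
have cphi := C1_with_continuous Cphi.
pose a_ n := phi (q_ n) - phi p + V p + ka n - sqdist p (q_ n).
have ha m : V p < m -> \forall n \near \oo, a_ n < m.
  move=> Vm.
  have : a_ n @[n --> \oo] --> phi p - phi p + V p + 0 - 0.
    apply: cvgB => //; apply: cvgD => //; apply: cvgD; last exact: cvg_cst.
    by apply: cvgB; [exact: (cvg_in_strip cphi)|exact: cvg_cst].
  by rewrite subrr add0r addr0 subr0 => /cvgr_lt; apply.
have Cs := C1_withD Cphi (C1_withN (C1_with_global T (C1_global_sqdist2 p))).
have [_ _ _ cdt cDx] := Cs.
move: strict; apply/negP; rewrite -leNgt -lerN2 -mulNr.
apply: (@limit_inequality _ _ _ (fun n => - (dt (q_ n) - 2 * ((q_ n).2 - p.2)))
  (fun n => - (c1 (q_ n) + J (q_ n).1 (q_ n).2 [set y | a_ n < V (y, (q_ n).2)]))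
  (fun n => enorm (Dx (q_ n) - 2 *: ((q_ n).1 - p.1)))).
- apply: cvgN; have := cvg_in_strip cdt Sp Sq_ cq.
  by rewrite subrr mulr0 subr0.
- have := cvg_in_strip cDx Sp Sq_ cq.
  by rewrite subrr scaler0 subr0 => /cvg_enorm.
- by move=> n; exact: enorm_ge0.
- move=> e e0; have e20 : 0 < e / 2 by rewrite divr_gt0.
  have h1 := J_superlevel_lsc D uV Sp Sq_ cq ha e20.
  have h2 : \forall n \near \oo, c1 p - e / 2 < c1 (q_ n).
    have := cvg_in_strip (c1_cont D) Sp Sq_ cq.
    by move/cvgr_gt; apply; rewrite ltrBlDr ltrDl.
  near=> n; rewrite /speed_gt.
  have k1 : J p.1 p.2 [set y | V p < V (y, p.2)] <=
    J (q_ n).1 (q_ n).2 [set y | a_ n < V (y, (q_ n).2)] + e / 2 by near: n.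
  have k2 : c1 p - e / 2 < c1 (q_ n) by near: n.
  lra.
- by apply: nearW => n; rewrite mulNr lerN2 ltW//; case: (hq n).
Unshelve. all: by end_near. Qed.

Lemma nonlocal_existence_uniqueness : exists u : X * R -> R,
  (locally_bounded T u /\ sub (usc_envelope T u) /\ super (lsc_envelope T u)) /\
  forall v, locally_bounded T v -> sub (usc_envelope T v) ->
    super (lsc_envelope T v) -> forall q, strip T q -> v q = u q.
Proof.
exists u; split.
  split; first exact: bu.
  by split; [exact: usc_envelope_perron_sub|exact: lsc_envelope_perron_super].
have cmp w w' : locally_bounded T w -> locally_bounded T w' ->
    sub (usc_envelope T w) -> super (lsc_envelope T w') ->
    forall q, strip T q -> w q <= w' q.
  move=> bw bw' sw sw' q Sq; apply: le_trans (le_usc_envelope bw Sq) _.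
  apply: le_trans (lsc_envelope_le bw' Sq).
  exact: (comparison D sw sw').
move=> v bv subv superv q Sq; apply/eqP; rewrite eq_le; apply/andP; split.
  exact: (cmp _ _ bv bu subv lsc_envelope_perron_super).
exact: (cmp _ _ bu bv usc_envelope_perron_sub superv).
Qed.

End perron.

(** * Reflections and Borel sets for the Lebesgue measure *)

Section reflection.
Context {R : realType}.

(** Both sides are measures in [A] that agree on intervals. *)
Lemma lebesgue_measure_refl (a : R) (A : set R) : measurable A ->
  lebesgue_measure ((fun r : R => a - r) @^-1` A) = lebesgue_measure A.
Proof.
move=> mA.
have mr : @measurable_fun _ _ (measurableTypeR R) (measurableTypeR R) setT
    (fun r => a - r).
  exact: (@measurable_funB _ _ R setT (fun=> a) id).
pose mf := @mfun_Sub _ _ (measurableTypeR R) (measurableTypeR R) _ (mem_set mr).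
have h : forall X, ocitv X ->
    lebesgue_measure X = pushforward (@lebesgue_measure R) mf X.
  move=> _ [[c d]] _ <-; rewrite /pushforward /=.
  rewrite (_ : _ @^-1` _ = `[a - d, a - c[%classic); last first.
    apply/seteqP; split => x /=; rewrite !in_itv/= => /andP[? ?]; apply/andP; split; lra.
  rewrite !lebesgue_measure_itv/= !lte_fin.
  rewrite (_ : (a - d < a - c) = (c < d)); last by rewrite ltrD2l ltrN2.
  by case: ifP => // _; rewrite -!EFinB; congr (_%:E); ring.
by rewrite (@lebesgue_measure_unique R (pushforward (@lebesgue_measure R) mf) h A mA).
Qed.

(** By induction on the dimension, reflecting the first coordinate and the sections
    separately. *)
Lemma lebesgue_rV_refl n (a : 'rV[R]_n) (A : set 'rV[R]_n) : measurable A ->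
  lebesgue_rV n ((fun z => a - z) @^-1` A) = lebesgue_rV n A.
Proof.
elim: n a A => [|n IH] a A mA.
  congr (lebesgue_rV 0 _); apply/seteqP; split => x /=;
    by rewrite (_ : a - x = x)//; apply/rowP => -[].
have mA' : measurable (@cons_rV R n @^-1` A).
  by rewrite -[X in measurable X]setTI; exact: measurable_cons_rV.
rewrite /= /cons_measure /pushforward /product_measure1 /=.
pose a' : 'rV[R]_n := \row_i a ord0 (lift ord0 i).
rewrite (_ : (fun x => _) = (fun r => lebesgue_rV n
    (xsection (@cons_rV R n @^-1` A) (a ord0 ord0 - r)))); last first.
  apply/funext => r /=; rewrite -(IH a' (xsection (@cons_rV R n @^-1` A) (a ord0 ord0 - r))); last first.
    exact: measurable_xsection.
  have E y : a - cons_rV (r, y) = cons_rV (a ord0 ord0 - r, a' - y).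
    apply/rowP => i; case: (unliftP ord0 i) => [j|] ->.
      by rewrite cons_rVS [LHS]mxE [X in _ + X]mxE cons_rVS !mxE.
    by rewrite cons_rV0 [LHS]mxE [X in _ + X]mxE cons_rV0.
  by congr (lebesgue_rV n _); apply/seteqP; split => y; rewrite /xsection /= !inE /= E.
set f := fun r => lebesgue_rV n (xsection (@cons_rV R n @^-1` A) r).
have mf : measurable_fun [set: measurableTypeR R] f by exact: measurable_fun_xsection.
have mr : @measurable_fun _ _ (measurableTypeR R) (measurableTypeR R) setT
    (fun r => a ord0 ord0 - r).
  exact: (@measurable_funB _ _ R setT (fun=> a ord0 ord0) id).
have := @ge0_integral_pushforward _ _ _ _ R _ mr (@lebesgue_measure R) setT f measurableT mf.
rewrite preimage_setT => <-//.
apply: eq_measure_integral => B mB _; exact: lebesgue_measure_refl.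
Qed.
End reflection.

Section borel.
Context {R : realType} {N : nat}.
Local Notation X := 'rV[R]_N.

Definition rat_box (ab : 'rV[rat]_N * 'rV[rat]_N) : set X :=
  [set x | forall i, ratr (ab.1 ord0 i) < x ord0 i < ratr (ab.2 ord0 i)].

(** Boxes with rational corners form a countable base, which makes open sets Borel. *)
Lemma open_rat_boxes (A : set X) : open A -> forall x, A x ->
  exists ab, rat_box ab x /\ rat_box ab `<=` A.
Proof.
rewrite openE => oA x Ax; have := oA x Ax; rewrite /interior/=.
move=> /nbhs_ballP[e /= e0 eA].
have ha i : exists q : rat, x ord0 i - e < ratr q < x ord0 i.
  have [|q] := @rat_in_itvoo R (x ord0 i - e) (x ord0 i); first by rewrite ltrBlDr ltrDl.
  by rewrite in_itv/=; exists q.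
have hb i : exists q : rat, x ord0 i < ratr q < x ord0 i + e.
  have [|q] := @rat_in_itvoo R (x ord0 i) (x ord0 i + e); first by rewrite ltrDl.
  by rewrite in_itv/=; exists q.
have [a ah] := choice ha; have [b bh] := choice hb.
exists (\row_i a i, \row_i b i); split => [i|y hy].
  by rewrite /= !mxE; case/andP: (ah i) => _ ->; case/andP: (bh i).
apply: eA; split => // i j; rewrite ord1 /ball/=.
have := hy j; rewrite !mxE => /andP[h1 h2].
have /andP[h3 h4] := ah j; have /andP[h5 h6] := bh j.
rewrite ltr_norml; apply/andP; split; lra.
Qed.

Lemma measurable_rat_box ab : measurable (rat_box ab).
Proof.
rewrite [X in measurable X](_ : _ = \bigcap_(i in [set: 'I_N])
   ((fun x : X => x ord0 i) @^-1` `]ratr (ab.1 ord0 i), ratr (ab.2 ord0 i)[)).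
  apply: fin_bigcap_measurable => // i _.
  rewrite -[X in measurable X]setTI; exact: measurable_rV_coord.
apply/seteqP; split => x /= h i; [move=> _|]; rewrite ?in_itv/=.
  exact: h.
by have := h i I; rewrite /= in_itv.
Qed.

(** The boxes contained in [A], enumerated through the countability of their
    corners, with the empty set at the indices of the other boxes. *)
Definition box_seq (A : set X) (k : nat) : set X :=
  if @unpickle ('rV[rat]_N * 'rV[rat]_N)%type k is Some ab then
    if pselect (rat_box ab `<=` A) then rat_box ab else set0
  else set0.

Lemma open_box_seq (A : set X) : open A -> A = \bigcup_k box_seq A k.
Proof.
move=> oA; apply/seteqP; split => x.
  move=> /(open_rat_boxes oA)[ab [abx abA]]; exists (pickle ab) => //.
  by rewrite /box_seq pickleK; case: pselect.
move=> [k _]; rewrite /box_seq; case: unpickle => [ab|//].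
by case: pselect => // h; exact: h.
Qed.

Lemma open_measurable_rV (A : set X) : open A -> measurable A.
Proof.
move=> oA; rewrite (open_box_seq oA); apply: bigcup_measurable => k _.
rewrite /box_seq; case: unpickle => [ab|]; last exact: measurable0.
by case: pselect => h /=; [exact: measurable_rat_box|exact: measurable0].
Qed.

Lemma closed_measurable_rV (A : set X) : closed A -> measurable A.
Proof.
move=> cA; rewrite -[A]setCK; apply: measurableC; apply: open_measurable_rV.
exact: closed_openC.
Qed.

Lemma measurable_refl_rV (a : X) : measurable_fun [set: X] (fun z : X => a - z).
Proof.
apply: measurable_fun_rV => i; under eq_fun do rewrite !mxE.
by apply: measurable_funB => //; exact: measurable_rV_coord.
Qed.

(** Together with [integral_refl], the change of variables [z |-> a - z]; it turns
    a convolution into an integral of a fixed density over a moving set. *)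
Lemma integrable_refl (a : X) (f : X -> \bar R) :
  (lebesgue_rV N).-integrable setT f ->
  (lebesgue_rV N).-integrable setT (fun z => f (a - z)).
Proof.
move=> fi; have mr := measurable_refl_rV a.
have mf := measurable_int _ fi.
apply/integrableP; split; first exact: measurableT_comp.
have /integrableP[_] := fi; congr (_ < _)%E.
have := @ge0_integral_pushforward _ _ _ _ R _ mr (lebesgue_rV N) setT
    (fun z => `|f z|%E) measurableT.
rewrite preimage_setT => <-//; last exact: measurableT_comp.
by apply: eq_measure_integral => B mB _; exact/esym/lebesgue_rV_refl.
Qed.

Lemma integral_refl (a : X) (f : X -> \bar R) :
  (lebesgue_rV N).-integrable setT f ->
  (\int[lebesgue_rV N]_z f (a - z)%R = \int[lebesgue_rV N]_z f z)%E.
Proof.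
move=> fi; have mr := measurable_refl_rV a.
have mf := measurable_int _ fi.
have fi' : (lebesgue_rV N).-integrable setT (f \o (fun z => a - z)).
  exact: integrable_refl.
have := @integral_pushforward _ _ _ _ R _ mr (lebesgue_rV N) setT f mf.
rewrite preimage_setT => <-//.
by apply: eq_measure_integral => B mB _; exact: lebesgue_rV_refl.
Qed.

End borel.

(** * Smooth bump functions *)

Section flat_functions.
Context {R : realType}.
Implicit Types (p : {poly R}) (y z w : R).

Lemma exprn_le_expR w n : 0 <= w -> w ^+ n <= n`!%:R * expR w.
Proof.
move=> w0; case: n => [|n].
  by rewrite expr0 fact0 mul1r -expR0 ler_expR.
have := expR_ge1Dxn n w0; rewrite -lerBrDl => h.
have f0 : 0 < (n.+1)`!%:R :> R by rewrite ltr0n fact_gt0.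
rewrite -ler_pdivrMl// mulrC (le_trans h)// lerBlDr lerDl//.
Qed.

Lemma horner_le_expR p : exists2 c, 0 <= c & forall w, 0 <= w -> `|p.[w]| <= c * expR w.
Proof.
exists (\sum_(i < size p) `|p`_i| * i`!%:R) => [|w w0].
  by apply: sumr_ge0 => i _; rewrite mulr_ge0.
rewrite horner_coef (le_trans (ler_norm_sum _ _ _))// mulr_suml.
apply: ler_sum => i _; rewrite normrM -mulrA ler_wpM2l// normrX ger0_norm//.
exact: exprn_le_expR.
Qed.

(** The functions [p(1/y) e^{-1/y}] for [y > 0], extended by [0].  As [p] varies
    over polynomials they form a class stable under differentiation. *)
Definition flat p y : R := if 0 < y then p.[y^-1] * expR (- y^-1) else 0.

(** The exponential beats [1/y^2] times the polynomial; the quadratic bound at [0]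
    gives the derivative there. *)
Lemma flat_bound p : exists2 c, 0 <= c & forall z, `|flat p z| <= c * z ^+ 2.
Proof.
have [c c0 hc] := horner_le_expR ('X^2 * p).
exists c => // z; rewrite /flat; case: ifP => [z0|_]; last first.
  by rewrite normr0 mulr_ge0// sqr_ge0.
have w0 : 0 <= z^-1 by rewrite invr_ge0 ltW.
have := hc _ w0; rewrite hornerM hornerXn normrM ger0_norm ?sqr_ge0// => h.
rewrite normrM (ger0_norm (expR_ge0 _)) expRN ler_pdivrMr ?expR_gt0//.
rewrite -(ler_pM2l (_ : 0 < z^-1 ^+ 2)) ?exprn_gt0 ?invr_gt0//.
apply: le_trans h _; rewrite mulrA mulrA (mulrAC _ c) -exprMn mulVf ?gt_eqF//.
by rewrite expr1n mul1r.
Qed.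

Lemma is_derive_flat p y :
  is_derive y (1 : R) (flat p) (flat ('X^2 * (p - p^`())) y).
Proof.
have [y0|y0|y0] := ltgtP y 0.
- rewrite /flat ltNge (ltW y0)/=.
  apply: near_eq_is_derive (is_derive_cst 0 y 1).
  have : \forall s \near y, s < 0 by exact: lt_nbhsl.
  by apply: filterS => s s0; rewrite ltNge (ltW s0).
- have D : is_derive y (1 : R) (fun s => p.[s^-1] * expR (- s^-1))
     (flat ('X^2 * (p - p^`())) y).
    have Di : is_derive y (1 : R) (fun s : R => s^-1) (- y ^- 2 *: 1).
      by apply: (@is_deriveV R id y); rewrite gt_eqF.
    have D1 := is_derive_compR (is_derive_poly p y^-1) Di.
    have DN : is_derive y (1 : R) (fun s : R => - s^-1) (- (- y ^- 2 *: 1)).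
      exact: (is_deriveN Di).
    have D2 := is_derive_compR (f := fun s : R => - s^-1) (is_derive_expR (- y^-1)) DN.
    have := is_deriveM D1 D2 => D3.
    apply: is_derive_eq D3 _.
    rewrite /flat y0 hornerM hornerXn hornerD hornerN /GRing.scale /=.
    field.
    by rewrite gt_eqF.
  apply: near_eq_is_derive D.
  have : \forall s \near y, 0 < s by exact: lt_nbhsr.
  by apply: filterS => s s0; rewrite /flat s0.
- rewrite y0; have [c c0 hc] := flat_bound p.
  rewrite [X in is_derive _ _ _ X](_ : _ = 0); last by rewrite /flat ltxx.
  apply: (is_derive_quadratic_bound c0) => z.
  by rewrite {2}/flat ltxx !subr0 mul0r subr0.
Qed.

Lemma flat1_bounds y : 0 <= flat 1 y <= 1.
Proof.
rewrite /flat; case: ifP => [y0|_]; last by rewrite lexx ler01.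
by rewrite hornerC mul1r expR_ge0 -expR0 ler_expR oppr_le0 invr_ge0 ltW.
Qed.

Lemma flat_le0 p y : y <= 0 -> flat p y = 0.
Proof. by move=> y0; rewrite /flat ltNge y0. Qed.

Lemma cvg_flat1 y : 0 < y -> flat 1 (n.+1%:R * y) @[n --> \oo] --> (1 : R).
Proof.
move=> y0; rewrite -[X in _ --> X]expR0.
rewrite (_ : (fun n => _) = (fun n => expR (- (n.+1%:R^-1 * y^-1)))); last first.
  by apply/funext => n; rewrite /flat mulr_gt0// hornerC mul1r invfM.
apply: (continuous_cvg _ (@continuous_expR R 0)).
rewrite -oppr0; apply: cvgN; rewrite -[X in _ --> X](mul0r y^-1).
by apply: cvgM; [exact: cvg_harmonic|exact: cvg_cst].
Qed.

End flat_functions.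

Section smooth_class.
Context {R : realType} {N : nat}.
Local Notation X := 'rV[R]_N.

(** An algebra of explicit smooth functions, closed under partial derivatives by
    construction, so that no iterated derivative has to be computed. *)
Inductive smooth : (X -> R) -> Prop :=
| smooth_cst c : smooth (fun=> c)
| smooth_flat p (s a : R) (i : 'I_N) : smooth (fun x => flat p (s * x ord0 i + a))
| smoothD f g : smooth f -> smooth g -> smooth (fun x => f x + g x)
| smoothM f g : smooth f -> smooth g -> smooth (fun x => f x * g x).

Lemma smooth_partial f : smooth f -> continuous f /\
  forall i, exists2 g, smooth g & forall x, is_derive x (unit_vec i) f (g x).
Proof.
elim => {f} [c|p s a i|f g _ [cf df] _ [cg dg]|f g sf [cf df] sg [cg dg]].
- split; first exact: cst_continuous.
  by move=> i; exists (fun=> 0); [exact: smooth_cst|move=> x; exact: is_derive_cst].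
- have D x j : is_derive x (unit_vec j) (fun x : X => s * x ord0 i + a)
      (s * (unit_vec j : X) ord0 i).
    apply/is_derive_line0 => /=.
    rewrite (_ : (fun r => _) = (fun=> s * x ord0 i + a) +
      (s * (unit_vec j : X) ord0 i) \*: (@id R)); last first.
      apply/funext => r.
      have E : (x + r *: unit_vec j : X) ord0 i = x ord0 i + r * (unit_vec j : X) ord0 i.
        by rewrite !mxE.
      rewrite E -[RHS]/(s * x ord0 i + a + (s * (unit_vec j : X) ord0 i) * r); ring.
    apply: is_derive_eq; by rewrite add0r [_ *: 1]mulr1.
  split.
    move=> x; have hx : {for x, continuous (fun z : X => z ord0 i)}.
      exact: coord_continuous.
    have h : {for x, continuous (fun z : X => s * z ord0 i + a)}.
      apply: (@continuousD _ _ _ (fun z : X => s * z ord0 i) (fun=> a)).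
        apply: (@continuousM _ _ (fun=> s) (fun z : X => z ord0 i)) => //.
        exact: cst_continuous.
      exact: cst_continuous.
    apply: (continuous_cvg _ _ h).
    by have [/derivable1_diffP/differentiable_continuous] := is_derive_flat p (s * x ord0 i + a).
  move=> j; exists (fun x => flat ('X^2 * (p - p^`())) (s * x ord0 i + a) *
      (s * (unit_vec j : X) ord0 i)).
    by apply: smoothM; [exact: smooth_flat|exact: smooth_cst].
  by move=> x; exact: (is_derive_compR (is_derive_flat p _) (D x j)).
- split; first by move=> x; exact: cvgD (cf x) (cg x).
  move=> i; have [f' sf' hf'] := df i; have [g' sg' hg'] := dg i.
  exists (fun x => f' x + g' x); first exact: smoothD.
  by move=> x; exact: (is_deriveD (hf' x) (hg' x)).
- split; first by move=> x; exact: cvgM (cf x) (cg x).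
  move=> i; have [f' sf' hf'] := df i; have [g' sg' hg'] := dg i.
  exists (fun x => f x * g' x + g x * f' x).
    by apply: smoothD; apply: smoothM.
  by move=> x; exact: (is_deriveM (hf' x) (hg' x)).
Qed.

Lemma smooth_iter_partial f s : smooth f -> smooth (iter_partial s f).
Proof.
move=> sf; elim: s => //= i s IH; have [_ /(_ i)[g sg hg]] := smooth_partial IH.
by rewrite (_ : (fun x => _) = g)//; apply/funext => x; exact: derive_val.
Qed.

Lemma smooth_test_function f : smooth f ->
  (exists2 K, compact K & forall x, ~ K x -> f x = 0) -> test_function f.
Proof.
move=> sf hK; split=> // s; have [c d] := smooth_partial (smooth_iter_partial s sf).
by split=> // i x; have [g _ hg] := d i; exact: ex_derive.
Qed.

Lemma smooth_translate f (v : X) : smooth f -> smooth (fun x => f (x + v)).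
Proof.
elim => {f} [c|p s a i|f g _ IHf _ IHg|f g _ IHf _ IHg].
- exact: smooth_cst.
- rewrite (_ : (fun x => _) = (fun x : X => flat p (s * x ord0 i + (s * v ord0 i + a)))).
    exact: smooth_flat.
  by apply/funext => x; rewrite mxE mulrDr addrA.
- exact: smoothD.
- exact: smoothM.
Qed.

Lemma smooth_prod (I : Type) (r : seq I) (f : I -> X -> R) :
  (forall i, smooth (f i)) -> smooth (fun x => \prod_(i <- r) f i x).
Proof.
move=> sf; elim: r => [|i r IH].
  by under eq_fun do rewrite big_nil; exact: smooth_cst.
by under eq_fun do rewrite big_cons; exact: smoothM.
Qed.

Lemma smoothC f : smooth f -> smooth (fun x => 1 - f x).
Proof.
move=> sf; have := smoothD (smooth_cst 1) (smoothM (smooth_cst (-1)) sf).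
by congr smooth; apply/funext => x; rewrite mulN1r.
Qed.

Record bump_function (f : X -> R) : Prop := {
  bump_smooth : smooth f;
  bump_support : exists2 K, compact K & forall x, ~ K x -> f x = 0;
  bump_range : forall x, 0 <= f x <= 1 }.

(** The indicator function of [A] is the pointwise limit of bumps supported in [A]. *)
Definition bump_approximable (A : set X) := exists phi : nat -> X -> R,
  [/\ forall n, bump_function (phi n), forall n x, ~ A x -> phi n x = 0 &
      forall x, A x -> phi n x @[n --> \oo] --> (1 : R)].

Lemma bump_approximable0 : bump_approximable set0.
Proof.
exists (fun _ _ => 0); split => // n; split.
- exact: smooth_cst.
- by exists set0 => //; exact: compact0.
- by move=> x; rewrite lexx ler01.
Qed.

Lemma prod01 (I : Type) (r : seq I) (f : I -> R) :
  (forall i, 0 <= f i <= 1) -> 0 <= \prod_(i <- r) f i <= 1.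
Proof.
move=> h; elim: r => [|i r /andP[IH0 IH1]]; first by rewrite big_nil ler01 lexx.
by rewrite big_cons; have /andP[h0 h1] := h i; rewrite mulr_ge0//= mulr_ile1.
Qed.

(** A product of functions of one coordinate, [e^{-1/(n (x_i - a_i))}] and its mirror
    image, tends to [1] inside the box. *)
Lemma bump_approximable_box (ab : 'rV[rat]_N * 'rV[rat]_N) :
  bump_approximable (rat_box ab).
Proof.
pose a i : R := ratr (ab.1 ord0 i). pose b i : R := ratr (ab.2 ord0 i).
pose g n i (x : X) := flat 1 (n.+1%:R * (x ord0 i - a i)) *
   flat 1 (n.+1%:R * (b i - x ord0 i)).
have g01 n i x : 0 <= g n i x <= 1.
  have /andP[h1 h2] := flat1_bounds (n.+1%:R * (x ord0 i - a i)).
  have /andP[h3 h4] := flat1_bounds (n.+1%:R * (b i - x ord0 i)).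
  by rewrite /g mulr_ge0//= mulr_ile1.
have g0 n i (x : X) : ~ (a i < x ord0 i < b i) -> g n i x = 0.
  move=> h; rewrite /g; have [h1|h1] := leP (x ord0 i) (a i).
    by rewrite flat_le0 ?mul0r// pmulr_rle0// subr_le0.
  have [h2|h2] := leP (b i) (x ord0 i); last by case: h; rewrite h1.
  by rewrite [X in _ * X]flat_le0 ?mulr0// pmulr_rle0// subr_le0.
have gs n i : smooth (g n i).
  have -> : g n i = (fun x => flat 1 (n.+1%:R * x ord0 i + - (n.+1%:R * a i)) *
      flat 1 ((- n.+1%:R) * x ord0 i + n.+1%:R * b i)).
    by apply/funext => x; rewrite /g; congr (flat _ _ * flat _ _); ring.
  by apply: smoothM; exact: smooth_flat.
have p0 n x : ~ rat_box ab x -> \prod_(i < N) g n i x = 0.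
  move=> /existsNP[i hi]; apply/eqP; rewrite prodf_seq_eq0.
  by apply/hasP; exists i; rewrite ?mem_index_enum//= g0.
exists (fun n x => \prod_(i < N) g n i x); split => [n|//|x hx].
- split; [exact: smooth_prod| |by move=> x; exact: prod01].
  exists [set x : X | forall i, `[a i, b i]%classic (x ord0 i)].
    apply: (@rV_compact _ _ (fun i => `[a i, b i]%classic)) => i.
    exact: segment_compact.
  move=> x hx; apply: p0 => hx'; apply: hx => i /=.
  by rewrite in_itv/=; have /andP[h1 h2] := hx' i; rewrite !ltW.
- suff h : \prod_(i < N) g n i x @[n --> \oo] --> \prod_(i < N) (1 : R).
    have e : \prod_(i < N) (1 : R) = 1 by rewrite big1.
    by rewrite e in h.
  apply: cvg_big => [|i _]; first exact: mul_continuous.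
  have /andP[h1 h2] := hx i.
  by rewrite -[X in _ --> X]mulr1; apply: cvgM; apply: cvg_flat1; rewrite subr_gt0.
Qed.

(** The combination [1 - prod_(k < n) (1 - phi k n)] is supported in the union of the
    supports and dominates each of its terms. *)
Lemma bump_approximable_bigcup (A : nat -> set X) :
  (forall k, bump_approximable (A k)) -> bump_approximable (\bigcup_k A k).
Proof.
move=> /choice[phi hphi].
pose psi n x := 1 - \prod_(k <- iota 0 n) (1 - phi k n x).
have b k n : bump_function (phi k n) by case: (hphi k).
have r01 k n x : 0 <= 1 - phi k n x <= 1.
  by have /andP[? ?] := bump_range (b k n) x; apply/andP; split; lra.
have psi0 n x : (forall k, phi k n x = 0) -> psi n x = 0.
  by move=> h; rewrite /psi big1 ?subrr// => k _; rewrite h subr0.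
exists psi; split => [n|n x hx|x [k _ hx]].
- split.
  + apply: smoothC; apply: smooth_prod => k; apply: smoothC.
    exact: bump_smooth (b k n).
  + have /choice[K hK] : forall k, exists K, compact K /\ forall x, ~ K x -> phi k n x = 0.
      by move=> k; have [K cK hK] := bump_support (b k n); exists K.
    exists (\big[setU/set0]_(k <- iota 0 n) K k).
      elim: (iota 0 n) => [|k s IH]; first by rewrite big_nil; exact: compact0.
      by rewrite big_cons; apply: compactU => //; case: (hK k).
    move=> x hx; rewrite /psi big_seq big1 ?subrr// => k kn.
    rewrite (hK k).2 ?subr0// => Kx; apply: hx.
    elim: (iota 0 n) kn => // j s IH; rewrite inE big_cons => /orP[/eqP <-|/IH]; first by left.
    by right.
  + move=> x; rewrite /psi; have /andP[? ?] := prod01 (iota 0 n) (fun k => r01 k n x).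
    by apply/andP; split; lra.
- apply: psi0 => k; have [_ h _] := hphi k; apply: h => Akx; apply: hx; by exists k.
- have [_ _ h] := hphi k.
  apply: (@squeeze_cvgr _ _ _ _ (phi k ^~ x) (fun=> 1)); [|exact: h|exact: cvg_cst].
  near=> n.
  have kn : (k < n)%N by near: n; exact: nbhs_infty_gt.
  have kiota : k \in iota 0 n by rewrite mem_iota.
  have /andP[h1 _] := prod01 (iota 0 n) (fun k => r01 k n x).
  have h2 : \prod_(k <- iota 0 n) (1 - phi k n x) <= 1 - phi k n x.
    rewrite (perm_big _ (perm_to_rem kiota)) big_cons ler_piMr//.
      by case/andP: (r01 k n x).
    by case/andP: (prod01 (rem k (iota 0 n)) (fun k => r01 k n x)).
  by rewrite /psi; apply/andP; split; lra.
Unshelve. all: by end_near. Qed.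

Lemma open_bump_approximable (A : set X) : open A -> bump_approximable A.
Proof.
move=> oA; rewrite (open_box_seq oA); apply: bump_approximable_bigcup => k.
rewrite /box_seq; case: unpickle => [ab|]; last exact: bump_approximable0.
by case: pselect => h /=; [exact: bump_approximable_box|exact: bump_approximable0].
Qed.

End smooth_class.

(** * Weak gradients and translations of open sets *)

Section shift.
Context {R : realType} {N : nat}.
Local Notation X := 'rV[R]_N.
Local Notation leb := (@lebesgue_rV R N).

Definition integ (f : X -> R) := leb.-integrable setT (EFin \o f).

Lemma continuous_measurable_rV (f : X -> R) : continuous f -> measurable_fun setT f.
Proof.
move=> /continuousP cf; apply: (measurability _ (RGenOpens.measurableE R)).
move=> _ [_ [a [b ->] <-]]; rewrite setTI; apply: open_measurable_rV.
by apply: cf; exact: interval_open.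
Qed.

Lemma integ_measurable f : integ f -> measurable_fun setT f.
Proof. by move=> /measurable_int /measurable_EFinP. Qed.

Lemma integ_le (f g : X -> R) : measurable_fun setT f -> integ g ->
  (forall x, `|f x| <= `|g x|) -> integ f.
Proof.
move=> mf ig h; apply: (le_integrable measurableT _ _ ig).
  exact/measurable_EFinP.
by move=> x _; rewrite /= lee_fin.
Qed.

Lemma integZ (f : X -> R) c : integ f -> integ (fun x => c * f x).
Proof.
move=> fi; rewrite /integ (_ : EFin \o _ = (fun x => c%:E * (EFin \o f) x)%E).
  exact: integrableZl.
by apply/funext => x /=; rewrite EFinM.
Qed.

Lemma integN (f : X -> R) : integ f -> integ (fun x => - f x).
Proof.
move=> /(integZ (-1)); congr integ; apply/funext => x; by rewrite mulN1r.
Qed.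

Lemma integD (f g : X -> R) : integ f -> integ g -> integ (fun x => f x + g x).
Proof.
move=> fi gi; rewrite /integ (_ : EFin \o _ = ((EFin \o f) \+ (EFin \o g))%E).
  exact: integrableD.
by apply/funext => x /=; rewrite EFinD.
Qed.

Lemma integB (f g : X -> R) : integ f -> integ g -> integ (fun x => f x - g x).
Proof. by move=> fi gi; apply: integD => //; exact: integN. Qed.

Lemma integ_norm (f : X -> R) : integ f -> integ (fun x => `|f x|).
Proof.
move=> fi; apply: (integ_le _ fi) => [|x]; last by rewrite normr_id.
by apply: measurableT_comp => //; exact: integ_measurable.
Qed.

Lemma integM_bounded (f g : X -> R) B : integ f -> measurable_fun setT g ->
  (forall x, `|g x| <= B) -> integ (fun x => f x * g x).
Proof.
move=> fi mg gB; apply: (integ_le _ (integZ B fi)).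
  by apply: measurable_funM => //; exact: integ_measurable.
move=> x; rewrite !normrM mulrC ler_wpM2r// (le_trans (gB x))//.
exact: ler_norm.
Qed.

Lemma norm_indic_le1 (A : set X) x : `|\1_A x : R| <= 1.
Proof. by rewrite indicE; case: (_ \in _); rewrite ?normr1 ?normr0. Qed.

Lemma integ_indic (f : X -> R) A : integ f -> measurable A ->
  integ (fun x => f x * \1_A x).
Proof.
move=> fi mA; apply: (integM_bounded fi) => [|x]; last exact: norm_indic_le1.
exact: measurable_indic.
Qed.

Lemma le_norm_Rint (f g : X -> R) : integ f -> integ g ->
  (forall x, `|f x| <= g x) -> `|\int[leb]_x f x| <= \int[leb]_x g x.
Proof.
move=> fi gi h; apply: le_trans (le_normr_Rintegral measurableT fi) _.
by apply: le_Rintegral => //; exact: integ_norm.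
Qed.

Lemma Rint_dominated (f_ : nat -> X -> R) (f g : X -> R) :
  (forall n, measurable_fun setT (f_ n)) -> integ g ->
  (forall n x, `|f_ n x| <= g x) ->
  (forall x, f_ n x @[n --> \oo] --> f x) ->
  \int[leb]_x f_ n x @[n --> \oo] --> \int[leb]_x f x.
Proof.
move=> mf gi fg cf.
have mf' : measurable_fun setT f by apply: measurable_fun_cvg => [n|x _]; [exact: mf|exact: cf].
have fg' x : `|f x| <= g x.
  by apply: (ler_cvg_to (cvg_norm (cf x)) (cvg_cst (g x))); apply: nearW => n; exact: fg.
have fi : integ f.
  by apply: (integ_le mf' gi) => x; apply: le_trans (fg' x) (ler_norm _).
apply: fine_cvg; rewrite fineK; last exact: integrable_fin_num fi.
apply: (@dominated_cvg _ _ _ _ _ measurableT (fun n x => (f_ n x)%:E)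
  (EFin \o f) (EFin \o g)) => //.
- by move=> n; exact/measurable_EFinP.
- by move=> x _; apply/cvg_EFin; [exact: nearW|exact: cf].
- by move=> n x _; rewrite /= lee_fin.
Qed.

Lemma smooth_measurable (f : X -> R) : smooth f -> measurable_fun setT f.
Proof. by move=> /smooth_partial[cf _]; exact: continuous_measurable_rV. Qed.

(** The derivative vanishes off the compact support, hence is bounded; this is the
    domination needed to differentiate under the integral. *)
Lemma bump_partial_bounded (f : X -> R) i : bump_function f -> exists g,
  [/\ smooth g, forall x, is_derive x (unit_vec i) f (g x) &
      exists B, forall x, `|g x| <= B].
Proof.
move=> bf; have [_ /(_ i)[g sg dg]] := smooth_partial (bump_smooth bf).
exists g; split => //; have [K cK hK] := bump_support bf.
have [cg _] := smooth_partial sg.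
have g0 x : ~ K x -> g x = 0.
  move=> nKx; have oK : open (~` K).
    by apply: closed_openC; apply: compact_closed => //; exact: norm_hausdorff.
  have D : is_derive x (unit_vec i) f 0.
    apply: near_eq_is_derive (is_derive_cst 0 x (unit_vec i)).
    have : \forall y \near x, (~` K) y by exact: open_nbhs_nbhs.
    by apply: filterS => y /hK.
  by have [_ <-] := dg x; have [_ ->] := D.
have : compact [set g x | x in K].
  by apply: continuous_compact => //; exact: continuous_subspaceT.
move=> /compact_bounded[M [_ hM]]; exists (Num.max (M + 1) 0) => x.
have [Kx|nKx] := pselect (K x); last by rewrite g0// normr0 le_max lexx orbT.
rewrite le_max; apply/orP; left; apply: (hM (M + 1)); first lra.
by exists x.
Qed.

Lemma translate_bump (f : X -> R) (v : X) : bump_function f -> bump_function (fun x => f (x + v)).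
Proof.
move=> bf; split; first exact: smooth_translate (bump_smooth bf).
  have [K cK hK] := bump_support bf.
  exists [set y - v | y in K].
    apply: continuous_compact => //; apply: continuous_subspaceT => y.
    by apply: (@continuousB _ _ _ id (cst v)); [exact: cvg_id|exact: cst_continuous].
  by move=> x hx; apply: hK => Kx; apply: hx; exists (x + v) => //; rewrite addrK.
by move=> x; exact: bump_range.
Qed.

Variables (f : X -> R) (G : X -> X).
Hypothesis fi : integ f.
Hypothesis Gi : forall i, integ (fun x => G x ord0 i).
Hypothesis wG : weak_gradient f G.

(** The integral of [f] against a translate of [phi] is differentiable in the
    translation parameter, with derivative [- \int G_i phi] by the definition of
    weak gradients.  Conclude by the mean value theorem. *)
Lemma bump_shift (phi : X -> R) i (h : R) : bump_function phi ->
  `|\int[leb]_x (f x * phi (x + h *: unit_vec i)) - \int[leb]_x (f x * phi x)| <=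
  `|h| * \int[leb]_x `|G x ord0 i|.
Proof.
move=> bphi; have [g [sg dg [B hB]]] := bump_partial_bounded i bphi.
set e := unit_vec i; set k := \int[leb]_x `|G x ord0 i|.
pose m s := \int[leb]_x (f x * phi (x + s *: e)).
pose F s x := f x * phi (x + s *: e).
have bt s := translate_bump (s *: e) bphi.
have phi1 x : `|phi x| <= 1.
  by have /andP[h0 h1] := bump_range bphi x; rewrite ger0_norm.
have B0 : 0 <= B by apply: le_trans (hB 0).
have dF s x : is_derive s (1 : R) (F ^~ x) (f x * g (x + s *: e)).
  have D : is_derive s (1 : R) (fun r => phi (x + r *: e)) (g (x + s *: e)).
    exact: (is_derive_line phi x e s (g (x + s *: e))).1 (dg _).
  exact: (is_deriveZ (f x) D).
have iF s : integ (F s).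
  apply: (@integM_bounded _ _ 1) => //.
  exact: smooth_measurable (bump_smooth (bt s)).
have p1 s x : partial1of2 F s x = f x * g (x + s *: e).
  by rewrite /partial1of2 derive1E; have [_ ->] := dF s x.
have dm a : is_derive a (1 : R) m (\int[leb]_x (f x * g (x + a *: e))).
  have Ia : `]a - 1, a + 1[%classic a by rewrite /= in_itv/=; apply/andP; split; lra.
  have hi s : `]a - 1, a + 1[%classic s -> leb.-integrable setT (EFin \o F s).
    by move=> _; exact: iF.
  have hd s x : `]a - 1, a + 1[%classic s -> setT x -> derivable (F ^~ x) s 1.
    by move=> _ _; have [] := dF s x.
  have G0 x : 0 <= `|B * f x| by [].
  have iG : leb.-integrable setT (EFin \o (fun x => `|B * f x|)).
    by apply: integ_norm; exact: integZ.
  have hG s x : `]a - 1, a + 1[%classic s -> setT x -> `|partial1of2 F s x| <= `|B * f x|.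
    move=> _ _; rewrite p1 !normrM mulrC ler_wpM2r// (le_trans (hB _))//.
    exact: ler_norm.
  have d1 := derivable_under_integral measurableT Ia hi hd G0 iG hG.
  have d2 := differentiation_under_integral measurableT Ia hi hd G0 iG hG.
  split => //; rewrite -derive1E; rewrite -/m in d2; rewrite d2.
  by apply: eq_Rintegral => x _; exact: p1.
have dm_le a : `|\int[leb]_x (f x * g (x + a *: e))| <= k.
  have E x : 'D_e (fun y => phi (y + a *: e)) x = g (x + a *: e).
    have D : is_derive x e (fun y => phi (y + a *: e)) (g (x + a *: e)).
      apply/(is_derive_line0 (fun y => phi (y + a *: e)) x e).
      have := (is_derive_line0 phi (x + a *: e) e _).1 (dg _).
      by congr is_derive; apply/funext => r; rewrite addrAC.
    by have [_ ->] := D.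
  have := wG (smooth_test_function (bump_smooth (bt a)) (bump_support (bt a))) i.
  under eq_Rintegral do rewrite E.
  move=> ->; rewrite normrN; apply: le_norm_Rint; [|exact: integ_norm|].
    apply: (@integM_bounded _ _ 1) => //.
    exact: smooth_measurable (bump_smooth (bt a)).
  by move=> x; rewrite normrM ler_piMr.
have -> : \int[leb]_x (f x * phi x) = m 0.
  by apply: eq_Rintegral => x _; rewrite scale0r addr0.
rewrite -/(m h).
have cm a b : {within `[a, b], continuous m}.
  apply: continuous_subspaceT => s.
  by have [/derivable1_diffP/differentiable_continuous] := dm s.
have [h0|h0] := leP 0 h.
  have [c _ ->] := MVT_segment h0 (fun s _ => dm s) (cm _ _).
  by rewrite subr0 normrM mulrC ler_wpM2l.
have [c _ E] := MVT_segment (ltW h0) (fun s _ => dm s) (cm _ _).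
by rewrite distrC E sub0r normrM normrN mulrC ler_wpM2l.
Qed.

(** Approximate the indicator function by bumps, in [bump_shift] and by dominated
    convergence.  The bound does not see the approximation since bumps are at
    most [1]. *)
Lemma indic_shift (A : set X) i (h : R) : open A ->
  `|\int[leb]_x (f x * \1_A (x + h *: unit_vec i)) - \int[leb]_x (f x * \1_A x)| <=
  `|h| * \int[leb]_x `|G x ord0 i|.
Proof.
move=> oA; have [phi [bphi phi0 phi1]] := open_bump_approximable oA.
have cphi x : phi n x @[n --> \oo] --> (\1_A x : R).
  rewrite indicE; have [Ax|nAx] := pselect (A x).
    by rewrite mem_set//; exact: phi1.
  rewrite memNset//; under eq_fun do rewrite phi0//; exact: cvg_cst.
have cint (v : X) : \int[leb]_x (f x * phi n (x + v)) @[n --> \oo] -->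
    \int[leb]_x (f x * \1_A (x + v)).
  apply: (@Rint_dominated _ _ (fun x => `|f x|)).
  - move=> n; apply: measurable_funM; first exact: integ_measurable.
    exact: smooth_measurable (bump_smooth (translate_bump v (bphi n))).
  - exact: integ_norm.
  - move=> n x; rewrite normrM ler_piMr//.
    by have /andP[h0 h1] := bump_range (bphi n) (x + v); rewrite ger0_norm.
  - by move=> x; apply: cvgM; [exact: cvg_cst|exact: cphi].
have E (g : X -> R) : (fun x => f x * g (x + 0)) = (fun x => f x * g x).
  by apply/funext => x; rewrite addr0.
have c0 := cint 0; rewrite E in c0.
have {}c0 : \int[leb]_x (f x * phi n x) @[n --> \oo] --> \int[leb]_x (f x * \1_A x).
  by move: c0; under eq_fun do rewrite E.
apply: (ler_cvg_to (cvg_norm (cvgB (cint (h *: unit_vec i)) c0))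
  (cvg_cst (`|h| * \int[leb]_x `|G x ord0 i|))).
by apply: nearW => n; exact: bump_shift.
Qed.

End shift.

(** * Integrals over sets of a given density *)

Section mass.
Context {R : realType} {N : nat}.
Local Notation X := 'rV[R]_N.
Local Notation leb := (@lebesgue_rV R N).
Implicit Types (f g : X -> R) (A B : set X).

Definition mass f B : R := \int[leb]_w (f w * \1_B w).

Lemma mass_ge0 f B : (forall w, 0 <= f w) -> 0 <= mass f B.
Proof.
by move=> f0; apply: Rintegral_ge0 => w _; rewrite mulr_ge0// indicE.
Qed.

Lemma le_mass f A B : integ f -> (forall w, 0 <= f w) -> measurable A ->
  measurable B -> A `<=` B -> mass f A <= mass f B.
Proof.
move=> fi f0 mA mB AB; apply: le_Rintegral => //; [exact: integ_indic..|].
move=> w _; rewrite ler_wpM2l// !indicE ler_nat.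
have [Aw|nAw] := pselect (A w); last by rewrite memNset.
by rewrite !mem_set//; exact: AB.
Qed.

Lemma mass_setT f : mass f setT = \int[leb]_w f w.
Proof. by apply: eq_Rintegral => w _; rewrite indicT mulr1. Qed.

Lemma massC f B : integ f -> measurable B ->
  mass f (~` B) = \int[leb]_w f w - mass f B.
Proof.
move=> fi mB; rewrite -RintegralB//; last exact: integ_indic.
apply: eq_Rintegral => w _; rewrite !indicE in_setC.
by case: (w \in B) => /=; ring.
Qed.

Lemma mass_dist f g B : integ f -> integ g -> measurable B ->
  mass f B - mass g B <= \int[leb]_w `|f w - g w|.
Proof.
move=> fi gi mB; rewrite -RintegralB//; [|exact: integ_indic..].
apply: le_Rintegral => //.
- by apply: integB; exact: integ_indic.
- by apply: integ_norm; exact: integB.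
- move=> w _; rewrite -mulrBl indicE.
  by case: (w \in B); rewrite ?mulr1 ?mulr0 ?ler_norm.
Qed.

(** The part of [A] outside [B] contributes at most the mass of [D]. *)
Lemma mass_excess f A B D : integ f -> (forall w, 0 <= f w) -> measurable A ->
  measurable B -> measurable D -> A `\` B `<=` D ->
  mass f A <= mass f B + mass f D.
Proof.
move=> fi f0 mA mB mD ABD; rewrite -RintegralD//; [|exact: integ_indic..].
apply: le_Rintegral => //; first exact: integ_indic.
  by apply: integD; exact: integ_indic.
move=> w _; rewrite -mulrDr ler_wpM2l// !indicE -natrD ler_nat.
have [Aw|nAw] := pselect (A w); last by rewrite memNset.
have [Bw|nBw] := pselect (B w).
  by rewrite [w \in B]mem_set// (leq_trans (leq_b1 _))// leq_addr.
by rewrite [w \in D]mem_set ?(leq_trans (leq_b1 _))// ?leq_addl//; exact: ABD.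
Qed.

Lemma mass_cvg0 f (D : nat -> set X) : integ f -> (forall n, measurable (D n)) ->
  (forall w, \forall n \near \oo, ~ D n w) -> mass f (D n) @[n --> \oo] --> 0.
Proof.
move=> fi mD D0.
have -> : 0 = \int[leb]_w (cst 0 : X -> R) w :> R by rewrite Rintegral_cst// mul0r.
apply: (@Rint_dominated _ _ _ _ (fun w => `|f w|)).
- by move=> n; apply: integ_measurable; exact: integ_indic.
- exact: integ_norm.
- by move=> n w; rewrite normrM ler_piMr// norm_indic_le1.
- move=> w; apply: cvg_near_cst; apply: filterS (D0 w) => n nD.
  by rewrite indicE memNset// mulr0.
Qed.

Definition far (r : R) : set X := [set w | r < enorm w].

Lemma open_far r : open (far r).
Proof.
have : continuous (fun w : X => enorm w).
  by move=> w; apply: (@cvg_enorm _ _ _ (nbhs w) _ id); exact: cvg_id.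
by move=> /continuousP/(_ _ (@open_gt R r)).
Qed.

Lemma mass_far_small f e : integ f -> 0 < e ->
  exists r : R, mass f (far r) < e.
Proof.
move=> fi e0.
have : mass f (far n%:R) @[n --> \oo] --> 0.
  apply: mass_cvg0 => // [n|w].
    by apply: open_measurable_rV; exact: open_far.
  near=> n; apply/negP; rewrite -leNgt.
  by near: n; exact: nbhs_infty_ger.
move=> /cvgr_lt /(_ e e0) [n _ /(_ n (leqnn n))] h.
by exists n%:R.
Unshelve. all: by end_near. Qed.

Definition shift_set (v : X) B : set X := [set w | B (w + v)].

Lemma continuous_shift v : continuous (fun w : X => w + v).
Proof.
by move=> w; apply: (@continuousD _ _ _ id (cst v)); [exact: cvg_id|exact: cst_continuous].
Qed.

Lemma open_shift_set v B : open B -> open (shift_set v B).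
Proof. by move=> oB; have /continuousP/(_ _ oB) := @continuous_shift v. Qed.

Lemma closed_shift_set v B : closed B -> closed (shift_set v B).
Proof. by move=> cB; have /continuous_closedP/(_ _ cB) := @continuous_shift v. Qed.

Lemma open_or_closed_shift v B : open_or_closed B -> open_or_closed (shift_set v B).
Proof.
by case=> h; [left; exact: open_shift_set|right; exact: closed_shift_set].
Qed.

(** Move along one coordinate axis at a time; [indic_shift] applies to each step,
    because translates of open sets are open. *)
Lemma mass_shift_open f (G : X -> X) (K : R) B v : integ f ->
  (forall i, integ (fun x => G x ord0 i)) ->
  (forall i, \int[leb]_x `|G x ord0 i| <= K) ->
  weak_gradient f G -> open B ->
  `|mass f (shift_set v B) - mass f B| <= N%:R * K * enorm v.
Proof.
move=> fi Gi GK wG oB.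
have h (s : seq 'I_N) (C : set X) : open C ->
    `|mass f (shift_set (\sum_(i <- s) v ord0 i *: unit_vec i) C) - mass f C| <=
    \sum_(i <- s) enorm v * K.
  elim: s C => [|i s IH] C oC.
    rewrite !big_nil (_ : shift_set 0 C = C) ?subrr ?normr0//.
    by apply/seteqP; split => w; rewrite /shift_set/= addr0.
  rewrite !big_cons; set S := \sum_(j <- s) v ord0 j *: _.
  pose C' := shift_set S C.
  have oC' : open C' by exact: open_shift_set.
  rewrite -(subrK (mass f C') (mass f (shift_set _ C))) -addrA.
  apply: le_trans (ler_normD _ _) _; apply: lerD; last exact: IH.
  apply: le_trans (_ : `|v ord0 i| * \int[leb]_x `|G x ord0 i| <= _).
    apply: le_trans (indic_shift fi Gi wG i (v ord0 i) oC').
    rewrite /mass le_eqVlt; apply/orP; left; apply/eqP; congr (`| _ - _|).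
    apply: eq_Rintegral => w _; congr (_ * _); rewrite !indicE; congr (_%:R).
    by congr (nat_of_bool _); apply/idP/idP; rewrite !inE /C' /shift_set /= addrA.
  by apply: ler_pM => //; [exact: Rintegral_ge0|exact: coord_le_enorm].
have := h (index_enum 'I_N) B oB.
rewrite -[\sum_(i <- _) v ord0 i *: _](row_sum_delta v) => /le_trans; apply.
by rewrite sumr_const card_ord -[_ *+ N]mulr_natl [enorm v * K]mulrC mulrA.
Qed.

(** For a closed set pass to the complement: the total mass is fixed. *)
Lemma mass_shift f (G : X -> X) (K : R) B v : integ f ->
  (forall i, integ (fun x => G x ord0 i)) ->
  (forall i, \int[leb]_x `|G x ord0 i| <= K) ->
  weak_gradient f G -> open_or_closed B ->
  `|mass f (shift_set v B) - mass f B| <= N%:R * K * enorm v.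
Proof.
move=> fi Gi GK wG [oB|cB]; first exact: mass_shift_open wG oB.
have oB := closed_openC cB.
have E C : closed C -> mass f C = \int[leb]_w f w - mass f (~` C).
  by move=> cC; rewrite massC// ?subKr//; exact: closed_measurable_rV.
have cS : closed (shift_set v B) by exact: closed_shift_set.
rewrite (E _ cS) (E _ cB) opprB addrC addrA subrK distrC.
exact: (mass_shift_open v fi Gi GK wG oB).
Qed.

Definition refl_set (x : X) A : set X := [set w | A (x - w)].

Lemma refl_setE x y A : refl_set y A = shift_set (x - y) (refl_set x A).
Proof.
have E w : x - (w + (x - y)) = y - w.
  by rewrite opprD opprB addrCA [x + _]addrC subrK addrC.
by apply/seteqP; split=> w; rewrite /refl_set /shift_set /= E.
Qed.

Lemma continuous_refl x : continuous (fun w : X => x - w).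
Proof.
by move=> w; apply: (@continuousB _ _ _ (cst x) id); [exact: cst_continuous|exact: cvg_id].
Qed.

Lemma open_or_closed_refl x A : open_or_closed A -> open_or_closed (refl_set x A).
Proof.
move=> [oA|cA]; [left|right]; first by have /continuousP/(_ _ oA) := @continuous_refl x.
by have /continuous_closedP/(_ _ cA) := @continuous_refl x.
Qed.

Lemma open_or_closed_measurable A : open_or_closed A -> measurable A.
Proof. by case=> ?; [exact: open_measurable_rV|exact: closed_measurable_rV]. Qed.

(** In the variable [w = x - z] the density no longer depends on [x]. *)
Lemma convolution_mass f x A : integ f -> measurable A ->
  \int[leb]_z (f (x - z) * \1_A z) = mass f (refl_set x A).
Proof.
move=> fi mA.
have mr : measurable (refl_set x A).
  by rewrite -[X in measurable X]setTI; exact: measurable_refl_rV.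
rewrite /mass /Rintegral.
rewrite -(@integral_refl _ _ x (fun w => (f w * \1_(refl_set x A) w)%:E)); last first.
  exact: integ_indic.
congr fine; apply: eq_integral => z _; congr (_ * _)%:E.
rewrite !indicE; congr (nat_of_bool _)%:R.
by apply/idP/idP; rewrite !inE /refl_set /= subKr.
Qed.

End mass.

(** * Densities depending on time *)

Section time.
Context {R : realType}.
Variable T : R.

(** Compactness of [0,T]: a bound [n] that works near each time can be chosen
    uniformly, provided that larger values work as well. *)
Lemma interval_cover (Q : R -> R -> Prop) :
  (forall n m t, n <= m -> Q n t -> Q m t) ->
  (forall t, 0 <= t <= T -> exists n, exists2 d, 0 < d &
     forall s, 0 <= s <= T -> `|s - t| < d -> Q n s) ->
  exists n, forall t, 0 <= t <= T -> Q n t.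
Proof.
move=> Qm Ql.
have /compact_near_coveringP/near_covering_withinP cc := @segment_compact R 0 T.
have : \forall n \near +oo, `[0, T]%classic `<=` Q n.
  apply: cc => t; rewrite /= in_itv/= => /Ql[n [d d0 hd]].
  near=> s m; rewrite /= in_itv/= => sT.
  have nm : n <= m by near: m; apply: nbhs_pinfty_ge; exact: num_real.
  apply: (Qm n) => //; apply: hd => //.
move=> /filter_ex[n hn]; exists n => t tT; apply: hn.
by rewrite /= in_itv.
Unshelve. all: by end_near. Qed.

(** A set of full measure meets every interval of positive length. *)
Lemma ae_dense (P : R -> Prop) t d : {ae (@lebesgue_measure R), forall s, P s} ->
  0 < T -> 0 <= t <= T -> 0 < d -> exists s, [/\ 0 <= s <= T, `|s - t| < d & P s].
Proof.
move=> [B [mB B0 PB]] T0 /andP[t0 tT] d0.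
apply: contrapT => hn.
pose a := Num.max 0 (t - d / 2); pose b := Num.min T (t + d / 2).
have ab : a < b by rewrite /a /b lt_min !gt_max; apply/andP; split; apply/andP; split; lra.
have sub : `[a, b]%classic `<=` B.
  move=> s; rewrite /= in_itv/= /a /b ge_max le_min.
  move=> /andP[/andP[s0 st] /andP[sT s_t]]; apply: PB => Ps; apply: hn.
  exists s; split => //; first by rewrite s0.
  by rewrite ltr_norml; apply/andP; split; lra.
have : (@lebesgue_measure R `[a, b]%classic <= lebesgue_measure B)%E.
  by apply: le_measure => //; rewrite inE.
by rewrite B0 lebesgue_measure_itv/= lte_fin ab -EFinB lee_fin; lra.
Qed.

End time.

Section nonlocal_term.
Context {R : realType} {N : nat}.
Local Notation X := 'rV[R]_N.
Local Notation leb := (@lebesgue_rV R N).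
Variables (T : R) (f : R -> X -> R).
Hypothesis T0 : 0 < T.
Hypothesis f0 : forall t w, 0 <= t <= T -> 0 <= f t w.
Hypothesis fi : forall t, 0 <= t <= T -> integ (f t).
Hypothesis f_cont : forall t e, 0 <= t <= T -> 0 < e -> exists2 d, 0 < d &
  forall s, 0 <= s <= T -> `|s - t| < d -> \int[leb]_w `|f s w - f t w| <= e.

Lemma L1_distC t s :
  \int[leb]_w `|f t w - f s w| = \int[leb]_w `|f s w - f t w|.
Proof. by apply: eq_Rintegral => w _; rewrite distrC. Qed.

Lemma L1_dist_triangle t s r : 0 <= t <= T -> 0 <= s <= T -> 0 <= r <= T ->
  \int[leb]_w `|f t w - f s w| <=
  \int[leb]_w `|f t w - f r w| + \int[leb]_w `|f s w - f r w|.
Proof.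
move=> tT sT rT.
have D a b : 0 <= a <= T -> 0 <= b <= T -> integ (fun w => `|f a w - f b w|).
  by move=> aT bT; apply: integ_norm; apply: integB; exact: fi.
rewrite -RintegralD//; [|exact: D..].
apply: le_Rintegral => //; [exact: D|by apply: integD; exact: D|].
move=> w _; rewrite [`|f s w - _|]distrC (le_trans _ (ler_normD _ _))//.
by rewrite addrA subrK.
Qed.

(** In [interval_cover] the parameter [n] is the inverse of the modulus. *)
Lemma L1_unif_continuous e : 0 < e -> exists2 d, 0 < d &
  forall t s, 0 <= t <= T -> 0 <= s <= T -> `|t - s| < d ->
    \int[leb]_w `|f t w - f s w| <= e.
Proof.
move=> e0.
have [n hn] : exists n, forall t, 0 <= t <= T -> 0 < n /\
    forall s, 0 <= s <= T -> n * `|t - s| < 1 -> \int[leb]_w `|f t w - f s w| <= e.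
  apply: interval_cover => [n m t nm [n0 h]|t tT].
    split; first exact: lt_le_trans nm.
    by move=> s sT ts; apply: h => //; apply: le_lt_trans ts; rewrite ler_wpM2r.
  have e20 : 0 < e / 2 by rewrite divr_gt0.
  have [d d0 hd] := f_cont tT e20.
  have d20 : 0 < 2 / d by rewrite divr_gt0.
  exists (2 / d); exists (d / 2); first by rewrite divr_gt0.
  move=> s sT st; split=> // r rT.
  rewrite mulrAC ltr_pdivrMr// mul1r => sr.
  apply: le_trans (L1_dist_triangle sT rT tT) _.
  rewrite (splitr e); apply: lerD; apply: hd => //; first lra.
  have := ler_distD s r t; rewrite [`|r - s|]distrC; lra.
have n0 : 0 < n by have [] := hn 0; [rewrite lexx ltW|].
exists n^-1; first by rewrite invr_gt0.
move=> t s tT sT ts; apply: (hn t tT).2 => //.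
by rewrite mulrC -ltr_pdivlMr// div1r.
Qed.

Lemma L1_bounded : exists m, forall t, 0 <= t <= T -> \int[leb]_w f t w <= m.
Proof.
apply: interval_cover => [n m t nm h|t tT]; first exact: le_trans nm.
have [d d0 hd] := f_cont tT ltr01.
exists (\int[leb]_w f t w + 1); exists d => // s sT st.
rewrite -lerBlDl -RintegralB//; [|exact: fi..].
apply: le_trans (hd s sT st); apply: le_Rintegral => //.
- by apply: integB; exact: fi.
- by apply: integ_norm; apply: integB; exact: fi.
- by move=> w _; exact: ler_norm.
Qed.

(** Uniform tightness: a continuous curve in [L^1] over a compact interval is a
    compact set of functions. *)
Lemma L1_tight e : 0 < e -> exists r, forall t, 0 <= t <= T -> mass (f t) (far r) <= e.
Proof.
move=> e0.
have mfar r : measurable (@far R N r) by apply: open_measurable_rV; exact: open_far.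
(* The property must be monotone in [r] for every real [t]: it is made vacuous
   outside [0,T], where [f t] need not be integrable. *)
suff [r hr] : exists r, forall t, 0 <= t <= T -> 0 <= t <= T ->
    mass (f t) (far r) <= e by exists r => t tT; exact: hr.
apply: interval_cover => [n m t nm h tT|t tT].
  apply: le_trans (h tT); apply: le_mass => //; [exact: fi|by move=> w; exact: f0|].
  by move=> w; rewrite /far/=; exact: le_lt_trans.
have e20 : 0 < e / 2 by rewrite divr_gt0.
have [r hr] := mass_far_small (fi tT) e20; have [d d0 hd] := f_cont tT e20.
exists r; exists d => // s sT st _.
have := mass_dist (fi sT) (fi tT) (mfar r).
have := hd s sT st; lra.
Qed.

Variable K : R.
Hypothesis f_grad : {ae (@lebesgue_measure R), forall t, 0 <= t <= T ->
  exists G : X -> X, [/\ forall i, integ (fun x => G x ord0 i),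
    forall i, \int[leb]_x `|G x ord0 i| <= K & weak_gradient (f t) G]}.

(** The bound of [mass_shift] holds at almost every time, and both masses are
    continuous in time. *)
Lemma mass_shift_time t v B : 0 <= t <= T -> open_or_closed B ->
  mass (f t) (shift_set v B) <= mass (f t) B + N%:R * K * enorm v.
Proof.
move=> tT oB.
have mB := open_or_closed_measurable oB.
have mS : measurable (shift_set v B).
  by apply: open_or_closed_measurable; exact: open_or_closed_shift.
apply: (@le_eps _ _ _ 1) => e e0; rewrite mulr1.
have e20 : 0 < e / 2 by rewrite divr_gt0.
have [d d0 hd] := f_cont tT e20.
have [s [sT st /(_ sT)[G [Gi GK wG]]]] := ae_dense f_grad T0 tT d0.
have := mass_shift v (fi sT) Gi GK wG oB; rewrite ler_norml => /andP[_].
have := hd s sT st.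
have := mass_dist (fi sT) (fi tT) mB.
have := mass_dist (fi tT) (fi sT) mS; rewrite L1_distC.
clear; lra.
Qed.

End nonlocal_term.

(** * The convolution term *)

Section convolution.
Context {R : realType} {N : nat}.
Local Notation X := 'rV[R]_N.
Local Notation leb := (@lebesgue_rV R N).
Variables (T : R) (c0 c1 : X * R -> R) (u0 : X -> R).

Definition conv_J (x : X) (t : R) (A : set X) : R :=
  \int[leb]_z (c0 (x - z, t) * \1_A z).

Lemma normL1E (g : X -> R) : integ g ->
  'N[leb]_1[EFin \o g]%E = (\int[leb]_x `|g x|)%:E.
Proof.
move=> gi; rewrite Lnorm1 /Rintegral fineK//.
exact: integrable_fin_num (integ_norm gi).
Qed.

Hypothesis c0_cont : continuous_L1 T c0.
Hypothesis c0_grad : gradient_Linfty_L1 T c0.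
Hypothesis c0_ge0 : forall x t, 0 <= t <= T -> 0 <= c0 (x, t).

Lemma c0_integ t : 0 <= t <= T -> integ (fun w => c0 (w, t)).
Proof. by move=> tT; apply/Lfun1_integrable; exact: c0_cont.1. Qed.

Lemma c0_L1_cont t e : 0 <= t <= T -> 0 < e -> exists2 d, 0 < d &
  forall s, 0 <= s <= T -> `|s - t| < d ->
    \int[leb]_w `|c0 (w, s) - c0 (w, t)| <= e.
Proof.
move=> tT e0.
have e0' : (0 < e%:E)%E by rewrite lte_fin.
have := c0_cont.2 t tT => /(_ [set y | (y < e%:E)%E]) h.
have /h : nbhs (0%E : \bar R) [set y | (y < e%:E)%E].
  by apply: open_nbhs_nbhs; split=> //; exact: open_ereal_lt_ereal.
move=> hn.
have : \forall s \near within `[0, T] (nbhs t),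
    ('N[leb]_1[(fun x => (c0 (x, s) - c0 (x, t))%:E)] < e%:E)%E by exact: hn.
rewrite near_withinE => /nbhs_ballP[d /= d0 hd].
exists d => // s sT st.
have /(_ _) := hd s; rewrite /ball/= distrC => /(_ st).
rewrite in_itv/= => /(_ sT).
rewrite (normL1E (integB (c0_integ sT) (c0_integ tT))) lte_fin; exact: ltW.
Qed.

Lemma measurable_strip : measurable (strip T : set (X * R)).
Proof.
rewrite (_ : strip T = setT `*` `[0, T]%classic).
  by apply: measurableX.
by apply/seteqP; split=> -[x t] /=; rewrite /strip/= in_itv/=; [split|case].
Qed.

(** Sections at a fixed time of a jointly measurable map are measurable; this is
    where the joint measurability of the gradient is used. *)
Lemma measurable_section (G : X * R -> X) t : 0 <= t <= T ->
  measurable_fun (strip T) G -> measurable_fun setT (fun x => G (x, t)).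
Proof.
move=> tT mG _ Y mY; rewrite setTI.
have mp : measurable_fun setT (fun x : X => (x, t)).
  by apply/measurable_fun_pairP; split; [exact: measurable_id|exact: measurable_cst].
have := mp measurableT _ (mG measurable_strip _ mY); rewrite setTI.
by congr measurable; apply/seteqP; split=> x /= => [[]|].
Qed.

(** Each coordinate of the gradient is dominated by its Euclidean norm. *)
Lemma c0_gradient_time : exists K : R, {ae (@lebesgue_measure R), forall t, 0 <= t <= T ->
  exists G : X -> X, [/\ forall i, integ (fun x => G x ord0 i),
    forall i, \int[leb]_x `|G x ord0 i| <= K &
    weak_gradient (fun w => c0 (w, t)) G]}.
Proof.
have [G [mG [K hK]]] := c0_grad; exists K.
apply: negligibleS hK => t; apply: contra_not => h tT; have [wG nG] := h tT.
have ms := measurable_section tT mG.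
exists (fun x => G (x, t)).
have mE : measurable_fun setT (fun x => enorm (G (x, t))).
  apply: (measurableT_comp _ ms); apply: continuous_measurable_rV => x.
  by apply: (@cvg_enorm _ _ _ (nbhs x) _ id); exact: cvg_id.
have iE : integ (fun x => enorm (G (x, t))).
  apply/integrableP; split; first exact/measurable_EFinP.
  by rewrite Lnorm1 in nG; apply: le_lt_trans nG _; rewrite ltry.
have iG i : integ (fun x => G (x, t) ord0 i).
  apply: (integ_le _ iE) => [|x].
    exact: (measurableT_comp (measurable_rV_coord i) ms).
  by rewrite [leRHS]ger0_norm ?enorm_ge0// coord_le_enorm.
split => // i; rewrite (normL1E iE) lee_fin in nG.
apply: le_trans nG; apply: le_Rintegral => //; [exact: integ_norm..|].
by move=> x _; rewrite [leRHS]ger0_norm ?enorm_ge0// coord_le_enorm.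
Qed.

Lemma conv_JE x t A : 0 <= t <= T -> open_or_closed A ->
  conv_J x t A = mass (fun w => c0 (w, t)) (refl_set x A).
Proof.
move=> tT oA; apply: (convolution_mass x (c0_integ tT)).
exact: open_or_closed_measurable.
Qed.

Lemma measurable_refl_set (x : X) A : open_or_closed A -> measurable (refl_set x A).
Proof. by move=> oA; apply: open_or_closed_measurable; exact: open_or_closed_refl. Qed.

Hypothesis T0 : 0 < T.
Hypothesis u0_bounded : bounded_fun u0.
Hypothesis u0_unif : unif_continuous u0.
Hypothesis c1_continuous : {within strip T, continuous c1}.
Hypothesis c1_bounds : exists M1 L1 : R,
     (forall x t, 0 <= t <= T -> `|c1 (x, t)| <= M1) /\
     (forall x y t, 0 <= t <= T ->
        `|c1 (x, t) - c1 (y, t)| <= L1 * enorm (x - y)).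

Lemma convolution_nonlocal_data :
  exists m0 M1 L L1 A, nonlocal_data T conv_J c1 u0 m0 M1 L L1 A.
Proof.
pose f t w := c0 (w, t).
have f0 t w : 0 <= t <= T -> 0 <= f t w by exact: c0_ge0.
have fi t : 0 <= t <= T -> integ (f t) by exact: c0_integ.
have fc := c0_L1_cont.
have [m0 hm0] := L1_bounded fi fc.
have [M1 [L1 [hM1 hL1]]] := c1_bounds.
have [K hK] := c0_gradient_time.
have [A hA] : exists A, forall x, `|u0 x| <= A.
  have [M [_ hM]] := u0_bounded; exists (M + 1) => x.
  by apply: hM => //; rewrite ltrDl.
pose L := N%:R * Num.max K 0.
exists m0, M1, L, (Num.max L1 0), A.
have lipL t v B : 0 <= t <= T -> open_or_closed B ->
    mass (f t) (shift_set v B) <= mass (f t) B + L * enorm v.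
  move=> tT oB; apply: le_trans (mass_shift_time T0 fi fc hK v tT oB) _.
  by rewrite lerD2l ler_wpM2r ?enorm_ge0// ler_wpM2l// le_max lexx.
split => //.
- by rewrite mulr_ge0// le_max lexx orbT.
- by rewrite le_max lexx orbT.
- move=> x t Z tT oZ; rewrite conv_JE//; apply/andP; split.
    by apply: mass_ge0 => w; exact: f0.
  apply: le_trans (hm0 t tT); rewrite -mass_setT.
  apply: le_mass => //; [exact: fi|by move=> w; exact: f0|exact: measurable_refl_set].
- move=> e e0; have [d d0 hd] := L1_unif_continuous T0 fi fc e0.
  exists d => // x y t s Z tT sT oZ ts; rewrite !conv_JE//.
  rewrite [in leRHS]enorm_distC.
  have oZx := open_or_closed_refl x oZ; have oZy := open_or_closed_refl y oZ.
  have := lipL s (y - x) _ sT oZy; rewrite -refl_setE => h1.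
  apply: le_trans (_ : e + mass (f s) (refl_set x Z) <= _); last first.
    by rewrite addrC lerD2r.
  rewrite -lerBlDr; apply: le_trans (hd t s tT sT ts).
  exact: mass_dist (fi t tT) (fi s sT) (measurable_refl_set x oZ).
- move=> x t Y Z tT oY oZ YZ; rewrite !conv_JE//.
  apply: le_mass; [exact: fi|by move=> w; exact: f0|exact: measurable_refl_set..|].
  by move=> w /=; exact: YZ.
- move=> e e0; have [r hr] := L1_tight f0 fi fc e0.
  exists r => x t Y Z tT oY oZ YZ; rewrite !conv_JE//.
  apply: le_trans (_ : mass (f t) (refl_set x Z) + mass (f t) (far r) <= _); last first.
    by rewrite lerD2l; exact: hr.
  apply: mass_excess; [exact: fi|by move=> w; exact: f0|exact: measurable_refl_set..| |].
    by apply: open_measurable_rV; exact: open_far.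
  move=> w [/= Yw nZw]; rewrite /far/= ltNge; apply/negP => wr; apply: nZw.
  by apply: YZ => //; rewrite subKr.
- move=> x t Y Z e tT e0 oY oZ YZ.
  pose D n := refl_set x (Y n) `\` refl_set x (Z n).
  have mD n : measurable (D n) by apply: measurableD; exact: measurable_refl_set.
  have := @mass_cvg0 _ _ (f t) D (fi t tT) mD.
  have Dz w : \forall n \near \oo, ~ D n w.
    by apply: filterS (YZ (x - w)) => n h [/= Yw]; apply; exact: h.
  move=> /(_ Dz)/cvgr_le/(_ e e0); apply: filterS => n hn; rewrite !conv_JE//.
  apply: le_trans (_ : mass (f t) (refl_set x (Z n)) + mass (f t) (D n) <= _).
    by apply: mass_excess; [exact: fi|by move=> w; exact: f0|exact: measurable_refl_set..| |].
  by rewrite lerD2l.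
- move=> x y t tT; apply: le_trans (hL1 x y t tT) _.
  by rewrite ler_wpM2r ?enorm_ge0// le_max lexx.
Qed.

End convolution.

Theorem theorem1p4 (R : realType) (N : nat) (T : R)
  (c0 c1 : 'rV[R]_N * R -> R) (u0 : 'rV[R]_N -> R)
  (hN : (1 <= N)%N) (hT : 0 < T)
  (u0_bounded : bounded_fun u0) (u0_unif : unif_continuous u0)
  (c0_continuous : continuous_L1 T c0)
  (c0_gradient : gradient_Linfty_L1 T c0)
  (c0_ge0 : forall x t, 0 <= t <= T -> 0 <= c0 (x, t))
  (c1_continuous : {within strip T, continuous c1})
  (c1_bounds : exists M1 L1 : R,
     (forall x t, 0 <= t <= T -> `|c1 (x, t)| <= M1) /\
     (forall x y t, 0 <= t <= T ->
        `|c1 (x, t) - c1 (y, t)| <= L1 * enorm (x - y))) :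
  exists u : 'rV[R]_N * R -> R,
    viscosity_solution T c0 c1 u0 u /\
    forall v, viscosity_solution T c0 c1 u0 v ->
      forall x t, 0 <= t <= T -> v (x, t) = u (x, t).
Proof.
have [m0 [M1 [L [L1 [A D]]]]] := convolution_nonlocal_data c0_continuous
  c0_gradient c0_ge0 hT u0_bounded u0_unif c1_continuous c1_bounds.
have subE w : subsolution T c0 c1 u0 w <-> nonlocal_sub T (conv_J c0) c1 u0 w.
  by split=> -[h1 h2]; split => //; exact/usc_on_stripP.
have superE w : supersolution T c0 c1 u0 w <-> nonlocal_super T (conv_J c0) c1 u0 w.
  have E : w = \- (\- w) by apply/funext => p; rewrite /= opprK.
  split=> -[h1 h2]; split => //.
    by apply/usc_on_stripP; rewrite /usc_on_strip -E.
  by rewrite E; exact/usc_on_stripP.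
have [u [[bu [su su']] uniq]] := nonlocal_existence_uniqueness D.
exists u; split; first by split => //; [exact/subE|exact/superE].
move=> v [bv /subE sv /superE sv'] x t tT.
exact: uniq.
Qed.
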